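(* Let $M^2$ be a connected $2$-manifold and let $f: M^2\to S^5\subset \mathbf{C}^3$ be a nonminimal Legendre surface in the unit $5$-sphere whose mean curvature vector field $H$ satisfies $\Delta^D H=0$. Then the following hold. (i) The mean curvature function $\|H\|$ of $M^2$ is not constant. (ii) If $(\phi H)\|H\|^2=0$, then $f$ is locally given (up to an isometry of $S^5$) by $$f(x,y)=\bigl(z(y)\cos x,\ \sin x\bigr),$$ where $z(y)$ is a unit speed Legendre curve with nonzero constant curvature in the unit sphere $S^3(1)\subset\mathbf{C}^2$. (iii) If $(\phi H)^{\perp}\|H\|^2=0$, then $f$ is locally given (up to an isometry of $S^5$) by $$f(x,y)=\bigl(z_1(x),\ z_2(x)\cos y,\ z_2(x)\sin y\bigr),$$ where $(z_1,z_2)$ is the unit speed Legendre curve in $S^3(1)\subset\mathbf{C}^2$ given by $$z_1(x)=\frac{ib+\sin x}{\sqrt{1+b^2}},\qquad z_2(x)=\frac{\exp\bigl(ib\ln(\sec x+\tan x)\bigr)\cos x}{\sqrt{1+b^2}}$$ for some nonzero real number $b$.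
   Context: Let $\mathbf{C}^{n+1}$ be complex Euclidean space with its standard complex structure $J$ and standard real inner product $\langle\cdot,\cdot\rangle$, and let $S^{2n+1}\subset\mathbf{C}^{n+1}$ be the unit sphere with induced metric $g$ and position vector field $\mathbf{x}$. Put $\xi=-J\mathbf{x}$, a unit tangent vector field on $S^{2n+1}$, and define a $1$-form $\eta$ and an endomorphism field $\phi$ of $TS^{2n+1}$ by $JX=\phi X+\eta(X)\mathbf{x}$ for $X$ tangent to $S^{2n+1}$ (so $\eta(X)=g(X,\xi)$). An immersion $f:M^n\to S^{2n+1}$ of an $n$-manifold (with the induced metric on $M^n$) is Legendre if $f^*\eta=0$. For $n=2$ it is called a Legendre surface; for $n=1$ a Legendre curve. Let $\nabla$ be the Levi-Civita connection of $M^n$, $h$ the second fundamental form of $M^n$ in $S^{2n+1}$, and $D$ the normal connection in $S^{2n+1}$. The mean curvature vector field is $H=\frac1n\,\mathrm{trace}\,h$, and its length $\|H\|$ is the mean curvature function. Nonminimal means that $H$ is not identically zero. The normal Laplacian is $$\Delta^D=-\sum_{i=1}^n\bigl(D_{e_i}D_{e_i}-D_{\nabla_{e_i}e_i}\bigr),$$ where $\{e_i\}$ is a local orthonormal frame of $M^n$. For a Legendre surface, the vector field $\phi H$ is tangent to $M^2$. Where $H\neq 0$, $(\phi H)^{\perp}$ denotes the tangent unit vector field on $M^2$ orthogonal to $\phi H$ (unique up to sign). For a tangent vector field $V$, the expression $V\|H\|^2$ denotes the derivative of the function $\|H\|^2$ along $V$; the condition $(\phi H)^{\perp}\|H\|^2=0$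 is understood at points where $H\neq0$. The curvature of a unit speed Legendre curve $z$ in $S^3(1)\subset\mathbf{C}^2$ is its geodesic curvature in $S^3(1)$. Equivalently, it is the real function $\lambda$ (up to sign) with $z''=i\lambda z'-z$. ''Locally given by'' means that around each point of $M^2$ there are local coordinates $(x,y)$ in which $f$, after composition with an isometry of $S^5$, has the stated form. In (iii), $x$ ranges in an interval on which $\cos x>0$, so that $\sec x+\tan x>0$ and $\ln$ is the real logarithm. In (ii), $(z(y)\cos x,\sin x)$ denotes a point of $\mathbf{C}^2\times\mathbf{C}=\mathbf{C}^3$. *)

(* Defs.v *)
From HB Require Import structures.
From mathcomp Require Import all_boot all_order all_algebra.
From mathcomp Require Import all_classical all_reals all_analysis.
From mathcomp Require Import complex.

Set Implicit Arguments.
Unset Strict Implicit.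
Unset Printing Implicit Defensive.

Import Order.TTheory GRing.Theory Num.Theory.
Import numFieldNormedType.Exports.

Local Open Scope classical_set_scope.
Local Open Scope ring_scope.

(* C^oo on the open set [U]: all iterated directional derivatives of [f]
   exist and are (Frechet) differentiable at every point of [U]. *)
Definition smooth_on (R : realType) (V W : normedModType R)
    (U : set V) (f : V -> W) : Prop :=
  forall (vs : seq V) (x : V), U x ->
    differentiable (foldr (fun v g => 'D_v g) f vs) x.

Section Manifold.
Variables (R : realType) (M : topologicalType) (n : nat).

(* [coord] and [param] are meaningful only on [dom] and [cod]. *)
Record chart := Chart {
  dom : set M;
  cod : set 'rV[R]_n;
  coord : M -> 'rV[R]_n;
  param : 'rV[R]_n -> M;
  dom_open : open dom;
  cod_open : open cod;
  coord_cod : forall p, dom p -> cod (coord p);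
  param_dom : forall x, cod x -> dom (param x);
  coordK : forall p, dom p -> param (coord p) = p;
  paramK : forall x, cod x -> coord (param x) = x;
  coord_continuous : {within dom, continuous coord};
  param_continuous : {within cod, continuous param} }.

Definition smoothly_compatible (c c' : chart) : Prop :=
  smooth_on (cod c `&` param c @^-1` dom c') (coord c' \o param c) /\
  smooth_on (cod c' `&` param c' @^-1` dom c) (coord c \o param c').

Record smooth_structure := SmoothStructure {
  atlas : set chart;
  atlas_cover : forall p, exists2 c, atlas c & dom c p;
  atlas_compatible : forall c c', atlas c -> atlas c' ->
    smoothly_compatible c c';
  atlas_maximal : forall c,
    (forall c', atlas c' -> smoothly_compatible c c') -> atlas c }.

End Manifold.

(* A vector of C^m is a 2 x m real matrix: row 0 holds the real parts and row 1
   the imaginary parts of its m complex coordinates, so that [row_mx]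
   concatenates complex coordinates. *)
Notation cvect R m := 'M[R]_(2, m).

Section ComplexSpace.
Variable R : realType.

Definition dot m (u v : cvect R m) : R := \sum_k \sum_j u k j * v k j.

(* Not the norm [`|u|] of the library, which is the maximum norm. *)
Definition enorm m (u : cvect R m) : R := Num.sqrt (dot u u).

Definition J m (u : cvect R m) : cvect R m :=
  \matrix_(k, j) (if k == 0 then - u 1 j else u 0 j).

Definition sphere m : set (cvect R m) := [set u | enorm u = 1].

(* The splitting J X = phi X + eta(X) p at the point p of the sphere. *)
Definition eta m (p X : cvect R m) : R := dot (J X) p.
Definition phi m (p X : cvect R m) : cvect R m := J X - eta p X *: p.

(* Riemannian isometries of the unit sphere; a map of the sphere is given by a
   map of the ambient space that is smooth near the sphere. *)
Definition sphere_isometry m (A : cvect R m -> cvect R m) : Prop :=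
  [/\ exists U : set (cvect R m),
        [/\ open U, @sphere m `<=` U & smooth_on U A],
      set_bij (@sphere m) (@sphere m) A &
      forall p X Y, sphere p -> dot X p = 0 -> dot Y p = 0 ->
        dot ('D_X A p) ('D_Y A p) = dot X Y].

Definition cnum (w : R[i]) : cvect R 1 :=
  \matrix_(k, _) (if k == 0 then complex.Re w else complex.Im w).

Definition cexp (w : R[i]) : R[i] :=
  ((expR (complex.Re w))%:C * (cos (complex.Im w) +i* sin (complex.Im w)))%C.

Definition sec (x : R) : R := (cos x)^-1.

End ComplexSpace.

(* Geometry of an immersion F into the unit sphere of C^m, written in local
   coordinates: vectors tangent to the ambient space are elements of C^m,
   vectors tangent to the source are rows of coordinates. *)
Section Immersion.
Variables (R : realType) (n m : nat) (F : 'rV[R]_n -> cvect R m).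

Let del (i : 'I_n) : 'rV[R]_n := delta_mx 0 i.

Definition metric (x u v : 'rV[R]_n) : R := dot ('D_u F x) ('D_v F x).

Definition gram (x : 'rV[R]_n) : 'M[R]_n :=
  \matrix_(i, j) metric x (del i) (del j).

(* Coordinates of the tangential component of an ambient vector; if w is itself
   tangent to the immersed submanifold, w = 'D_(tangent_coord x w) F x. *)
Definition tangent_coord (x : 'rV[R]_n) (w : cvect R m) : 'rV[R]_n :=
  \row_k \sum_l invmx (gram x) k l * dot w ('D_(del l) F x).

(* Orthogonal projection onto the normal space inside the sphere. *)
Definition normal_part (x : 'rV[R]_n) (w : cvect R m) : cvect R m :=
  w - 'D_(tangent_coord x w) F x - dot w (F x) *: F x.

Definition second_fundamental_form (x u v : 'rV[R]_n) : cvect R m :=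
  normal_part x ('D_u ('D_v F) x).

Definition mean_curvature_vector (x : 'rV[R]_n) : cvect R m :=
  n%:R^-1 *: \sum_i \sum_j
    invmx (gram x) i j *: second_fundamental_form x (del i) (del j).

(* [christoffel x k i j] is Gamma^k_ij of the induced metric. *)
Definition christoffel (x : 'rV[R]_n) (k i j : 'I_n) : R :=
  2^-1 * \sum_l invmx (gram x) k l *
    ('D_(del i) (fun y => gram y j l) x + 'D_(del j) (fun y => gram y i l) x
     - 'D_(del l) (fun y => gram y i j) x).

Definition levi_civita (X Y : 'rV[R]_n -> 'rV[R]_n) (x : 'rV[R]_n) : 'rV[R]_n :=
  'D_(X x) Y x +
  \row_k \sum_i \sum_j christoffel x k i j * X x 0 i * Y x 0 j.

Definition normal_connection (X : 'rV[R]_n -> 'rV[R]_n)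
    (N : 'rV[R]_n -> cvect R m) (x : 'rV[R]_n) : cvect R m :=
  normal_part x ('D_(X x) N x).

Definition orthonormal_frame (W : set 'rV[R]_n)
    (e : 'I_n -> 'rV[R]_n -> 'rV[R]_n) : Prop :=
  (forall i, smooth_on W (e i)) /\
  (forall x i j, W x -> metric x (e i x) (e j x) = (i == j)%:R).

Definition normal_laplacian (e : 'I_n -> 'rV[R]_n -> 'rV[R]_n)
    (N : 'rV[R]_n -> cvect R m) (x : 'rV[R]_n) : cvect R m :=
  - \sum_i (normal_connection (e i) (normal_connection (e i) N) x
            - normal_connection (levi_civita (e i) (e i)) N x).

(* The derivatives (phi H)||H||^2 and, for every unit tangent vector orthogonal
   to phi H, (phi H)^perp ||H||^2 at the point of coordinates x. *)
Definition mean_curvature_constant_along_phiH (x : 'rV[R]_n) : Prop :=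
  let phiH := phi (F x) (mean_curvature_vector x) in
  'D_(tangent_coord x phiH)
    (fun y => enorm (mean_curvature_vector y) ^+ 2) x = 0.

Definition mean_curvature_constant_along_phiH_perp (x : 'rV[R]_n) : Prop :=
  let phiH := phi (F x) (mean_curvature_vector x) in
  mean_curvature_vector x != 0 ->
  forall v : 'rV[R]_n, metric x v v = 1 -> dot ('D_v F x) phiH = 0 ->
    'D_v (fun y => enorm (mean_curvature_vector y) ^+ 2) x = 0.

End Immersion.

(* H and the normal Laplacian do not depend on the coordinates, so conditions on
   them are imposed in every chart of the (maximal) atlas. *)
Section Submanifold.
Variables (R : realType) (M : topologicalType) (n m : nat).
Variables (S : smooth_structure R M n) (f : M -> cvect R m).

Definition in_charts
    (P : ('rV[R]_n -> cvect R m) -> set 'rV[R]_n -> 'rV[R]_n -> Prop) : Prop :=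
  forall (c : chart R M n) (x : 'rV[R]_n), atlas S c -> cod c x ->
    P (f \o param c) (cod c) x.

Definition legendre_immersion : Prop :=
  [/\ forall p, sphere (f p),
      forall c, atlas S c -> smooth_on (cod c) (f \o param c),
      in_charts (fun F _ x => forall v, 'D_v F x = 0 -> v = 0) &
      in_charts (fun F _ x => forall v, eta (F x) ('D_v F x) = 0)].

Definition minimal : Prop :=
  in_charts (fun F _ x => mean_curvature_vector F x = 0).

Definition constant_mean_curvature : Prop :=
  exists k : R, in_charts (fun F _ x => enorm (mean_curvature_vector F x) = k).

Definition harmonic_mean_curvature_vector : Prop :=
  in_charts (fun F U x => forall (W : set 'rV[R]_n) e,
    open W -> W `<=` U -> W x -> orthonormal_frame F W e ->
    normal_laplacian F e (mean_curvature_vector F) x = 0).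

End Submanifold.

Section Curves.
Variable R : realType.

Definition unit_speed_legendre_curve m (I : set R) (z : R -> cvect R m) : Prop :=
  [/\ smooth_on (I : set R^o) (z : R^o -> cvect R m),
      forall t, I t -> sphere (z t),
      forall t, I t -> enorm (derive1 z t) = 1 &
      forall t, I t -> eta (z t) (derive1 z t) = 0].

(* Length of the covariant derivative, in the unit sphere, of the velocity of a
   unit speed curve. *)
Definition geodesic_curvature m (z : R -> cvect R m) (t : R) : R :=
  let z'' := derive1 (derive1 z) t in enorm (z'' - dot z'' (z t) *: z t).

Definition open_interval (I : set R) : Prop := open I /\ is_interval I.

Definition z1 (b x : R) : R[i] :=
  (('i * b%:C + (sin x)%:C) / (Num.sqrt (1 + b ^+ 2))%:C)%C.

Definition z2 (b x : R) : R[i] :=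
  (cexp ('i * (b * ln (sec x + tan x))%:C) * (cos x)%:C
   / (Num.sqrt (1 + b ^+ 2))%:C)%C.

End Curves.

(* Main.v *)
(* On the open set where H <> 0 take the orthonormal frame e1, e2 with
   H = r J E1, where E1, E2 are the derivatives of the immersion along e1, e2,
   and let w1, w2 be the coefficients of its Levi-Civita connection.  The
   equation Delta^D H = 0 then amounts to D1 r = - r w2, D2 r = r w1 and Gauss
   curvature D2 w1 - D1 w2 - w1^2 - w2^2 = 1.  If r is constant then
   w1 = w2 = 0, which contradicts the last equation.  In case (ii) w2 = 0, in
   case (iii) w1 = 0; the Gauss equation s (r - s) = q^2 and the Codazzi
   equations for the components q = C_112 and s = C_122 of the cubic form are
   then overdetermined and force s = q = 0, respectively s = r and q = 0.  With w
   the remaining connection coefficient, r^2 / (1 + w^2) is locally constant and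
   bounded by r^2, so by connectedness H vanishes nowhere; in suitable unitary
   frames the structure equations become linear with constant coefficients, up
   to reparametrization, and are integrated explicitly. *)

(* The component of [Delta^D H = 0] along [J F] gives [D1 r], the one along [J E1] gives the
   curvature, and the traced Codazzi equations give [D2 r]. Since the trace of the cubic form leaves
   [p = 2 r - s] and [t = - q], the curvature is [1 + 2 (s (r - s) - q^2)]; hence the algebraic
   relation. Exchanging [e1] and [e2] and replacing [w1], [s] by [- w2], [r - s] carries case (ii)
   into case (iii), so one rigidity argument serves both. The quotient [r^2 / (1 + w^2)] is a first
   integral because [r] and [sqrt (1 + w^2)] have the same logarithmic derivative; its root is [b]
   in (iii) and half the curvature of [z] in (ii). The adapted frame exists only where [H] is
   nonzero, whereas the conclusion concerns every point of [M]: this is why nonvanishing has to be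
   propagated. No existence theorem for differential equations is invoked: the coordinates are
   arctangents of known functions, the solutions are written down, and agreement with them follows
   from conservation of a squared norm. The coordinate vector fields are known beforehand, so the
   inverse function theorem is set up with the inverse Jacobian as data. *)
Require Import Defs.
From HB Require Import structures.
From mathcomp Require Import all_boot all_order all_algebra.
From mathcomp Require Import all_classical all_reals all_analysis.
From mathcomp Require Import complex.
From mathcomp Require Import ring lra.

Set Implicit Arguments.
Unset Strict Implicit.
Unset Printing Implicit Defensive.

Import Order.TTheory GRing.Theory Num.Theory.
Import numFieldNormedType.Exports.

Local Open Scope classical_set_scope.
Local Open Scope ring_scope.

(* [der] is [derive], sealed so that unification never unfolds it. *)
HB.lock Definition der (R : realType) (V W : normedModType R) (f : V -> W) (x v : V) : W :=
  derive f x v.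
Canonical der_unlockable := Unlockable der.unlock.

Lemma derE (R : realType) (V W : normedModType R) (f : V -> W) (x v : V) :
  der f x v = derive f x v.
Proof. by rewrite der.unlock. Qed.

Notation "''D_' v f" := (der f ^~ v).
Notation "''D_' v f c" := (der f c v).

(** * Directional derivatives *)

Section Calculus.
Variables (R : realType) (V : normedModType R).
Implicit Types (W : normedModType R) (x v : V).

(** The differential of [f] also satisfies the first order expansion of [g] at [x], and
    [diff_unique] identifies it with the differential of [g]. *)
Lemma near_eq_differentiable W (f g : V -> W) x :
  (\near x, f x = g x) -> differentiable f x -> differentiable g x.
Proof.
move=> fg df; have fgx := nbhs_singleton fg.
have dfc := diff_continuous df.
have gx : g \o shift x = cst (g x) + 'd f x +o_ (0 : V) id.
  apply/eqaddoP => _/posnumP[e].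
  have /eqaddoP/(_ e%:num (gt0 _)) := diff_locally df.
  move=> H.
  have fg0 : \forall y \near (0 : V), f (y + x) = g (y + x).
    by rewrite (near_shift x 0) /= sub0r; near=> y; rewrite /= addrNK; near: y.
  near=> y.
  have <- : (f \o shift x - (cst (f x) + 'd f x)) y =
            (g \o shift x - (cst (g x) + 'd f x)) y.
    by rewrite /= !fctE /= -fgx; congr (_ - _); near: y.
  by near: y.
apply/diff_locallyP; have E := diff_unique dfc gx.
by rewrite E.
Unshelve. all: by end_near. Qed.

Section Rules.
Variables (W : normedModType R) (x v : V).
Implicit Types (f g : V -> W) (a b : V -> R).

Lemma near_open (U : set V) f g : open U -> U x -> (forall y, U y -> f y = g y) ->
  \near x, f x = g x.
Proof. by move=> oU Ux fg; near=> y; apply: fg; near: y; apply: open_nbhs_nbhs.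
Unshelve. all: by end_near. Qed.

Lemma eq_derive_on (U : set V) f g : open U -> U x ->
  (forall y, U y -> f y = g y) -> 'D_v f x = 'D_v g x.
Proof. by move=> oU Ux fg; rewrite !derE; apply/near_eq_derive/(near_open oU). Qed.

Lemma eq_differentiable_on (U : set V) f g : open U -> U x ->
  (forall y, U y -> f y = g y) -> differentiable f x -> differentiable g x.
Proof. by move=> oU Ux fg; apply/near_eq_differentiable/(near_open oU). Qed.

Lemma dD f g : differentiable f x -> differentiable g x ->
  'D_v (fun y => f y + g y) x = 'D_v f x + 'D_v g x.
Proof. by move=> df dg; rewrite !derE; apply: deriveD; apply: diff_derivable. Qed.

Lemma dB f g : differentiable f x -> differentiable g x ->
  'D_v (fun y => f y - g y) x = 'D_v f x - 'D_v g x.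
Proof. by move=> df dg; rewrite !derE; apply: deriveB; apply: diff_derivable. Qed.

Lemma dN f : differentiable f x -> 'D_v (fun y => - f y) x = - 'D_v f x.
Proof. by move=> df; rewrite !derE; apply: deriveN; apply: diff_derivable. Qed.

Lemma diffrD f g : differentiable f x -> differentiable g x ->
  differentiable (fun y => f y + g y) x.
Proof. exact: differentiableD. Qed.

Lemma diffrB f g : differentiable f x -> differentiable g x ->
  differentiable (fun y => f y - g y) x.
Proof. exact: differentiableB. Qed.

Lemma diffrN f : differentiable f x -> differentiable (fun y => - f y) x.
Proof. exact: differentiableN. Qed.

Lemma diffrM a b : differentiable a x -> differentiable b x ->
  differentiable (fun y => a y * b y) x.
Proof. exact: differentiableM. Qed.

Lemma dM a b : differentiable a x -> differentiable b x ->
  'D_v (fun y => a y * b y) x = 'D_v a x * b x + a x * 'D_v b x.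
Proof.
move=> da db; rewrite !derE [LHS]deriveM; try exact: diff_derivable.
by rewrite addrC /GRing.scale /= [b x * _]mulrC.
Qed.

Lemma diffrV a : a x != 0 -> differentiable a x -> differentiable (fun y => (a y)^-1) x.
Proof. by move=> ax da; apply: differentiableV. Qed.

Lemma dV a : a x != 0 -> differentiable a x ->
  'D_v (fun y => (a y)^-1) x = - ('D_v a x * ((a x)^-1 * (a x)^-1)).
Proof.
move=> ax da; rewrite !derE [LHS](deriveV ax); last exact: diff_derivable.
by rewrite -[_ *: _]/(_ * _) mulNr expr2 mulrC invfM.
Qed.

Lemma d_cst (c : W) : 'D_v (fun=> c) x = 0.
Proof. by rewrite derE; exact: derive_cst. Qed.

Lemma diffrZl a (w : W) : differentiable a x -> differentiable (fun y => a y *: w) x.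
Proof. by move=> da; apply: differentiableZl. Qed.

Lemma dZl a (w : W) : differentiable a x ->
  'D_v (fun y => a y *: w) x = 'D_v a x *: w.
Proof.
move=> da; rewrite !derE deriveE; last exact: differentiableZl.
by rewrite diffZl // deriveE.
Qed.

Lemma d_lin (Z : normedModType R) (L : {linear W -> Z}) f : continuous L ->
  differentiable f x -> 'D_v (fun y => L (f y)) x = L ('D_v f x).
Proof.
move=> Lc df; have dL := @linear_differentiable _ _ _ L (f x) Lc.
rewrite !derE -[fun y => _]/(L \o f) deriveE; last exact: differentiable_comp.
by rewrite diff_comp //= diff_lin // deriveE.
Qed.

Lemma diffr_lin (Z : normedModType R) (L : {linear W -> Z}) f : continuous L ->
  differentiable f x -> differentiable (fun y => L (f y)) x.
Proof.
move=> Lc df; have dL := @linear_differentiable _ _ _ L (f x) Lc.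
exact: (differentiable_comp df dL).
Qed.

Lemma diffr_sum (I : Type) (s : seq I) (P : pred I) (F : I -> V -> W) :
  (forall i, P i -> differentiable (F i) x) ->
  differentiable (fun y => \sum_(i <- s | P i) F i y) x.
Proof.
move=> dF; elim: s => [|i s IH].
  by under eq_fun do rewrite big_nil; exact: differentiable_cst.
under eq_fun do rewrite big_cons.
by case: (P i) (dF i) => // dFi; apply: diffrD => //; exact: dFi.
Qed.

Lemma dsum (I : Type) (s : seq I) (P : pred I) (F : I -> V -> W) :
  (forall i, P i -> differentiable (F i) x) ->
  'D_v (fun y => \sum_(i <- s | P i) F i y) x = \sum_(i <- s | P i) 'D_v (F i) x.
Proof.
move=> dF; elim: s => [|i s IH].
  by under eq_fun do rewrite big_nil; rewrite d_cst big_nil.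
under eq_fun do rewrite big_cons.
rewrite big_cons; case: (P i) (dF i) => // dFi; rewrite dD ?IH //; first exact: dFi.
exact: diffr_sum.
Qed.

Lemma diffr1 (phi : R -> R) (d : R) a : is_derive (a x) 1 phi d ->
  differentiable a x -> differentiable (fun y => phi (a y)) x.
Proof.
move=> [dphi _] da; apply: (differentiable_comp da).
exact/derivable1_diffP.
Qed.

Lemma d1 (phi : R -> R) (d : R) a : is_derive (a x) 1 phi d ->
  differentiable a x -> 'D_v (fun y => phi (a y)) x = 'D_v a x * d.
Proof.
move=> [dphi ephi] da; have dp : differentiable phi (a x) by exact/derivable1_diffP.
rewrite !derE -[fun y => _]/(phi \o a) deriveE; last exact: differentiable_comp.
rewrite diff_comp //= -ephi.
by rewrite -[X in 'd phi _ X]mulr1 [LHS]linearZ -!deriveE.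
Qed.

Lemma d_comp (Z : normedModType R) (g : W -> Z) f : differentiable f x ->
  differentiable g (f x) ->
  'D_v (fun y => g (f y)) x = 'D_('D_v f x) g (f x).
Proof.
move=> df dg; rewrite !derE -[fun y => _]/(g \o f) deriveE; last exact: differentiable_comp.
by rewrite diff_comp //= -!deriveE.
Qed.

Lemma derive_dirD f (u w : V) : differentiable f x ->
  'D_(u + w) f x = 'D_u f x + 'D_w f x.
Proof. by move=> df; rewrite !derE !deriveE // linearD. Qed.

Lemma derive_dirB f (u w : V) : differentiable f x ->
  'D_(u - w) f x = 'D_u f x - 'D_w f x.
Proof. by move=> df; rewrite !derE !deriveE // linearB. Qed.

Lemma derive_dirZ f (u : V) (c : R) : differentiable f x ->
  'D_(c *: u) f x = c *: 'D_u f x.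
Proof. by move=> df; rewrite !derE !deriveE // linearZ. Qed.

Lemma derive_dir_sum (I : Type) (s : seq I) (P : pred I) (u : I -> V) f :
  differentiable f x ->
  'D_(\sum_(i <- s | P i) u i) f x = \sum_(i <- s | P i) 'D_(u i) f x.
Proof.
by move=> df; rewrite derE deriveE // linear_sum; apply: eq_bigr => i _; rewrite derE deriveE.
Qed.

End Rules.

Lemma diffr_coord m n (f : V -> 'M[R]_(m, n)) x i j : differentiable f x ->
  differentiable (fun y => f y i j) x.
Proof.
move=> df; exact: (differentiable_comp df (differentiable_coord _ _ _)).
Qed.

Lemma d_coord m n (f : V -> 'M[R]_(m, n)) x v i j : differentiable f x ->
  'D_v (fun y => f y i j) x = 'D_v f x i j.
Proof. by move=> df; rewrite !derE derive_mx ?mxE //; apply: diff_derivable. Qed.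

Lemma d_id x v : 'D_v id x = v.
Proof. by rewrite derE derive_id. Qed.

Lemma diffr_mx m n (f : V -> 'M[R]_(m, n)) x :
  (forall i j, differentiable (fun y => f y i j) x) -> differentiable f x.
Proof.
move=> df.
have -> : f = fun y => \sum_i \sum_j (f y i j *: delta_mx i j).
  by apply/funext => y; rewrite -matrix_sum_delta.
apply: (@diffr_sum 'M[R]_(m, n)) => i _; apply: (@diffr_sum 'M[R]_(m, n)) => j _.
exact: diffrZl.
Qed.

Lemma diffrZ m n (a : V -> R) (f : V -> 'M[R]_(m, n)) x :
  differentiable a x -> differentiable f x -> differentiable (fun y => a y *: f y) x.
Proof.
move=> da df; apply: diffr_mx => i j; under eq_fun do rewrite mxE.
by apply: diffrM => //; apply: diffr_coord.
Qed.

Lemma dZ m n (a : V -> R) (f : V -> 'M[R]_(m, n)) x v :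
  differentiable a x -> differentiable f x ->
  'D_v (fun y => a y *: f y) x = 'D_v a x *: f x + a x *: 'D_v f x.
Proof.
move=> da df; apply/matrixP => i j; rewrite -d_coord; last exact: diffrZ.
under eq_fun do rewrite mxE.
by rewrite dM ?d_coord ?mxE //; exact: diffr_coord.
Qed.

End Calculus.

Section Mulmx.
Variables (R : realType) (V : normedModType R).
Implicit Types (x v : V).

Lemma continuous_mulmxr m n k (B : 'M[R]_(n, k)) :
  continuous (fun w : 'M[R]_(m, n) => w *m B).
Proof.
move=> w; apply: differentiable_continuous.
suff: forall i j, differentiable (fun w : 'M[R]_(m, n) => (w *m B) i j) w.
  move=> dB; have -> : (fun w => w *m B) =
      fun w : 'M[R]_(m, n) => \sum_i \sum_j ((w *m B) i j *: delta_mx i j).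
    by apply/funext => y; rewrite -matrix_sum_delta.
  apply: (@diffr_sum R _ 'M[R]_(m, k)) => i _; apply: (@diffr_sum R _ 'M[R]_(m, k)) => j _.
  exact: differentiableZl.
move=> i j; under eq_fun do rewrite mxE.
apply: (@diffr_sum R _ R) => l _; apply: differentiableM; last exact: differentiable_cst.
exact: differentiable_coord.
Qed.

Lemma diffr_mulmxr m n k (f : V -> 'M[R]_(m, n)) (B : 'M[R]_(n, k)) x :
  differentiable f x -> differentiable (fun y => f y *m B) x.
Proof. 
exact: (@diffr_lin _ _ _ _ _ (mulmxr B) f (@continuous_mulmxr m n k B)). Qed.

Lemma d_mulmxr m n k (f : V -> 'M[R]_(m, n)) (B : 'M[R]_(n, k)) x v :
  differentiable f x -> 'D_v (fun y => f y *m B) x = 'D_v f x *m B.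
Proof. exact: (@d_lin _ _ _ _ v _ (mulmxr B) f (@continuous_mulmxr m n k B)). Qed.

End Mulmx.

(** * Smooth maps *)

(** Sealed like [der], so that the quantification over lists of directions is never unfolded by
    unification. *)
HB.lock Definition smooth (R : realType) (V W : normedModType R) (U : set V)
  (f : V -> W) : Prop := smooth_on U f.

Lemma smoothE (R : realType) (V W : normedModType R) (U : set V) (f : V -> W) :
  smooth U f = smooth_on U f.
Proof. by rewrite smooth.unlock. Qed.

Section Smooth.
Variables (R : realType) (V : normedModType R).
Implicit Types (W : normedModType R) (x v : V) (U : set V) (n : nat).

(** A recursive form of smoothness, suited to proofs by induction on the order, unlike the lists of
    directions in [smooth_on]. Order [0] already means differentiable once. *)
Fixpoint smooth_upto W n U (f : V -> W) : Prop :=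
  (forall x, U x -> differentiable f x) /\
  if n is n'.+1 then forall v, smooth_upto n' U ('D_v f) else True.

Lemma smooth_differentiable W U (f : V -> W) x :
  smooth U f -> U x -> differentiable f x.
Proof. by rewrite smoothE => fU; exact: (fU [::]). Qed.

Lemma der_funE W (f : V -> W) v : 'D_v f = (fun x => derive f x v).
Proof. by apply/funext => x; rewrite derE. Qed.

Lemma smooth_derive W U (f : V -> W) v : smooth U f -> smooth U ('D_v f).
Proof.
rewrite !smoothE => fU vs x Ux; rewrite der_funE.
by rewrite -[foldr _ _ _](foldr_rcons (fun v g => derive g ^~ v) f vs v); exact: fU.
Qed.

Lemma smooth_uptoP W U (f : V -> W) :
  smooth U f <-> forall n, smooth_upto n U f.
Proof.
split=> [fU n|fU]; last (rewrite smoothE => vs x Ux).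
  elim: n f fU => [|n IH] f fU; split => //; try by move=> x; exact: smooth_differentiable.
  by move=> v; apply: IH; exact: smooth_derive.
(* [foldr] differentiates along the last direction of the list first, so the list is consumed from
   its right end. *)
have := fU (size vs); elim/last_ind: vs f {fU} => [|vs v IH] f; first by case=> /(_ _ Ux).
by rewrite size_rcons foldr_rcons => -[_ /(_ v)] /IH; rewrite der_funE.
Qed.

Lemma upto_differentiable W n U (f : V -> W) x :
  smooth_upto n U f -> U x -> differentiable f x.
Proof. by case: n => [|n] [+ _]; apply. Qed.

Lemma uptoW W n U (f : V -> W) : smooth_upto n.+1 U f -> smooth_upto n U f.
Proof.
elim: n f => [|n IH] f [df Df]; split => // v; apply: IH; exact: Df.
Qed.

Lemma uptoS W n U (f : V -> W) : (forall x, U x -> differentiable f x) ->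
  (forall v, smooth_upto n U ('D_v f)) -> smooth_upto n.+1 U f.
Proof. by []. Qed.

Lemma smooth_onS W U U' (f : V -> W) : U' `<=` U -> smooth U f -> smooth U' f.
Proof. by rewrite !smoothE => UU' fU vs x /UU'; exact: fU. Qed.

Section Open.
Variables (U : set V) (oU : open U).

Lemma eq_upto W n (f g : V -> W) : (forall x, U x -> f x = g x) ->
  smooth_upto n U f -> smooth_upto n U g.
Proof.
elim: n f g => [|n IH] f g fg [df Df]; split => //.
- by move=> x Ux; apply: (eq_differentiable_on oU Ux fg); exact: df.
- by move=> x Ux; apply: (eq_differentiable_on oU Ux fg); exact: df.
- by move=> v; apply: IH (Df v) => x Ux; exact: (eq_derive_on _ oU Ux fg).
Qed.

Lemma eq_smooth W (f g : V -> W) : (forall x, U x -> f x = g x) ->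
  smooth U f -> smooth U g.
Proof. by move=> fg /smooth_uptoP fU; apply/smooth_uptoP => n; apply: eq_upto (fU n). Qed.

(** The inductive step of the closure properties below: a formula [D] for the derivative is needed
    on [U] only, because [eq_upto] ignores values outside the open set. *)
Lemma upto_step W n (f : V -> W) (D : V -> V -> W) :
  (forall x, U x -> differentiable f x) ->
  (forall v x, U x -> 'D_v f x = D v x) -> (forall v, smooth_upto n U (D v)) ->
  smooth_upto n.+1 U f.
Proof. by move=> df fD Dn; apply: uptoS => // v; apply: eq_upto (Dn v) => x /fD. Qed.

Lemma upto_cst W n (c : W) : smooth_upto n U (fun=> c).
Proof.
elim: n c => [|n IH] c; first by split=> // x _; exact: differentiable_cst.
apply: (upto_step (D := fun _ _ => 0)) => [x _|v x _|v]; first exact: differentiable_cst.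
  exact: d_cst.
exact: IH.
Qed.

Lemma uptoD W n (f g : V -> W) : smooth_upto n U f -> smooth_upto n U g ->
  smooth_upto n U (fun x => f x + g x).
Proof.
elim: n f g => [|n IH] f g fn gn.
  by split=> // x Ux; apply: diffrD; [exact: fn.1|exact: gn.1].
apply: (upto_step (D := fun v x => 'D_v f x + 'D_v g x)) => [x Ux|v x Ux|v].
- by apply: diffrD; [exact: fn.1|exact: gn.1].
- by apply: dD; [exact: fn.1|exact: gn.1].
- by apply: IH; [exact: fn.2|exact: gn.2].
Qed.

Lemma uptoN W n (f : V -> W) : smooth_upto n U f -> smooth_upto n U (fun x => - f x).
Proof.
elim: n f => [|n IH] f fn.
  by split=> // x Ux; apply: diffrN; exact: fn.1.
apply: (upto_step (D := fun v x => - 'D_v f x)) => [x Ux|v x Ux|v].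
- by apply: diffrN; exact: fn.1.
- by apply: dN; exact: fn.1.
- by apply: IH; exact: fn.2.
Qed.

Lemma uptoM n (a b : V -> R) : smooth_upto n U a -> smooth_upto n U b ->
  smooth_upto n U (fun x => a x * b x).
Proof.
elim: n a b => [|n IH] a b an bn.
  by split=> // x Ux; apply: diffrM; [exact: an.1|exact: bn.1].
apply: (upto_step (D := fun v x => 'D_v a x * b x + a x * 'D_v b x)) => [x Ux|v x Ux|v].
- by apply: diffrM; [exact: an.1|exact: bn.1].
- by apply: dM; [exact: an.1|exact: bn.1].
- by apply: uptoD; apply: IH; [exact: an.2|exact: uptoW|exact: uptoW|exact: bn.2].
Qed.

Lemma upto_mx m p n (f : V -> 'M[R]_(m, p)) :
  (forall i j, smooth_upto n U (fun x => f x i j)) -> smooth_upto n U f.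
Proof.
elim: n f => [|n IH] f fn.
  by split=> // x Ux; apply: diffr_mx => i j; exact: (upto_differentiable (fn i j)).
apply: (upto_step (D := fun v x => 'D_v f x)) => // [x Ux|v].
  by apply: diffr_mx => i j; exact: (upto_differentiable (fn i j)).
apply: IH => i j; apply: eq_upto ((fn i j).2 v) => x Ux.
apply: d_coord; apply: diffr_mx => i' j'; exact: (upto_differentiable (fn i' j')).
Qed.

Lemma upto_coord m p n (f : V -> 'M[R]_(m, p)) i j :
  smooth_upto n U f -> smooth_upto n U (fun x => f x i j).
Proof.
elim: n f => [|n IH] f fn.
  by split=> // x Ux; apply: diffr_coord; exact: fn.1.
apply: (upto_step (D := fun v x => 'D_v f x i j)) => // [x Ux|v x Ux|v].
- by apply: diffr_coord; exact: fn.1.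
- by apply: d_coord; exact: fn.1.
- by apply: IH; exact: fn.2.
Qed.

Lemma upto_sum W n (I : Type) (s : seq I) (P : pred I) (F : I -> V -> W) :
  (forall i, P i -> smooth_upto n U (F i)) ->
  smooth_upto n U (fun x => \sum_(i <- s | P i) F i x).
Proof.
move=> Fn; elim: s => [|i s IH].
  by under eq_fun do rewrite big_nil; exact: upto_cst.
under eq_fun do rewrite big_cons.
by case: (P i) (Fn i) => // Fi; apply: uptoD => //; exact: Fi.
Qed.

Lemma uptoZ m p n (a : V -> R) (f : V -> 'M[R]_(m, p)) : smooth_upto n U a ->
  smooth_upto n U f -> smooth_upto n U (fun x => a x *: f x).
Proof.
move=> an fn; apply: upto_mx => i j; under eq_fun do rewrite mxE.
by apply: uptoM => //; exact: upto_coord.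
Qed.

(** Bootstrapping: the last hypothesis may assume that [phi (a x)] is already smooth of order [k].
    This suits functions whose derivative is an expression in themselves, such as the inverse and
    the square root. *)
Lemma upto_fun n (phi dphi : R -> R) (a : V -> R) :
  (forall x, U x -> is_derive (a x) 1 phi (dphi (a x))) ->
  smooth_upto n U a ->
  (forall k, (k < n)%N -> smooth_upto k U (fun x => phi (a x)) ->
     smooth_upto k U (fun x => dphi (a x))) ->
  smooth_upto n U (fun x => phi (a x)).
Proof.
move=> phid an dphin.
have dphia x : U x -> differentiable (fun x => phi (a x)) x.
  by move=> Ux; apply: diffr1 (phid x Ux) _; exact: upto_differentiable an _.
elim: n an dphin => [|n IH] an dphin; first by split.
apply: (upto_step (D := fun v x => 'D_v a x * dphi (a x))) => // [v x Ux|v].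
  by apply: d1 (phid x Ux) _; exact: upto_differentiable an _.
apply: uptoM; first exact: an.2.
have dphin0 := dphin; apply: dphin => //; apply: IH; first exact: uptoW.
by move=> k kn; apply: dphin0; exact: ltnW.
Qed.

Lemma smooth_fun (phi dphi : R -> R) (a : V -> R) :
  (forall x, U x -> is_derive (a x) 1 phi (dphi (a x))) ->
  smooth U a ->
  (forall n, smooth_upto n U (fun x => phi (a x)) -> smooth_upto n U (fun x => dphi (a x))) ->
  smooth U (fun x => phi (a x)).
Proof.
move=> phid /smooth_uptoP an dphin; apply/smooth_uptoP => n.
by apply: (upto_fun phid (an n)) => k _; exact: dphin.
Qed.

Lemma smooth_cst W (c : W) : smooth U (fun=> c).
Proof. by apply/smooth_uptoP => n; exact: upto_cst. Qed.

Lemma smoothD W (f g : V -> W) : smooth U f -> smooth U g ->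
  smooth U (fun x => f x + g x).
Proof. by move=> /smooth_uptoP fn /smooth_uptoP gn; apply/smooth_uptoP => n; exact: uptoD. Qed.

Lemma smoothN W (f : V -> W) : smooth U f -> smooth U (fun x => - f x).
Proof. by move=> /smooth_uptoP fn; apply/smooth_uptoP => n; exact: uptoN. Qed.

Lemma smoothB W (f g : V -> W) : smooth U f -> smooth U g ->
  smooth U (fun x => f x - g x).
Proof. by move=> fn gn; apply: smoothD => //; exact: smoothN. Qed.

Lemma smoothM (a b : V -> R) : smooth U a -> smooth U b ->
  smooth U (fun x => a x * b x).
Proof. by move=> /smooth_uptoP fn /smooth_uptoP gn; apply/smooth_uptoP => n; exact: uptoM. Qed.

Lemma smooth_mx m p (f : V -> 'M[R]_(m, p)) :
  (forall i j, smooth U (fun x => f x i j)) -> smooth U f.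
Proof.
move=> fn; apply/smooth_uptoP => n; apply: upto_mx => i j.
exact: (smooth_uptoP _ _).1.
Qed.

Lemma smooth_coord m p (f : V -> 'M[R]_(m, p)) i j :
  smooth U f -> smooth U (fun x => f x i j).
Proof. by move=> /smooth_uptoP fn; apply/smooth_uptoP => n; exact: upto_coord. Qed.

Lemma smooth_sum W (I : Type) (s : seq I) (P : pred I) (F : I -> V -> W) :
  (forall i, P i -> smooth U (F i)) ->
  smooth U (fun x => \sum_(i <- s | P i) F i x).
Proof.
move=> Fn; apply/smooth_uptoP => n; apply: upto_sum => i Pi.
by apply: (smooth_uptoP _ _).1; exact: Fn.
Qed.

Lemma smoothZ m p (a : V -> R) (f : V -> 'M[R]_(m, p)) : smooth U a ->
  smooth U f -> smooth U (fun x => a x *: f x).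
Proof. by move=> /smooth_uptoP fn /smooth_uptoP gn; apply/smooth_uptoP => n; exact: uptoZ. Qed.

Lemma smoothV (a : V -> R) : (forall x, U x -> a x != 0) -> smooth U a ->
  smooth U (fun x => (a x)^-1).
Proof.
move=> a0 sa; apply: (@smooth_fun (fun t => t^-1) (fun t => - (t^-1 * t^-1))) => //.
  move=> x Ux; apply: is_derive_eq; first by apply: is_deriveV; exact: a0.
  by rewrite -[_ *: _]/(_ * _) mulr1 expr2 invfM.
by move=> n an; apply: uptoN; apply: uptoM.
Qed.

Lemma smooth_sqrt (a : V -> R) : (forall x, U x -> 0 < a x) -> smooth U a ->
  smooth U (fun x => Num.sqrt (a x)).
Proof.
move=> a0 sa; apply: (@smooth_fun Num.sqrt (fun t => (2 * Num.sqrt t)^-1)) => //.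
  by move=> x Ux; apply: is_derive1_sqrt; exact: a0.
move=> n an; pose b x := Num.sqrt (a x).
have : smooth_upto n U (fun x => (2 * b x)^-1).
  apply: (@upto_fun n (fun t => (2 * t)^-1) (fun t => - (2 * ((2 * t)^-1 * (2 * t)^-1))) b).
  - move=> x Ux; apply: is_derive_eq; first apply: is_deriveV.
      by rewrite mulf_neq0 // gt_eqF // sqrtr_gt0 a0.
    by rewrite -[_ *: _]/(_ * _) /= expr2 invfM mulNr [X in _ * X]mulr1 mulrC.
  - exact: an.
  - move=> k kn bk; apply: uptoN; apply: uptoM; first exact: upto_cst.
    by apply: uptoM.
by [].
Qed.

Lemma smooth_atan (a : V -> R) : smooth U a -> smooth U (fun x => atan (a x)).
Proof.
move=> sa; apply: (@smooth_fun atan (fun t => (1 + t ^+ 2)^-1)) => //.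
have : smooth U (fun x => (1 + a x ^+ 2)^-1).
  apply: smoothV => [x _|]; first by rewrite gt_eqF // ltr_wpDr // sqr_ge0.
  by apply: smoothD; [exact: smooth_cst|apply: smoothM].
by move=> /smooth_uptoP h n _; exact: h.
Qed.

Lemma smooth_ln (a : V -> R) : (forall x, U x -> 0 < a x) -> smooth U a ->
  smooth U (fun x => ln (a x)).
Proof.
move=> a0 sa; apply: (@smooth_fun (@ln R) (fun t => t^-1)) => //.
  by move=> x Ux; apply: is_derive1_ln; exact: a0.
have /smooth_uptoP h : smooth U (fun x => (a x)^-1).
  by apply: smoothV => // x Ux; rewrite gt_eqF // a0.
by move=> n _; exact: h.
Qed.

(** Both functions are treated in one induction, since each is up to sign the derivative of the
    other. *)
Lemma smooth_sincos (a : V -> R) : smooth U a ->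
  smooth U (fun x => sin (a x)) /\ smooth U (fun x => cos (a x)).
Proof.
move=> /smooth_uptoP sa.
suff h n : smooth_upto n U (fun x => sin (a x)) /\ smooth_upto n U (fun x => cos (a x)).
  by split; apply/smooth_uptoP => n; have [] := h n.
elim: n => [|n [IHs IHc]].
  split; split => // x Ux; apply: diffr1; exact: upto_differentiable (sa 0%N) _.
split.
- apply: (upto_step (D := fun v x => 'D_v a x * cos (a x))) => [x Ux|v x Ux|v].
  + by apply: diffr1; exact: upto_differentiable (sa 0%N) _.
  + by apply: d1; exact: upto_differentiable (sa 0%N) _.
  + by apply: uptoM => //; exact: (sa n.+1).2.
- apply: (upto_step (D := fun v x => 'D_v a x * - sin (a x))) => [x Ux|v x Ux|v].
  + by apply: diffr1; exact: upto_differentiable (sa 0%N) _.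
  + by apply: d1; exact: upto_differentiable (sa 0%N) _.
  + by apply: uptoM => //; [exact: (sa n.+1).2|apply: uptoN].
Qed.

Lemma smooth_potential W (f : V -> W) (D : V -> V -> W) :
  (forall x, U x -> differentiable f x) ->
  (forall v x, U x -> 'D_v f x = D v x) -> (forall v, smooth U (D v)) ->
  smooth U f.
Proof.
move=> df fD sD; apply/smooth_uptoP => -[|n]; first by split.
by apply: (upto_step df fD) => v; exact: (smooth_uptoP _ _).1.
Qed.

End Open.
End Smooth.

(** * Mean value theorem and symmetry of second derivatives *)

Section Lines.
Variables (R : realType) (V : normedModType R).
Implicit Types (x u v : V).

Lemma line_differentiable x u (t : R) : differentiable (fun s : R => x + s *: u) t.
Proof.
apply: diffrD; first exact: differentiable_cst.
by apply: (@diffrZl R R V t id) => //.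
Qed.

Lemma line_derive x u (t : R) : 'D_1 (fun s : R => x + s *: u) t = u.
Proof.
rewrite dD; [|exact: differentiable_cst|exact: (@diffrZl R R V t id)].
by rewrite d_cst (@dZl R R V t 1 id) // d_id scale1r add0r.
Qed.

Lemma is_derive_line (W : normedModType R) (f : V -> W) x u (t : R) :
  differentiable f (x + t *: u) ->
  is_derive t 1 (fun s : R => f (x + s *: u)) ('D_u f (x + t *: u)).
Proof.
move=> df; have dl := line_differentiable x u t; split.
  by apply: diff_derivable; exact: (differentiable_comp dl df).
by rewrite -derE (@d_comp R R V t 1 W f _ dl df) line_derive.
Qed.

Lemma MVT_line (f : V -> R) x u :
  (forall t : R, 0 <= t <= 1 -> differentiable f (x + t *: u)) ->
  exists2 c : R, 0 <= c <= 1 & f (x + u) - f x = 'D_u f (x + c *: u).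
Proof.
move=> df; pose g (t : R) := f (x + t *: u).
have dg (t : R) : 0 <= t <= 1 -> is_derive t 1 g ('D_u f (x + t *: u)).
  by move=> /df; exact: is_derive_line.
have [||c c01 gc] := @MVT_segment R g (fun t => 'D_u f (x + t *: u)) 0 1 ler01.
- by move=> t; rewrite in_itv /= => /andP[t0 t1]; apply: dg; rewrite !ltW.
- apply: derivable_within_continuous => t; rewrite in_itv /= => /dg [+ _]; exact.
- exists c => //; move: gc; rewrite /g scale1r scale0r addr0 => ->.
  by rewrite subr0 mulr1.
Qed.

Lemma ball_segment x (r : R) u (t : R) : 0 <= t <= 1 -> ball x r (x + u) ->
  ball x r (x + t *: u).
Proof.
move=> /andP[t0 t1]; rewrite -!ball_normE /= !opprD !addrA !subrr !sub0r !normrN.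
apply: le_lt_trans; rewrite normrZ ger0_norm // -[leRHS]mul1r ler_wpM2r //.
Qed.

Lemma zero_derive_const_scalar x (r : R) (f : V -> R) :
  (forall y, ball x r y -> differentiable f y) ->
  (forall y v, ball x r y -> 'D_v f y = 0) -> forall y, ball x r y -> f y = f x.
Proof.
move=> df Df y xy; have xy' : ball x r (x + (y - x)) by rewrite subrKC.
have [t t01|c c01] := @MVT_line f x (y - x).
  by apply: df; exact: ball_segment.
rewrite subrKC Df; last exact: ball_segment.
by move/eqP; rewrite subr_eq0 => /eqP.
Qed.

Lemma zero_derive_const m n x (r : R) (f : V -> 'M[R]_(m, n)) :
  (forall y, ball x r y -> differentiable f y) ->
  (forall y v, ball x r y -> 'D_v f y = 0) -> forall y, ball x r y -> f y = f x.
Proof.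
move=> df Df y xy; apply/matrixP => i j.
apply: (zero_derive_const_scalar (f := fun y => f y i j)) xy => [z xz|z v xz].
  by apply: diffr_coord; exact: df.
by rewrite d_coord ?Df ?mxE //; exact: df.
Qed.

(** Second difference argument: by two applications of the mean value theorem, the second difference
    of [f] on a parallelogram with sides [h u] and [h v] is [h^2] times a value of [D_v D_u f] near
    [x], and by symmetry [h^2] times a value of [D_u D_v f] near [x]. Continuity of both mixed
    derivatives at [x] does the rest. *)
Lemma schwarz_scalar (U : set V) (f : V -> R) x u v : open U -> smooth U f ->
  U x -> 'D_u ('D_v f) x = 'D_v ('D_u f) x.
Proof.
move=> oU fU Ux.
have swap (a b c d : R) : a - b - (c - d) = a - c - (b - d) by ring.
apply/eqP; rewrite -subr_eq0 -normr_le0; apply/ler_addgt0Pr => e e0; rewrite add0r.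
  have key : exists p q,
    [/\ `|'D_v ('D_u f) x - p| < e / 2, `|'D_u ('D_v f) x - q| < e / 2 & p = q].
    have quad u' v' : \forall y \near x, `|'D_v' ('D_u' f) x - 'D_v' ('D_u' f) y| < e / 2.
      have := differentiable_continuous
        (smooth_differentiable (smooth_derive v' (smooth_derive u' fU)) Ux).
      by move=> /cvgrPdist_lt; apply; rewrite divr_gt0.
    have nU : nbhs x U by exact: open_nbhs_nbhs.
    have : nbhs x (U `&`
        ([set y | `|'D_v ('D_u f) x - 'D_v ('D_u f) y| < e / 2] `&`
         [set y | `|'D_u ('D_v f) x - 'D_u ('D_v f) y| < e / 2])).
      by apply: filterI => //; apply: filterI; exact: quad.
    move=> /nbhs_ballP[d /= d0 dP].
    have half u' v' (h : R) : 0 < h -> h * (`|u'| + `|v'|) < d ->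
        exists2 y, ball x d y &
        f (x + h *: u' + h *: v') - f (x + h *: u') - (f (x + h *: v') - f x)
        = h ^+ 2 * 'D_v' ('D_u' f) y.
      move=> h0 hd.
      have inb (a b : R) : 0 <= a <= 1 -> 0 <= b <= 1 ->
          ball x d (x + a *: (h *: u') + b *: (h *: v')).
        move=> /andP[a0 a1] /andP[b0 b1]; rewrite -ball_normE /= -addrA opprD addrA.
        rewrite subrr sub0r normrN; apply: le_lt_trans hd.
        rewrite (le_trans (ler_normD _ _)) // !normrZ !ger0_norm ?(ltW h0) //.
        by rewrite mulrDr lerD // -[leRHS]mul1r ler_wpM2r // mulr_ge0 // ltW.
      have inU (a b : R) : 0 <= a <= 1 -> 0 <= b <= 1 ->
          U (x + a *: (h *: u') + b *: (h *: v')).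
        by move=> a01 b01; have [] := dP _ (inb a b a01 b01).
      have one01 : 0 <= (1 : R) <= 1 by rewrite ler01 lexx.
      have zero01 : 0 <= (0 : R) <= 1 by rewrite ler01 lexx.
      pose g y := f (y + h *: v') - f y.
      have dfU y : U y -> differentiable f y by exact: smooth_differentiable fU.
      have dsh y : differentiable (fun z => z + h *: v') y.
        by apply: diffrD; [exact: ex_diff|exact: differentiable_cst].
      have Dsh y w : 'D_w (fun z => z + h *: v') y = w.
        by rewrite dD ?d_id ?d_cst ?addr0.
      have [t t01|c c01 gc] := @MVT_line g x (h *: u').
        apply: diffrB; last first.
          by apply: dfU; have := inU t 0 t01 zero01; rewrite scale0r addr0.
        apply: (differentiable_comp (dsh _)); apply: dfU.
        by have := inU t 1 t01 one01; rewrite scale1r.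
      have Uc1 : U (x + c *: (h *: u') + h *: v').
        by have := inU c 1 c01 one01; rewrite scale1r.
      have Uc0 : U (x + c *: (h *: u')).
        by have := inU c 0 c01 zero01; rewrite scale0r addr0.
      have {}gc : g (x + h *: u') - g x =
          h * ('D_u' f (x + c *: (h *: u') + h *: v') - 'D_u' f (x + c *: (h *: u'))).
        rewrite gc dB; [|apply: (differentiable_comp (dsh _)); exact: dfU|exact: dfU].
        rewrite (d_comp (g := f) _ (dsh _)); last exact: dfU.
        by rewrite Dsh !derive_dirZ ?mulrBr //; exact: dfU.
      have [t t01|b b01 fb] := @MVT_line ('D_u' f) (x + c *: (h *: u')) (h *: v').
        by apply: smooth_differentiable (smooth_derive _ fU) _; exact: inU.
      exists (x + c *: (h *: u') + b *: (h *: v')); first exact: inb.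
      move: gc; rewrite /g => ->; rewrite fb derive_dirZ; first by rewrite expr2 mulrA.
      by apply: smooth_differentiable (smooth_derive _ fU) _; exact: inU.
    have uv1 : 0 < `|u| + `|v| + 1 by rewrite ltr_wpDl // addr_ge0.
    (* This step keeps the whole parallelogram inside the ball of radius [d]; the summand [1] covers
       [u = v = 0]. *)
    pose h := d / (`|u| + `|v| + 1).
    have h0 : 0 < h by rewrite divr_gt0.
    have hd : h * (`|u| + `|v|) < d.
      by rewrite /h mulrAC ltr_pdivrMr // ltr_pM2l // ltrDl.
    have [y xy fy] := half u v h h0 hd.
    have hd' : h * (`|v| + `|u|) < d by rewrite [`|v| + _]addrC.
    have [z xz fz] := half v u h h0 hd'.
    exists ('D_v ('D_u f) y), ('D_u ('D_v f) z); split.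
    - by have [_ [+ _]] := dP _ xy; apply.
    - by have [_ [_ +]] := dP _ xz; apply.
    - apply: (mulfI (_ : h ^+ 2 != 0)); first by rewrite expf_neq0 // gt_eqF.
      apply: etrans (esym fy) (etrans _ fz).
      by rewrite swap [x + h *: v + _]addrAC.
have [p [q [up vq pq]]] := key.
rewrite -(subrKA q) (le_trans (ler_normD _ _)) // (splitr e) lerD ?(ltW vq) //.
by rewrite -pq distrC ltW.
Qed.

Lemma schwarz m n (U : set V) (f : V -> 'M[R]_(m, n)) x u v : open U ->
  smooth U f -> U x -> 'D_u ('D_v f) x = 'D_v ('D_u f) x.
Proof.
move=> oU fU Ux; apply/matrixP => i j.
have D2 w1 w2 : 'D_w1 ('D_w2 f) x i j = 'D_w1 ('D_w2 (fun y => f y i j)) x.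
  rewrite -d_coord; last exact: smooth_differentiable (smooth_derive _ fU) Ux.
  apply: (eq_derive_on _ oU Ux) => y Uy; rewrite d_coord //.
  exact: smooth_differentiable fU Uy.
apply: etrans (D2 u v) (etrans _ (esym (D2 v u))).
by apply: (schwarz_scalar _ _ oU _ Ux); exact: smooth_coord.
Qed.

End Lines.

(** * Inverse function theorem *)

Section Composition.
Variables (R : realType) (V : normedModType R) (k : nat).
Variables (U : set V) (O : set 'rV[R]_k) (oU : open U).
Variables (f : V -> 'rV[R]_k) (fUO : forall x, U x -> O (f x)).

Lemma row_delta_sum (w : 'rV[R]_k) : w = \sum_i w 0 i *: delta_mx 0 i.
Proof. exact: row_sum_delta. Qed.

Lemma derive_comp_row m p (g : 'rV[R]_k -> 'M[R]_(m, p)) x v :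
  differentiable f x -> differentiable g (f x) ->
  'D_v (fun y => g (f y)) x =
  \sum_i ('D_v f x) 0 i *: 'D_(delta_mx 0 i) g (f x).
Proof.
move=> df dg; rewrite (d_comp v df dg) [X in 'D_X g _]row_delta_sum.
by rewrite derive_dir_sum //; apply: eq_bigr => i _; rewrite derive_dirZ.
Qed.

(** The chain rule is taken in coordinates: the derivative of the composite is then a finite sum of
    products of functions to which the induction applies, with constant directions only. *)
Lemma upto_comp m p n (g : 'rV[R]_k -> 'M[R]_(m, p)) :
  smooth_upto n U f -> smooth_upto n O g -> smooth_upto n U (fun x => g (f x)).
Proof.
elim: n g => [|n IH] g fn gn.
  split=> // x Ux; apply: (differentiable_comp (fn.1 x Ux)).
  by apply: gn.1; exact: fUO.
apply: (upto_step oU (D := fun v x =>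
    \sum_i ('D_v f x) 0 i *: 'D_(delta_mx 0 i) g (f x))) => [x Ux|v x Ux|v].
- by apply: (differentiable_comp (fn.1 x Ux)); apply: gn.1; exact: fUO.
- by apply: derive_comp_row; [exact: fn.1|apply: gn.1; exact: fUO].
- apply: (upto_sum oU) => i _; apply: (uptoZ oU).
    by apply: (upto_coord oU); exact: fn.2.
  exact: (IH _ (uptoW fn) (gn.2 _)).
Qed.

Lemma smooth_comp m p (g : 'rV[R]_k -> 'M[R]_(m, p)) :
  smooth U f -> smooth O g -> smooth U (fun x => g (f x)).
Proof.
by move=> /smooth_uptoP fn /smooth_uptoP gn; apply/smooth_uptoP => n; exact: upto_comp.
Qed.

End Composition.

Lemma mx_norm_le (R : realType) m n (A : 'M[R]_(m, n)) (e : R) : 0 <= e ->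
  (forall i j, `|A i j| <= e) -> `|A| <= e.
Proof.
by move=> e0 Ae; rewrite [leLHS]mx_normrE; apply: bigmax_le => // -[i j] _; exact: Ae.
Qed.

Lemma mx_norm_ge (R : realType) m n (A : 'M[R]_(m, n)) i j : `|A i j| <= `|A|.
Proof. by rewrite [leRHS]mx_normrE; exact: (le_bigmax _ _ (i, j)). Qed.

Lemma ball_convex (R : realType) (V : normedModType R) (p x y : V) (r t : R) :
  0 <= t <= 1 -> ball p r x -> ball p r y -> ball p r (x + t *: (y - x)).
Proof.
move=> /andP[t0 t1]; rewrite -!ball_normE /= => px py.
have -> : p - (x + t *: (y - x)) = (1 - t) *: (p - x) + t *: (p - y).
  rewrite scalerBl scale1r -addrA [- _ + _]addrC -scalerBr opprD addrA -scalerN opprB.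
  by congr (_ + _ *: _); rewrite opprB [RHS]addrC subrKA.
rewrite (le_lt_trans (ler_normD _ _)) // !normrZ !ger0_norm ?subr_ge0 //.
have [->|t_neq0] := eqVneq t 0; first by rewrite subr0 mul1r mul0r addr0.
have t_gt0 : 0 < t by rewrite lt_def t_neq0.
rewrite (@lt_le_trans _ _ ((1 - t) * r + t * r)) //; last by rewrite -mulrDl subrK mul1r.
by rewrite ler_ltD ?ltr_pM2l // ler_wpM2l ?subr_ge0 // ltW.
Qed.

(** Joins completeness with the normed structure of matrices, so that Banach's fixed point theorem
    applies to row vectors. *)
HB.instance Definition _ (R : realType) (m n : nat) := Complete.on 'M[R]_(m, n).

Section InverseFunction.
Variables (R : realType) (n : nat).
Local Notation V := 'rV[R]_n.
Variables (U : set V) (oU : open U) (p : V) (Up : U p) (tau : V -> V).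
Variables (X : 'I_n -> V -> V) (tauU : smooth U tau)
  (XU : forall i, smooth U (X i))
  (tauX : forall i x, U x -> 'D_(X i x) tau x = delta_mx 0 i).

Let A x : 'M[R]_n := \matrix_i X i x.

Lemma mulA_sum (w : V) x : w *m A x = \sum_i w 0 i *: X i x.
Proof.
rewrite [w in LHS]row_delta_sum mulmx_suml; apply: eq_bigr => i _.
by rewrite -scalemxAl -rowE rowK.
Qed.

Let J x : 'M[R]_n := \matrix_i 'D_(delta_mx 0 i) tau x.

Lemma derive_J x v : U x -> 'D_v tau x = v *m J x.
Proof.
move=> Ux; have dt := smooth_differentiable tauU Ux.
rewrite [v in LHS]row_delta_sum derive_dir_sum // [v in RHS]row_delta_sum mulmx_suml.
by apply: eq_bigr => i _; rewrite derive_dirZ // -scalemxAl -rowE rowK.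
Qed.

Lemma mul_A_J x : U x -> A x *m J x = 1%:M.
Proof.
move=> Ux; apply/row_matrixP => i.
by rewrite row_mul rowK -derive_J // tauX // row1.
Qed.

Lemma mul_J_A x : U x -> J x *m A x = 1%:M.
Proof. by move=> /mul_A_J/mulmx1C. Qed.

(** The simplified Newton map: a fixed point of [Phi x + y *m A p] solves [tau x = y], and the
    derivative of [Phi] vanishes at [p] because [A p] inverts the Jacobian there. *)
Let Phi x := x - tau x *m A p.

Lemma derive_Phi x v : U x -> 'D_v Phi x = v - 'D_v tau x *m A p.
Proof.
move=> Ux; have dt := smooth_differentiable tauU Ux.
by rewrite dB ?d_id ?d_mulmxr //; exact: diffr_mulmxr.
Qed.

Lemma diff_Phi x : U x -> differentiable Phi x.
Proof.
by move=> Ux; apply: diffrB => //; apply: diffr_mulmxr; exact: smooth_differentiable Ux.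
Qed.

Lemma Phi_contracting : exists2 r : R, 0 < r & (ball p r `<=` U)%classic /\
  forall x v, ball p r x -> `|'D_v Phi x| <= 2^-1 * `|v|.
Proof.
(* At most [n] coordinates each contribute an error [e], and [n * e <= 1 / 2]; the successor makes
   [n = 0] harmless. *)
pose e : R := (2 * n.+1%:R)^-1.
have e0 : 0 < e by rewrite invr_gt0 mulr_gt0.
have near_i (i : 'I_n) : \forall x \near p, `|'D_(delta_mx 0 i) tau x *m A p - delta_mx 0 i| < e.
  have /cvgrPdist_lt : {for p, continuous (fun x => 'D_(delta_mx 0 i) tau x *m A p)}.
    apply: differentiable_continuous; apply: diffr_mulmxr.
    exact: smooth_differentiable (smooth_derive _ tauU) Up.
  move=> /(_ e e0); apply: filterS => x; rewrite derive_J // distrC.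
  by rewrite -mulmxA mul_J_A // mulmx1.
have nU : nbhs p U by exact: open_nbhs_nbhs.
have : nbhs p (U `&` [set x | forall i : 'I_n,
    `|'D_(delta_mx 0 i) tau x *m A p - delta_mx 0 i| < e]).
  exact: (filterI nU (filter_forall _ near_i)).
move=> /nbhs_ballP[r /= r0 rP]; exists r => //; split; first by move=> x /rP[].
move=> x v /rP[Ux Dx].
have dt := smooth_differentiable tauU Ux.
have -> : 'D_v Phi x =
    \sum_i (v 0 i *: delta_mx 0 i - 'D_(v 0 i *: delta_mx 0 i) tau x *m A p).
  have Ev := row_delta_sum v.
  by rewrite derive_Phi // sumrB -mulmx_suml -(derive_dir_sum _ _ _ dt) -Ev.
apply: (le_trans (ler_norm_sum _ _ _)).
have le_i (i : 'I_n) : `|v 0 i *: delta_mx 0 i - 'D_(v 0 i *: delta_mx 0 i) tau x *m A p|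
    <= `|v| * e.
  rewrite derive_dirZ // -scalemxAl -scalerBr normrZ ler_pM //; first exact: mx_norm_ge.
  by rewrite distrC ltW.
apply: (le_trans (ler_sum _ (fun i _ => le_i i))).
rewrite sumr_const card_ord -[_ *+ n]mulr_natr -mulrA mulrC ler_wpM2r //.
by rewrite /e invfM -mulrA ler_piMr ?invr_ge0 // mulrC ler_pdivrMr // mul1r ler_nat.
Qed.

(** The mean value theorem is applied to each entry, with its own intermediate point. The norm being
    the maximum of the entries, no constant is lost. *)
Lemma Phi_lipschitz r x y : ball p r `<=` U ->
  (forall x v, ball p r x -> `|'D_v Phi x| <= 2^-1 * `|v|) ->
  ball p r x -> ball p r y -> `|Phi y - Phi x| <= 2^-1 * `|y - x|.
Proof.
move=> rU DPhi px py; apply: mx_norm_le => [|i j]; first by rewrite mulr_ge0 // invr_ge0.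
have inb (t : R) : 0 <= t <= 1 -> ball p r (x + t *: (y - x)) by move=> t01; exact: ball_convex.
have [t t01|c c01] := @MVT_line R V (fun z => Phi z i j) x (y - x).
  by apply: diffr_coord; apply: diff_Phi; apply: rU; exact: inb.
rewrite subrKC d_coord; last by apply: diff_Phi; apply: rU; exact: inb.
move=> E; rewrite !mxE in E *; rewrite E.
by apply: le_trans (DPhi _ _ (inb c c01)); exact: mx_norm_ge.
Qed.

Lemma mulA_inj : injective (fun w : V => w *m A p).
Proof.
by move=> w w' /(congr1 (mulmx^~ (J p))); rewrite -!mulmxA mul_A_J // !mulmx1.
Qed.

Lemma mul_mx_bounded (B : 'M[R]_n) : exists2 K : R, 0 < K &
  forall w : V, `|w *m B| <= K * `|w|.
Proof. exact: (@linear_lipschitz _ _ _ (mulmxr B) (@continuous_mulmxr _ _ _ _ B)). Qed.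

(** The Newton map is a contraction of the closed ball: half of the radius is used by the Lipschitz
    bound on [Phi], the other half by the distance of [y] from [tau x0]. *)
Lemma tau_surjective (r : R) x0 s : ball p r `<=` U ->
  (forall x v, ball p r x -> `|'D_v Phi x| <= 2^-1 * `|v|) ->
  0 < s -> closed_ball x0 s `<=` ball p r ->
  forall y, `|(y - tau x0) *m A p| <= 2^-1 * s ->
  exists2 x, closed_ball x0 s x & tau x = y.
Proof.
move=> rU DPhi s0 sr y ys; pose C := closed_ball x0 s.
have CE x : C x <-> `|x0 - x| <= s by rewrite /C closed_ballE.
have x0C : C x0 by apply/CE; rewrite subrr normr0 ltW.
pose T x := Phi x + y *m A p.
have TC : {homo T : x / C x >-> C x}.
  move=> x Cx; apply/CE.
  have -> : x0 - T x = (Phi x0 - Phi x) - (y - tau x0) *m A p.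
    rewrite /T /Phi mulmxBl; move: (tau x *m A p) (tau x0 *m A p) (y *m A p) => a b c.
    by apply/matrixP => i j; rewrite !mxE; ring.
  rewrite (le_trans (ler_normB _ _)) // [s]splitr [s / 2]mulrC lerD //.
  apply: le_trans (Phi_lipschitz rU DPhi (sr _ Cx) (sr _ x0C)) _.
  by rewrite ler_pM2l ?invr_gt0 //; apply/CE.
pose f : {fun C >-> C} := mkfun_fun TC.
have fc : is_contraction f.
  exists (2^-1)%:nng.
  split => /=; first by rewrite invf_lt1 // ltr1n.
  move=> [x x'] /= [Cx Cx']; rewrite /T opprD addrACA subrr addr0.
  exact: (Phi_lipschitz rU DPhi (sr _ Cx') (sr _ Cx)).
have [|x Cx Tx] := @banach_fixed_point R 'rV[R]_n C f fc (@closed_ball_closed _ _ _ _) _;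
  first by exists x0.
exists x => //; apply: mulA_inj => /=; move: Tx; rewrite /= /T /Phi.
by move=> /(congr1 (fun z => z - x));
  rewrite subrr addrAC [x - _ - x]addrAC subrr sub0r addrC => /esym/eqP; rewrite subr_eq0 => /eqP.
Qed.

(** The fields [X i] provide the inverse Jacobian, so the derivative of the local inverse is
    [w *m A (g y)], a smooth expression in [g] itself. Smoothness of [g] then improves by one order
    at each step of an induction. *)
Theorem inverse_function : exists r (g : V -> V),
  [/\ 0 < r, ball p r `<=` U, open (tau @` ball p r),
      forall x, ball p r x -> g (tau x) = x & smooth (tau @` ball p r) g].
Proof.
have [r r0 [rU DPhi]] := Phi_contracting.
pose B := ball p r; pose O := tau @` B.
have [K K0 KP] := mul_mx_bounded (A p).
(* [x - y] splits into an increment of [Phi], at most half of [x - y], and [(tau x - tau y) *m A p];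
   absorbing the first part produces the factor [2]. *)
have dist x y : B x -> B y -> `|x - y| <= 2 * K * `|tau x - tau y|.
  move=> Bx By.
  have E : x - y = (Phi x - Phi y) + (tau x - tau y) *m A p.
    rewrite /Phi mulmxBl opprB addrA; apply/eqP; rewrite -subr_eq0; apply/eqP.
    by rewrite !opprD !opprK !addrA; apply/matrixP => i j; rewrite !mxE; ring.
  have := ler_normD (Phi x - Phi y) ((tau x - tau y) *m A p); rewrite -E.
  move=> le1; have le2 := Phi_lipschitz rU DPhi By Bx; have le3 := KP (tau x - tau y).
  rewrite -mulrA; lra.
have tau_inj x y : B x -> B y -> tau x = tau y -> x = y.
  move=> Bx By xy; have := dist x y Bx By; rewrite xy subrr normr0 mulr0.
  by rewrite normr_le0 subr_eq0 => /eqP.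
(* Outside the image [O] the choice returns the default value [p]. *)
pose g y := xget p [set x | B x /\ tau x = y].
have gK x : B x -> g (tau x) = x.
  move=> Bx; rewrite /g; case: xgetP => [z _ [Bz zx]|/(_ x) []//].
  exact: tau_inj.
have oB : open B by exact: ball_open.
have oO : open O.
  rewrite openE => _ [x0 Bx0 <-]; rewrite /interior.
  have /nbhs_closedballP[s sB] : nbhs x0 B by exact: open_nbhs_nbhs.
  apply/nbhs_ballP; exists (2^-1 * s%:num / K) => /=; first by rewrite divr_gt0 // mulr_gt0 // invr_gt0.
  move=> y; rewrite -ball_normE /= distrC ltr_pdivlMr // mulrC => yK.
  have [|x xs <-] := tau_surjective rU DPhi (gt0 s) sB (y := y).
    by apply: le_trans (KP _) (ltW yK).
  by exists x => //; exact: sB.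
have gB y : O y -> B (g y) by move=> [x Bx <-]; rewrite gK.
have gO y : O y -> tau (g y) = y by move=> [x Bx <-]; rewrite gK.
have dg y : O y -> differentiable g y /\ forall w, 'D_w g y = w *m A (g y).
  move=> Oy; set x0 := g y; have Bx0 : B x0 by exact: gB.
  have Ux0 : U x0 by exact: rU.
  have lc : continuous (mulmxr (A x0) : V -> V) by exact: continuous_mulmxr.
  (* The remainder of [g] at [y] is minus the remainder of [tau] at [x0], multiplied by [A x0];
     [dist] turns an error small relative to [x - x0] into one small relative to [h]. *)
  suff E : g \o shift y = cst (g y) + (mulmxr (A x0) : V -> V) +o_ (0 : V) id.
    have ED := diff_unique lc E.
    have dgy : differentiable g y by apply/diff_locallyP; rewrite ED.
    by split => // w; rewrite derE deriveE // ED.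
  have [L L0 LP] := mul_mx_bounded (A x0).
  have dt := smooth_differentiable tauU Ux0.
  apply/eqaddoP => _/posnumP[e].
  (* The tolerance for [tau] compensates the two losses: the factor [L] of multiplication by [A x0]
     and the factor [2 * K] of [dist]. *)
  have c0 : 0 < e%:num / (L * (2 * K)) by rewrite divr_gt0 // mulr_gt0 // mulr_gt0.
  have /eqaddoP/(_ _ c0) := diff_locally dt.
  move=> /nbhs_ballP[d /= d0 dP].
  have nO : nbhs y O by exact: open_nbhs_nbhs.
  have [d' /= d'0 d'O] := (nbhs_ballP _ _).1 nO.
  (* The first radius keeps [h + y] in the image, the second makes the preimage lie within [d] of
     [x0]. *)
  apply/nbhs_ballP; exists (Num.min d' (d / (2 * K))) => /=.
    by rewrite lt_min d'0 divr_gt0 // mulr_gt0.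
  move=> h; rewrite -ball_normE /= sub0r normrN lt_min => /andP[hd' hd].
  have Oh : O (h + y).
    by apply: d'O; rewrite -ball_normE /= opprD addrC addrNK normrN.
  rewrite !fctE /= /shift; set x := g (h + y); have Bx : B x by exact: gB.
  have xx0 : `|x - x0| <= 2 * K * `|h|.
    by have := dist x x0 Bx Bx0; rewrite !gO // addrK.
  have := dP (x - x0); rewrite -ball_normE /= sub0r normrN => /(_ _).
  have xd : `|x - x0| < d.
    by apply: le_lt_trans xx0 _; rewrite mulrC -ltr_pdivlMr // mulr_gt0.
  move=> /(_ xd); rewrite !fctE /= /shift subrK !gO //.
  rewrite -deriveE // -derE derive_J // => est.
  have -> : x - (x0 + h *m A x0) = - ((h + y - (y + (x - x0) *m J x0)) *m A x0).
    have -> : h + y - (y + (x - x0) *m J x0) = h - (x - x0) *m J x0.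
      by rewrite opprD addrA addrK.
    rewrite mulmxBl -mulmxA mul_J_A // mulmx1.
    by rewrite opprB opprD addrA.
  rewrite normrN; apply: le_trans (LP _) _.
  apply: le_trans (ler_wpM2l (ltW L0) est) _.
  apply: le_trans (ler_wpM2l (ltW L0) (ler_wpM2l (ltW c0) xx0)) _.
  rewrite le_eqVlt; apply/orP; left; apply/eqP; field.
  by rewrite !gt_eqF.
exists r, g; split => //; apply/smooth_uptoP => k; elim: k => [|k IH].
  by split=> // y /dg[].
apply: (upto_step oO (D := fun w y => \sum_i w 0 i *: X i (g y))) => [y /dg[]//|w y|w].
  by move=> /dg[_ ->]; exact: mulA_sum.
apply: (upto_sum oO) => i _; apply: (uptoZ oO); first exact: (upto_cst oO).
apply: (upto_comp oO gB) => //.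
by apply: (smooth_uptoP _ _).1; apply: smooth_onS (XU i).
Qed.

End InverseFunction.

(** * The space C^m and unitary triples *)

Section Dot.
Variables (R : realType) (m : nat).
Implicit Types (u v w : cvect R m) (c : R).

Lemma dotE u v : dot u v = \sum_j (u 0 j * v 0 j + u 1 j * v 1 j).
Proof.
rewrite /dot big_ord_recl big_ord1 -big_split; apply: eq_bigr => j _ /=.
by rewrite (_ : lift ord0 ord0 = 1) //; apply: val_inj.
Qed.

Lemma dotC u v : dot u v = dot v u.
Proof. by rewrite /dot; do 2!apply: eq_bigr => ? _; rewrite mulrC. Qed.

Lemma dotDl u v w : dot (u + v) w = dot u w + dot v w.
Proof.
rewrite /dot -big_split; apply: eq_bigr => k _; rewrite -big_split.
by apply: eq_bigr => j _; rewrite mxE mulrDl.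
Qed.

Lemma dotZl c u w : dot (c *: u) w = c * dot u w.
Proof.
rewrite /dot mulr_sumr; apply: eq_bigr => k _; rewrite mulr_sumr.
by apply: eq_bigr => j _; rewrite mxE mulrA.
Qed.

Lemma dotDr u v w : dot w (u + v) = dot w u + dot w v.
Proof. by rewrite dotC dotDl !(dotC w). Qed.

Lemma dotZr c u w : dot w (c *: u) = c * dot w u.
Proof. by rewrite dotC dotZl (dotC w). Qed.

Lemma dotNl u w : dot (- u) w = - dot u w.
Proof. by rewrite -scaleN1r dotZl mulN1r. Qed.

Lemma dotNr u w : dot w (- u) = - dot w u.
Proof. by rewrite dotC dotNl dotC. Qed.

Lemma dotBl u v w : dot (u - v) w = dot u w - dot v w.
Proof. by rewrite dotDl dotNl. Qed.

Lemma dotBr u v w : dot w (u - v) = dot w u - dot w v.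
Proof. by rewrite dotDr dotNr. Qed.

Lemma dot0l w : dot 0 w = 0.
Proof. by rewrite -(scale0r w) dotZl mul0r. Qed.

Lemma dot0r w : dot w 0 = 0.
Proof. by rewrite dotC dot0l. Qed.

Lemma dot_suml (I : Type) (s : seq I) (P : pred I) (F : I -> cvect R m) w :
  dot (\sum_(i <- s | P i) F i) w = \sum_(i <- s | P i) dot (F i) w.
Proof. by apply: (big_morph (fun u => dot u w)) => [u v|]; rewrite ?dotDl ?dot0l. Qed.

Lemma dot_ge0 u : 0 <= dot u u.
Proof. by do 2!apply: sumr_ge0 => ? _; rewrite -expr2 sqr_ge0. Qed.

Lemma dot_eq0 u : dot u u = 0 -> u = 0.
Proof.
move=> /eqP; rewrite psumr_eq0; last by move=> k _; apply: sumr_ge0 => j _; rewrite -expr2 sqr_ge0.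
move=> /allP u0; apply/matrixP => k j; rewrite mxE.
have := u0 k; rewrite mem_index_enum psumr_eq0 => [/(_ isT)|j' _]; last by rewrite -expr2 sqr_ge0.
by move=> /allP/(_ j); rewrite mem_index_enum => /(_ isT) /=; rewrite mulf_eq0 orbb => /eqP.
Qed.

Lemma JE0 u j : J u 0 j = - u 1 j.
Proof. by rewrite mxE. Qed.

Lemma JE1 u j : J u 1 j = u 0 j.
Proof. by rewrite mxE. Qed.

Lemma cvectP u v : u 0 =1 v 0 -> u 1 =1 v 1 -> u = v.
Proof.
move=> uv0 uv1; apply/matrixP => k j.
by case: k => -[|[|//]] k2; [have := uv0 j|have := uv1 j]; congr (_ = _); congr (_ _ j); apply: val_inj.
Qed.

Lemma J_is_linear : linear (@J R m).
Proof. by move=> c u v; apply: cvectP => j; rewrite !mxE //= opprD mulrN. Qed.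

HB.instance Definition _ := GRing.isLinear.Build R (cvect R m) (cvect R m) _ (@J R m) J_is_linear.

Lemma JK u : J (J u) = - u.
Proof. by apply: cvectP => j; rewrite !mxE. Qed.

Lemma JD u v : J (u + v) = J u + J v. Proof. exact: linearD. Qed.
Lemma JN u : J (- u) = - J u. Proof. exact: linearN. Qed.
Lemma JB u v : J (u - v) = J u - J v. Proof. exact: linearB. Qed.
Lemma JZ c u : J (c *: u) = c *: J u. Proof. exact: linearZ. Qed.

Lemma dotJl u v : dot (J u) v = - dot u (J v).
Proof.
by rewrite !dotE -sumrN; apply: eq_bigr => j _; rewrite !JE0 !JE1; ring.
Qed.

Lemma dotJJ u v : dot (J u) (J v) = dot u v.
Proof. by rewrite dotJl JK dotNr opprK. Qed.

Lemma dotJ0 u : dot (J u) u = 0.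
Proof.
have : dot (J u) u = - dot (J u) u by rewrite {1}dotJl dotC.
by lra.
Qed.

Lemma dot0J u : dot u (J u) = 0.
Proof. by rewrite dotC dotJ0. Qed.

Lemma enorm2 u : enorm u ^+ 2 = dot u u.
Proof. by rewrite sqr_sqrtr ?dot_ge0. Qed.

Lemma sphereP u : sphere u <-> dot u u = 1.
Proof.
rewrite /sphere /=; split=> [u1|u1]; first by rewrite -enorm2 u1 expr1n.
by rewrite /enorm u1 sqrtr1.
Qed.

End Dot.

Section Unitary.
Variables (R : realType) (b : 'I_3 -> cvect R 3).
Hypotheses (bb : forall i j, dot (b i) (b j) = (i == j)%:R)
  (bJb : forall i j, dot (b i) (J (b j)) = 0).

Lemma dot_mxvec m (u v : cvect R m) : dot u v = (mxvec u *m (mxvec v)^T) 0 0.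
Proof.
rewrite /dot pair_bigA mxE (reindex _ (curry_mxvec_bij _ _)) /=.
by apply: eq_bigr => -[k j] _; rewrite mxE !mxvecE.
Qed.

(** The six vectors [b i], [J (b i)] are the rows of a square matrix [B] with [B *m B^T = 1]; being
    square, it also satisfies [B^T *m B = 1], which is the expansion. *)
Lemma unitary_expand (w : cvect R 3) :
  w = \sum_i (dot w (b i) *: b i + dot w (J (b i)) *: J (b i)).
Proof.
pose P : 'M[R]_(3, 2 * 3) := \matrix_i mxvec (b i).
pose Q : 'M[R]_(3, 2 * 3) := \matrix_i mxvec (J (b i)).
have rowd n (A B : 'I_n -> cvect R 3) i j :
    ((\matrix_i mxvec (A i)) *m (\matrix_i mxvec (B i))^T) i j = dot (A i) (B j).
  rewrite dot_mxvec !mxE; apply: eq_bigr => k _; rewrite !mxE //.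
have PP : P *m P^T = 1%:M by apply/matrixP => i j; rewrite rowd bb mxE.
have PQ : P *m Q^T = 0 by apply/matrixP => i j; rewrite rowd bJb mxE.
have QP : Q *m P^T = 0 by rewrite -[Q]trmxK -trmx_mul PQ trmx0.
have QQ : Q *m Q^T = 1%:M by apply/matrixP => i j; rewrite rowd dotJJ bb mxE.
pose B : 'M[R]_(3 + 3) := col_mx P Q.
have BB : B *m B^T = 1%:M.
  by rewrite /B tr_col_mx mul_col_row PP PQ QP QQ -scalar_mx_block.
have := mulmx1C BB; rewrite /B tr_col_mx mul_row_col => one.
apply: (can_inj mxvecK); rewrite -[LHS]mulmx1 -[X in _ *m X]one mulmxDr !mulmxA.
have colc (A : 'I_3 -> cvect R 3) : mxvec w *m (\matrix_i mxvec (A i))^T *m (\matrix_i mxvec (A i))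
    = mxvec (\sum_i dot w (A i) *: A i).
  rewrite linear_sum /= mulmx_sum_row; apply: eq_bigr => i _.
  rewrite linearZ /= rowK; congr (_ *: _).
  by rewrite dot_mxvec !mxE; apply: eq_bigr => k _; rewrite !mxE.
by rewrite !colc -linearD -big_split.
Qed.

End Unitary.

Section Unitary3.
Variable R : realType.
Implicit Types a b c w : cvect R 3.

(** A unitary basis in real terms: the real and the imaginary parts of the Hermitian products. *)
Definition unitary3 a b c : Prop :=
  [/\ dot a a = 1, dot b b = 1 & dot c c = 1] /\
  [/\ dot a b = 0, dot a c = 0 & dot b c = 0] /\
  [/\ dot a (J b) = 0, dot a (J c) = 0 & dot b (J c) = 0].

Lemma unitary3_table a b c : unitary3 a b c ->
  (dot a a = 1) * (dot b b = 1) * (dot c c = 1) *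
  (dot a b = 0) * (dot a c = 0) * (dot b a = 0) *
  (dot c a = 0) * (dot b c = 0) * (dot c b = 0) *
  (dot a (J b) = 0) * (dot a (J c) = 0) * (dot b (J c) = 0) *
  (dot b (J a) = 0) * (dot c (J a) = 0) * (dot c (J b) = 0) *
  (dot (J a) b = 0) * (dot (J a) c = 0) * (dot (J b) c = 0) *
  (dot (J b) a = 0) * (dot (J c) a = 0) * (dot (J c) b = 0).
Proof.
move=> [[a1 a2 a3] [[b1 b2 b3] [d1 d2 d3]]].
rewrite (dotC b a) (dotC c a) (dotC c b) a1 a2 a3 b1 b2 b3 d1 d2 d3.
rewrite (dotC b (J a)) (dotC c (J a)) (dotC c (J b)) (dotC (J b) a) (dotC (J c) a) (dotC (J c) b).
by rewrite d1 d2 d3 !dotJl d1 d2 d3 !oppr0.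
Qed.

Lemma unitary3_expand a b c w : unitary3 a b c ->
  w = (dot w a *: a + dot w (J a) *: J a) + (dot w b *: b + dot w (J b) *: J b)
      + (dot w c *: c + dot w (J c) *: J c).
Proof.
move=> [[aa bb cc] [[ab ac bc] [aJb aJc bJc]]].
have aJb' : dot b (J a) = 0 by rewrite dotC dotJl aJb oppr0.
have aJc' : dot c (J a) = 0 by rewrite dotC dotJl aJc oppr0.
have bJc' : dot c (J b) = 0 by rewrite dotC dotJl bJc oppr0.
pose f (i : 'I_3) := nth 0 [:: a; b; c] i.
have ff i j : dot (f i) (f j) = (i == j)%:R.
  by case: i => -[|[|[|//]]] Hi; case: j => -[|[|[|//]]] Hj; rewrite /f //=;
     rewrite dotC.
have fJf i j : dot (f i) (J (f j)) = 0.
  by case: i => -[|[|[|//]]] Hi; case: j => -[|[|[|//]]] Hj; rewrite /f //= dot0J.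
by rewrite {1}(unitary_expand ff fJf w) !big_ord_recl big_ord0 addr0 !addrA.
Qed.

Lemma unitary3_eq0 a b c w : unitary3 a b c ->
  dot w a = 0 -> dot w (J a) = 0 -> dot w b = 0 -> dot w (J b) = 0 ->
  dot w c = 0 -> dot w (J c) = 0 -> w = 0.
Proof.
move=> abc wa wJa wb wJb wc wJc.
by rewrite (unitary3_expand w abc) wa wJa wb wJb wc wJc !scale0r !addr0.
Qed.

Lemma unitary3_inj a b c v w : unitary3 a b c ->
  dot v a = dot w a -> dot v (J a) = dot w (J a) -> dot v b = dot w b ->
  dot v (J b) = dot w (J b) -> dot v c = dot w c -> dot v (J c) = dot w (J c) -> v = w.
Proof.
move=> abc e1 e2 e3 e4 e5 e6; apply/eqP; rewrite -subr_eq0; apply/eqP.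
by apply: (unitary3_eq0 abc); rewrite dotBl ?(e1, e2, e3, e4, e5, e6) subrr.
Qed.

End Unitary3.

Section DotCalculus.
Variables (R : realType) (V : normedModType R) (m : nat).
Implicit Types (f g : V -> cvect R m) (x v : V).

Lemma diffr_dot f g x : differentiable f x -> differentiable g x ->
  differentiable (fun y => dot (f y) (g y)) x.
Proof.
move=> df dg; apply: (@diffr_sum R V R) => k _; apply: (@diffr_sum R V R) => j _.
by apply: diffrM; apply: diffr_coord.
Qed.

Lemma d_dot f g x v : differentiable f x -> differentiable g x ->
  'D_v (fun y => dot (f y) (g y)) x = dot ('D_v f x) (g x) + dot (f x) ('D_v g x).
Proof.
move=> df dg; have dfg k j : differentiable (fun y => f y k j * g y k j) x.
  by apply: diffrM; apply: diffr_coord.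
rewrite (@dsum R V R); last by move=> k _; apply: (@diffr_sum R V R).
rewrite /dot -big_split; apply: eq_bigr => k _ /=; rewrite (@dsum R V R) // -big_split.
by apply: eq_bigr => j _; rewrite dM ?d_coord //; apply: diffr_coord.
Qed.

Lemma continuous_J : continuous (@J R m : cvect R m -> cvect R m).
Proof.
move=> w; apply: differentiable_continuous; apply: diffr_mx => i j.
under eq_fun do rewrite mxE; case: (i == 0); last exact: differentiable_coord.
by apply: diffrN; exact: differentiable_coord.
Qed.

Lemma diffr_J f x : differentiable f x -> differentiable (fun y => J (f y)) x.
Proof. exact: diffr_lin continuous_J. Qed.

Lemma d_J f x v : differentiable f x -> 'D_v (fun y => J (f y)) x = J ('D_v f x).
Proof. exact: d_lin continuous_J. Qed.

Lemma smooth_dot U f g : open U -> smooth U f -> smooth U g ->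
  smooth U (fun y => dot (f y) (g y)).
Proof.
move=> oU sf sg; apply: smooth_sum => // k _; apply: smooth_sum => // j _.
by apply: smoothM => //; exact: smooth_coord.
Qed.

Lemma smooth_J U f : open U -> smooth U f -> smooth U (fun y => J (f y)).
Proof.
move=> oU sf; apply: smooth_mx => // i j.
case: i => -[|[|//]] Hi.
  apply: (@eq_smooth _ _ _ oU _ (fun y => - f y 1 j)); first by move=> y _; rewrite mxE.
  by apply: smoothN => //; exact: smooth_coord.
apply: (@eq_smooth _ _ _ oU _ (fun y => f y 0 j)); first by move=> y _; rewrite mxE.
exact: smooth_coord.
Qed.

End DotCalculus.

(** * Derivatives along vector fields and commutators *)

Section VectorFields.
Variables (R : realType) (n : nat).
Local Notation V := 'rV[R]_n.
Variables (U : set V) (oU : open U).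
Implicit Types (x v : V) (e : V -> V).

Lemma field_expand (W : normedModType R) (f : V -> W) e x : differentiable f x ->
  'D_(e x) f x = \sum_i e x 0 i *: 'D_(delta_mx 0 i) f x.
Proof.
move=> df; rewrite [e x in LHS]row_delta_sum derive_dir_sum //.
by apply: eq_bigr => i _; rewrite derive_dirZ.
Qed.

Lemma smooth_field_mx m p (f : V -> 'M[R]_(m, p)) e : smooth U f -> smooth U e ->
  smooth U (fun y => 'D_(e y) f y).
Proof.
move=> sf se; apply: (@eq_smooth _ _ _ oU _ (fun y => \sum_i e y 0 i *: 'D_(delta_mx 0 i) f y)).
  by move=> x Ux; rewrite field_expand //; exact: smooth_differentiable Ux.
apply: smooth_sum => // i _; apply: smoothZ => //; first exact: smooth_coord.
exact: smooth_derive.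
Qed.

Lemma smooth_field (f : V -> R) e : smooth U f -> smooth U e ->
  smooth U (fun y => 'D_(e y) f y).
Proof.
move=> sf se; apply: (@eq_smooth _ _ _ oU _ (fun y => \sum_i e y 0 i * 'D_(delta_mx 0 i) f y)).
  by move=> x Ux; rewrite field_expand //; exact: smooth_differentiable Ux.
apply: smooth_sum => // i _; apply: smoothM => //; first exact: smooth_coord.
exact: smooth_derive.
Qed.

Lemma d_field_mx m p (f : V -> 'M[R]_(m, p)) e x v :
  smooth U f -> smooth U e -> U x ->
  'D_v (fun y => 'D_(e y) f y) x = 'D_v ('D_(e x) f) x + 'D_('D_v e x) f x.
Proof.
move=> sf se Ux; have dfU y : U y -> differentiable f y by exact: smooth_differentiable.
have dDf w : differentiable ('D_w f) x by exact: smooth_differentiable (smooth_derive w sf) Ux.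
have de := smooth_differentiable se Ux.
have dei i : differentiable (fun y => e y 0 i) x by exact: diffr_coord.
rewrite (@eq_derive_on _ _ _ _ _ _ _ (fun y => \sum_i e y 0 i *: 'D_(delta_mx 0 i) f y) oU Ux);
  last by move=> y /dfU; exact: field_expand.
rewrite (@dsum R V 'M[R]_(m, p)); last by move=> i _; apply: diffrZ.
have -> : 'D_v ('D_(e x) f) x = \sum_i e x 0 i *: 'D_v ('D_(delta_mx 0 i) f) x.
  rewrite (@eq_derive_on _ _ _ _ _ _ _ (fun y => \sum_i e x 0 i *: 'D_(delta_mx 0 i) f y) oU Ux);
    last by move=> y /dfU; exact: (field_expand (fun=> e x)).
  rewrite (@dsum R V 'M[R]_(m, p)); last by move=> i _; apply: diffrZ => //; exact: differentiable_cst.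
  apply: eq_bigr => i _; rewrite dZ ?d_cst ?scale0r ?add0r //.
rewrite (field_expand (fun=> 'D_v e x) (dfU _ Ux)) -big_split; apply: eq_bigr => i _ /=.
by rewrite dZ // addrC d_coord.
Qed.

Lemma d_field (f : V -> R) e x v :
  smooth U f -> smooth U e -> U x ->
  'D_v (fun y => 'D_(e y) f y) x = 'D_v ('D_(e x) f) x + 'D_('D_v e x) f x.
Proof.
(* The scalar rule is read off from the matrix rule for matrices of size one. *)
move=> sf se Ux; pose F y : 'M[R]_1 := const_mx (f y).
have sF : smooth U F.
  apply: smooth_mx => // i j; apply: (@eq_smooth _ _ _ oU _ f) => // y _.
  by rewrite mxE.
have DF w y : U y -> 'D_w F y 0 0 = 'D_w f y.
  move=> Uy; rewrite -d_coord; last exact: smooth_differentiable Uy.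
  by apply: (eq_derive_on _ oU Uy) => z _; rewrite mxE.
have := congr1 (fun A : 'M[R]_1 => A 0 0) (d_field_mx v sF se Ux).
rewrite !mxE -!d_coord; last first.
  exact: smooth_differentiable (smooth_field_mx sF se) Ux.
  exact: smooth_differentiable (smooth_derive _ sF) Ux.
  exact: smooth_differentiable Ux.
rewrite (@eq_derive_on _ _ _ _ _ _ _ (fun y => 'D_(e y) f y) oU Ux (fun y => @DF (e y) y)).
rewrite (@eq_derive_on _ _ _ _ _ _ _ (fun y => 'D_(e x) f y) oU Ux (@DF (e x))).
by move=> ->; congr (_ + _); apply: (eq_derive_on _ oU Ux) => z _; rewrite mxE.
Qed.

Definition bracket (e1 e2 : V -> V) x : V := 'D_(e1 x) e2 x - 'D_(e2 x) e1 x.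

Lemma commutator (f : V -> R) e1 e2 x :
  smooth U f -> smooth U e1 -> smooth U e2 -> U x ->
  'D_(e1 x) (fun y => 'D_(e2 y) f y) x - 'D_(e2 x) (fun y => 'D_(e1 y) f y) x
  = 'D_(bracket e1 e2 x) f x.
Proof.
move=> sf s1 s2 Ux; rewrite (d_field _ sf s2 Ux) (d_field _ sf s1 Ux) (schwarz_scalar _ _ oU sf Ux).
by rewrite opprD addrACA subrr add0r derive_dirB //; exact: smooth_differentiable Ux.
Qed.

Lemma commutator_mx m p (f : V -> 'M[R]_(m, p)) e1 e2 x :
  smooth U f -> smooth U e1 -> smooth U e2 -> U x ->
  'D_(e1 x) (fun y => 'D_(e2 y) f y) x - 'D_(e2 x) (fun y => 'D_(e1 y) f y) x
  = 'D_(bracket e1 e2 x) f x.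
Proof.
move=> sf s1 s2 Ux; rewrite (d_field_mx _ sf s2 Ux) (d_field_mx _ sf s1 Ux) (schwarz _ _ oU sf Ux).
by rewrite opprD addrACA subrr add0r derive_dirB //; exact: smooth_differentiable Ux.
Qed.

End VectorFields.

(** * Immersions in an orthonormal frame *)

Section PointFrame.
Variables (R : realType) (n m : nat) (F : 'rV[R]_n -> cvect R m).
Local Notation V := 'rV[R]_n.
Variables (x : V) (dF : differentiable F x).

Lemma metricE u v : metric F x u v = dot ('D_u F x) ('D_v F x).
Proof. by rewrite /metric -!derE. Qed.

Lemma gramE i j : gram F x i j = dot ('D_(delta_mx 0 i) F x) ('D_(delta_mx 0 j) F x).
Proof. by rewrite mxE metricE. Qed.

Lemma metric_gram u v : metric F x u v = (u *m gram F x *m v^T) 0 0.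
Proof.
rewrite metricE [u in LHS]row_delta_sum [v in LHS]row_delta_sum !derive_dir_sum //.
rewrite dot_suml -mulmxA mxE; apply: eq_bigr => i _.
rewrite derive_dirZ // dotZl mxE; congr (_ * _).
rewrite dotC dot_suml; apply: eq_bigr => j _.
by rewrite derive_dirZ // dotZl gramE mxE mulrC dotC.
Qed.

Variables (e : 'I_n -> V)
  (ee : forall i j, dot ('D_(e i) F x) ('D_(e j) F x) = (i == j)%:R).

Let P : 'M[R]_n := \matrix_i e i.

(** Orthonormality says that [P G P^T = 1] for the square matrix [P] of frame vectors; moving [P] to
    the other side yields the inverse Gram matrix. This is how every coordinate expression is
    rewritten in the frame. *)
Lemma gram_frame : gram F x *m (P^T *m P) = 1%:M.
Proof.
have PGP : P *m (gram F x *m P^T) = 1%:M.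
  apply/matrixP => i j; rewrite [RHS]mxE -ee -metricE metric_gram mulmxA.
  rewrite [in RHS]mxE mxE; apply: eq_bigr => c _; rewrite !mxE; congr (_ * _).
  by apply: eq_bigr => d _; rewrite !mxE.
by rewrite mulmxA (mulmx1C PGP).
Qed.

Lemma inv_gram k l : invmx (gram F x) k l = \sum_a e a 0 k * e a 0 l.
Proof.
have Gu : gram F x \in unitmx by have [] := mulmx1_unit gram_frame.
have -> : invmx (gram F x) = P^T *m P by rewrite -[LHS]mulmx1 -gram_frame mulKmx.
by rewrite mxE; apply: eq_bigr => a _; rewrite !mxE.
Qed.

Lemma tangent_coordE w :
  tangent_coord F x w = \sum_a dot w ('D_(e a) F x) *: e a.
Proof.
apply/rowP => k; rewrite mxE summxE.
under eq_bigr do rewrite inv_gram -derE mulr_suml.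
rewrite exchange_big; apply: eq_bigr => a _; rewrite mxE.
rewrite (field_expand (fun=> e a) dF) dotC dot_suml mulr_suml; apply: eq_bigr => l _.
by rewrite dotZl (dotC w); ring.
Qed.

Lemma tangent_partE w :
  'D_(tangent_coord F x w) F x = \sum_a dot w ('D_(e a) F x) *: 'D_(e a) F x.
Proof.
rewrite tangent_coordE derive_dir_sum //.
by apply: eq_bigr => a _; rewrite derive_dirZ.
Qed.

Lemma normal_partE w : normal_part F x w =
  w - \sum_a dot w ('D_(e a) F x) *: 'D_(e a) F x - dot w (F x) *: F x.
Proof. by rewrite /normal_part -derE tangent_partE. Qed.

Lemma dot_normal_part w nu : (forall a, dot ('D_(e a) F x) nu = 0) -> dot (F x) nu = 0 ->
  dot (normal_part F x w) nu = dot w nu.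
Proof.
move=> Enu Fnu; rewrite normal_partE !dotBl dotZl Fnu mulr0 subr0 dot_suml big1 ?subr0 //.
by move=> a _; rewrite dotZl Enu mulr0.
Qed.

Lemma normal_part_lin c w w' : normal_part F x (c *: w + w') =
  c *: normal_part F x w + normal_part F x w'.
Proof.
rewrite !normal_partE dotDl dotZl [in LHS]scalerDl.
under eq_bigr do rewrite dotDl dotZl scalerDl -scalerA.
rewrite big_split -scaler_sumr /= !scalerBr -scalerA.
by rewrite !opprD !addrA -!scalerN; apply/matrixP => i j; rewrite !mxE; ring.
Qed.

Lemma normal_part0 : normal_part F x 0 = 0.
Proof.
by have := normal_part_lin (-1) 0 0; rewrite scaler0 addr0 scaleN1r addNr.
Qed.

Lemma normal_part_sum (I : Type) (s : seq I) (Q : pred I) (w : I -> cvect R m) :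
  normal_part F x (\sum_(i <- s | Q i) w i) = \sum_(i <- s | Q i) normal_part F x (w i).
Proof.
apply: (big_morph (normal_part F x)) => [u v|]; last exact: normal_part0.
by rewrite -[u]scale1r normal_part_lin !scale1r.
Qed.

Lemma normal_partZ c w : normal_part F x (c *: w) = c *: normal_part F x w.
Proof. by rewrite -[c *: w]addr0 normal_part_lin normal_part0 addr0. Qed.

Lemma tangent_coord_tangent v : tangent_coord F x ('D_v F x) = v.
Proof.
rewrite tangent_coordE -[RHS]mulmx1 -gram_frame !mulmxA [RHS]mulmx_sum_row.
apply: eq_bigr => a _; rewrite rowK -metricE metric_gram; congr (_ *: _).
by rewrite !mxE; apply: eq_bigr => i _; rewrite !mxE.
Qed.

Lemma normal_part_tangent v : dot ('D_v F x) (F x) = 0 -> normal_part F x ('D_v F x) = 0.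
Proof.
by move=> vF; rewrite /normal_part tangent_coord_tangent -derE subrr vF scale0r subr0.
Qed.

Lemma tangent_coordD w w' :
  tangent_coord F x (w + w') = tangent_coord F x w + tangent_coord F x w'.
Proof.
by rewrite !tangent_coordE -big_split; apply: eq_bigr => a _; rewrite dotDl scalerDl.
Qed.

Variables (U : set V) (oU : open U) (sF : smooth U F) (Ux : U x).

Lemma second_derivative_expand u v : 'D_u ('D_v F) x =
  \sum_i \sum_j u 0 i *: (v 0 j *: 'D_(delta_mx 0 i) ('D_(delta_mx 0 j) F) x).
Proof.
have dD w : differentiable ('D_w F) x by exact: smooth_differentiable (smooth_derive w sF) Ux.
rewrite [u in LHS]row_delta_sum derive_dir_sum //; apply: eq_bigr => i _.
rewrite derive_dirZ // -scaler_sumr; congr (_ *: _).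
rewrite (@eq_derive_on _ _ _ _ _ _ _ (fun y => \sum_j v 0 j *: 'D_(delta_mx 0 j) F y) oU Ux).
  rewrite (@dsum R V (cvect R m)); last by move=> j _; apply: diffrZ => //; exact: differentiable_cst.
  by apply: eq_bigr => j _; rewrite dZ ?d_cst ?scale0r ?add0r //.
by move=> y Uy; apply: (field_expand (fun=> v)); exact: smooth_differentiable Uy.
Qed.

Lemma mean_curvature_vectorE : mean_curvature_vector F x =
  n%:R^-1 *: \sum_a normal_part F x ('D_(e a) ('D_(e a) F) x).
Proof.
rewrite /mean_curvature_vector; congr (_ *: _).
under [RHS]eq_bigr => a _.
  rewrite second_derivative_expand normal_part_sum.
  under eq_bigr => i _.
    rewrite normal_part_sum; under eq_bigr do rewrite !normal_partZ.
    over.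
  over.
rewrite [RHS]exchange_big; apply: eq_bigr => i _ /=.
rewrite [RHS]exchange_big; apply: eq_bigr => j _ /=.
rewrite inv_gram scaler_suml; apply: eq_bigr => a _.
by rewrite scalerA /second_fundamental_form -derE der_funE.
Qed.

(** Each derivative of the Gram matrix splits into two products with a second derivative of [F]; by
    symmetry of second derivatives, four of the six terms of Koszul's formula cancel and the other
    two coincide. *)
Lemma christoffelE k i j : christoffel F x k i j = \sum_l invmx (gram F x) k l *
  dot ('D_(delta_mx 0 i) ('D_(delta_mx 0 j) F) x) ('D_(delta_mx 0 l) F x).
Proof.
have dD w : differentiable ('D_w F) x by exact: smooth_differentiable (smooth_derive w sF) Ux.
have Dg a b c : derive (fun y => gram F y a b) x (delta_mx 0 c) =
    dot ('D_(delta_mx 0 c) ('D_(delta_mx 0 a) F) x) ('D_(delta_mx 0 b) F x) +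
    dot ('D_(delta_mx 0 a) F x) ('D_(delta_mx 0 c) ('D_(delta_mx 0 b) F) x).
  rewrite -derE -d_dot //; congr der; apply/funext => y.
  by rewrite mxE /metric -!derE.
rewrite /christoffel mulr_sumr; apply: eq_bigr => l _; rewrite !Dg.
rewrite (schwarz (delta_mx 0 j) (delta_mx 0 i) oU sF Ux).
rewrite (schwarz (delta_mx 0 l) (delta_mx 0 i) oU sF Ux).
rewrite (schwarz (delta_mx 0 l) (delta_mx 0 j) oU sF Ux).
rewrite (dotC ('D_(delta_mx 0 i) ('D_(delta_mx 0 l) F) x) ('D_(delta_mx 0 j) F x)).
by field.
Qed.

(** The intrinsic connection is the tangential part of the ambient derivative: the derivative of the
    components of [Y] is reproduced by [tangent_coord_tangent], and the second derivatives of [F]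
    produce the Christoffel symbols. *)
Lemma levi_civitaE (X Y : V -> V) : smooth U Y ->
  levi_civita F X Y x = tangent_coord F x ('D_(X x) (fun y => 'D_(Y y) F y) x).
Proof.
move=> sY; rewrite (d_field_mx oU _ sF sY Ux) tangent_coordD tangent_coord_tangent.
rewrite /levi_civita -derE addrC; congr (_ + _); apply/rowP => k; rewrite !mxE.
rewrite second_derivative_expand.
under [RHS]eq_bigr => l _.
  rewrite dot_suml mulr_sumr.
  under eq_bigr => i _.
    rewrite dot_suml mulr_sumr; over.
  over.
rewrite [RHS]exchange_big; apply: eq_bigr => i _ /=.
rewrite [RHS]exchange_big; apply: eq_bigr => j _ /=.
rewrite christoffelE !mulr_suml; apply: eq_bigr => l _.
by rewrite !dotZl -derE; ring.
Qed.

End PointFrame.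

Definition dotlin := (dotDl, dotDr, dotZl, dotZr, dotNl, dotNr).

Section Along.
Variables (R : realType) (n : nat).
Local Notation V := 'rV[R]_n.
Implicit Types (e : V -> V) (x : V) (U : set V).

(** Turns a vector field into an operator on functions, so that frame derivatives can be iterated as
    [D1 (D2 f)]. *)
Definition along (e : V -> V) (W : normedModType R) (f : V -> W) (x : V) : W := 'D_(e x) f x.

Lemma alongE e (W : normedModType R) (f : V -> W) x : 'D_(e x) f x = along e f x.
Proof. by []. Qed.

Lemma eq_along U e (W : normedModType R) (f g : V -> W) x : open U -> U x ->
  (forall y, U y -> f y = g y) -> along e f x = along e g x.
Proof. exact: eq_derive_on. Qed.

Lemma along_cst e (W : normedModType R) (c : W) x : along e (fun=> c) x = 0.
Proof. exact: d_cst. Qed.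

Lemma alongD e (W : normedModType R) (f g : V -> W) x : differentiable f x -> differentiable g x ->
  along e (fun y => f y + g y) x = along e f x + along e g x.
Proof. exact: dD. Qed.

Lemma alongB e (W : normedModType R) (f g : V -> W) x : differentiable f x -> differentiable g x ->
  along e (fun y => f y - g y) x = along e f x - along e g x.
Proof. exact: dB. Qed.

Lemma alongN e (W : normedModType R) (f : V -> W) x : differentiable f x ->
  along e (fun y => - f y) x = - along e f x.
Proof. exact: dN. Qed.

Lemma alongM e (a b : V -> R) x : differentiable a x -> differentiable b x ->
  along e (fun y => a y * b y) x = along e a x * b x + a x * along e b x.
Proof. exact: dM. Qed.

Lemma alongV e (a : V -> R) x : a x != 0 -> differentiable a x ->
  along e (fun y => (a y)^-1) x = - (along e a x * ((a x)^-1 * (a x)^-1)).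
Proof. exact: dV. Qed.

Lemma alongZ e m p (a : V -> R) (f : V -> 'M[R]_(m, p)) x : differentiable a x ->
  differentiable f x ->
  along e (fun y => a y *: f y) x = along e a x *: f x + a x *: along e f x.
Proof. exact: dZ. Qed.

Lemma along_dot e m (f g : V -> cvect R m) x : differentiable f x -> differentiable g x ->
  along e (fun y => dot (f y) (g y)) x = dot (along e f x) (g x) + dot (f x) (along e g x).
Proof. exact: d_dot. Qed.

Lemma along_J e m (f : V -> cvect R m) x : differentiable f x ->
  along e (fun y => J (f y)) x = J (along e f x).
Proof. exact: d_J. Qed.

Lemma along_fun e (phi : R -> R) (d : R) (a : V -> R) x : is_derive (a x) 1 phi d ->
  differentiable a x -> along e (fun y => phi (a y)) x = along e a x * d.
Proof. exact: d1. Qed.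

Lemma smooth_along_mx U e m p (f : V -> 'M[R]_(m, p)) : open U -> smooth U f -> smooth U e ->
  smooth U (along e f).
Proof. by move=> oU sf se; exact: (smooth_field_mx oU sf se). Qed.

Lemma smooth_along U e (f : V -> R) : open U -> smooth U f -> smooth U e ->
  smooth U (along e f).
Proof. by move=> oU sf se; exact: (smooth_field oU sf se). Qed.

Lemma bracket_along U (f : V -> R) e1 e2 x : open U ->
  smooth U f -> smooth U e1 -> smooth U e2 -> U x ->
  along e1 (along e2 f) x - along e2 (along e1 f) x = 'D_(bracket e1 e2 x) f x.
Proof. by move=> oU sf s1 s2 Ux; exact: (commutator oU sf s1 s2 Ux). Qed.

Lemma bracket_along_mx U m p (f : V -> 'M[R]_(m, p)) e1 e2 x : open U ->
  smooth U f -> smooth U e1 -> smooth U e2 -> U x ->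
  along e1 (along e2 f) x - along e2 (along e1 f) x = 'D_(bracket e1 e2 x) f x.
Proof. by move=> oU sf s1 s2 Ux; exact: (commutator_mx oU sf s1 s2 Ux). Qed.

End Along.
Arguments along : simpl never.

(** * Structure equations of a Legendre surface *)

Section LegendreFrame.
Variables (R : realType).
Local Notation V := 'rV[R]_2.
Variables (F : V -> cvect R 3) (W : set V) (oW : open W) (sF : smooth W F).
Hypotheses (FF : forall x, W x -> dot (F x) (F x) = 1)
  (FL : forall x v, W x -> dot (J ('D_v F x)) (F x) = 0)
  (FI : forall x v, W x -> 'D_v F x = 0 -> v = 0).

Lemma tangent_orthogonal x v : W x -> dot ('D_v F x) (F x) = 0.
Proof.
move=> Wx; have dF := smooth_differentiable sF Wx.
have := @eq_derive_on _ _ _ x v W (fun y => dot (F y) (F y)) (fun=> 1) oW Wx FF.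
by rewrite d_cst d_dot // [X in _ + X]dotC; lra.
Qed.

(** Differentiating the Legendre condition along a second direction and using that second
    derivatives commute makes [dot (J ('D_v F)) ('D_u F)] symmetric in [u] and [v]; it is
    antisymmetric because [J] is skew. *)
Lemma tangent_lagrangian x u v : W x -> dot ('D_u F x) (J ('D_v F x)) = 0.
Proof.
move=> Wx; have dF := smooth_differentiable sF Wx.
have dD w : differentiable ('D_w F) x by exact: smooth_differentiable (smooth_derive w sF) Wx.
have key a b : dot (J ('D_a ('D_b F) x)) (F x) + dot (J ('D_b F x)) ('D_a F x) = 0.
  have := @eq_derive_on _ _ _ x a W (fun y => dot (J ('D_b F y)) (F y)) (fun=> 0) oW Wx
    (fun y => @FL y b).
  by rewrite d_cst d_dot ?d_J //; exact: diffr_J.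
have k1 := key u v; have k2 := key v u.
rewrite (schwarz v u oW sF Wx) in k2.
by move: k1 k2; rewrite [dot (J ('D_v F x)) _]dotC [dot (J ('D_u F x)) _]dotJl; lra.
Qed.

Variables (e1 e2 : V -> V) (s1 : smooth W e1) (s2 : smooth W e2).
Local Notation D1 := (along e1).
Local Notation D2 := (along e2).
Local Notation E1 := (along e1 F).
Local Notation E2 := (along e2 F).
Hypotheses (E11 : forall x, W x -> dot (E1 x) (E1 x) = 1)
  (E22 : forall x, W x -> dot (E2 x) (E2 x) = 1)
  (E12 : forall x, W x -> dot (E1 x) (E2 x) = 0).

Lemma frame_unitary x : W x -> unitary3 (F x) (E1 x) (E2 x).
Proof.
move=> Wx; split; first by split; [exact: FF|exact: E11|exact: E22].
split; split.
- by rewrite dotC; exact: tangent_orthogonal.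
- by rewrite dotC; exact: tangent_orthogonal.
- exact: E12.
- by rewrite dotC; exact: FL.
- by rewrite dotC; exact: FL.
- exact: tangent_lagrangian.
Qed.

Lemma smooth_E1 : smooth W E1. Proof. exact: smooth_along_mx. Qed.
Lemma smooth_E2 : smooth W E2. Proof. exact: smooth_along_mx. Qed.

Let dE1 x (Wx : W x) := smooth_differentiable smooth_E1 Wx.
Let dE2 x (Wx : W x) := smooth_differentiable smooth_E2 Wx.

Lemma dot_rule (A B : V -> cvect R 3) (c : R) x v : smooth W A -> smooth W B -> W x ->
  (forall y, W y -> dot (A y) (B y) = c) -> dot ('D_v A x) (B x) = - dot (A x) ('D_v B x).
Proof.
move=> sA sB Wx AB.
have := @eq_derive_on _ _ _ x v W (fun y => dot (A y) (B y)) (fun=> c) oW Wx AB.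
rewrite d_cst d_dot; [lra|exact: smooth_differentiable sA Wx|exact: smooth_differentiable sB Wx].
Qed.

(** [w1] and [w2] are the values on [e1] and [e2] of the connection form of the frame. *)
Definition w1 (x : V) : R := dot (D1 E1 x) (E2 x).
Definition w2 (x : V) : R := dot (D2 E1 x) (E2 x).
(** The components of the cubic form, the inner product of [h(X, Y)] with [J Z]. Its total symmetry,
    proved in [structure_eqs], leaves these four. *)
Definition c111 (x : V) : R := dot (D1 E1 x) (J (E1 x)).
Definition c112 (x : V) : R := dot (D1 E1 x) (J (E2 x)).
Definition c122 (x : V) : R := dot (D1 E2 x) (J (E2 x)).
Definition c222 (x : V) : R := dot (D2 E2 x) (J (E2 x)).
Local Notation p := c111. Local Notation q := c112.
Local Notation s := c122. Local Notation t := c222.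

Lemma smooth_w1 : smooth W w1.
Proof. by apply: (smooth_dot oW) smooth_E2; apply: smooth_along_mx => //; exact: smooth_E1. Qed.
Lemma smooth_w2 : smooth W w2.
Proof. by apply: (smooth_dot oW) smooth_E2; apply: smooth_along_mx => //; exact: smooth_E1. Qed.
Lemma smooth_c111 : smooth W p.
Proof.
apply: (smooth_dot oW); last by apply: (smooth_J oW); exact: smooth_E1.
by apply: smooth_along_mx => //; exact: smooth_E1.
Qed.
Lemma smooth_c112 : smooth W q.
Proof.
apply: (smooth_dot oW); last by apply: (smooth_J oW); exact: smooth_E2.
by apply: smooth_along_mx => //; exact: smooth_E1.
Qed.
Lemma smooth_c122 : smooth W s.
Proof.
apply: (smooth_dot oW); last by apply: (smooth_J oW); exact: smooth_E2.
by apply: smooth_along_mx => //; exact: smooth_E2.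
Qed.
Lemma smooth_c222 : smooth W t.
Proof.
apply: (smooth_dot oW); last by apply: (smooth_J oW); exact: smooth_E2.
by apply: smooth_along_mx => //; exact: smooth_E2.
Qed.

Section AtPoint.
Variables (x : V) (Wx : W x).

Let dF : differentiable F x := smooth_differentiable sF Wx.
Let u3 := frame_unitary Wx.

Definition frame_table := unitary3_table u3.

Lemma bracket_dot (nu : cvect R 3) : dot ('D_(bracket e1 e2 x) F x) nu = 0 ->
  dot (D1 E2 x) nu = dot (D2 E1 x) nu.
Proof.
by rewrite -(bracket_along_mx oW sF s1 s2 Wx) dotBl => /eqP; rewrite subr_eq0 => /eqP.
Qed.

(** The derivatives are expanded in the unitary basis [F, E1, E2]. Differentiated orthogonality
    relations give the coefficients on [F], [J F], [E1], [E2]. For the symmetry of the remaining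
    ones, [D1 E2 - D2 E1] is the image of the bracket, hence tangent and orthogonal to [J E1] and
    [J E2] ([b1], [b2]), while [r12J] differentiates the Lagrangian condition. *)
Lemma structure_eqs :
  [/\ D1 E1 x = w1 x *: E2 x + p x *: J (E1 x) + q x *: J (E2 x) - F x,
      D1 E2 x = - w1 x *: E1 x + q x *: J (E1 x) + s x *: J (E2 x),
      D2 E1 x = w2 x *: E2 x + q x *: J (E1 x) + s x *: J (E2 x) &
      D2 E2 x = - w2 x *: E1 x + s x *: J (E1 x) + t x *: J (E2 x) - F x].
Proof.
have T := frame_table.
have sJE1 : smooth W (fun y => J (E1 y)) by apply: (smooth_J oW); exact: smooth_E1.
have sJE2 : smooth W (fun y => J (E2 y)) by apply: (smooth_J oW); exact: smooth_E2.
have sJF : smooth W (fun y => J (F y)) by exact: (smooth_J oW).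
have r1F v : dot ('D_v E1 x) (F x) = - dot (E1 x) ('D_v F x).
  by apply: (dot_rule v smooth_E1 sF Wx (c := 0)) => y Wy; exact: tangent_orthogonal.
have r2F v : dot ('D_v E2 x) (F x) = - dot (E2 x) ('D_v F x).
  by apply: (dot_rule v smooth_E2 sF Wx (c := 0)) => y Wy; exact: tangent_orthogonal.
have r1JF v : dot ('D_v E1 x) (J (F x)) = - dot (E1 x) (J ('D_v F x)).
  rewrite -d_J //; apply: (dot_rule v smooth_E1 sJF Wx (c := 0)) => y Wy.
  by apply/eqP; rewrite -oppr_eq0 -dotJl FL.
have r2JF v : dot ('D_v E2 x) (J (F x)) = - dot (E2 x) (J ('D_v F x)).
  rewrite -d_J //; apply: (dot_rule v smooth_E2 sJF Wx (c := 0)) => y Wy.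
  by apply/eqP; rewrite -oppr_eq0 -dotJl FL.
have r11 v : dot ('D_v E1 x) (E1 x) = 0.
  by have := dot_rule v smooth_E1 smooth_E1 Wx E11; rewrite [X in - X]dotC; lra.
have r22 v : dot ('D_v E2 x) (E2 x) = 0.
  by have := dot_rule v smooth_E2 smooth_E2 Wx E22; rewrite [X in - X]dotC; lra.
have r21 v : dot ('D_v E2 x) (E1 x) = - dot ('D_v E1 x) (E2 x).
  by rewrite (dot_rule v smooth_E1 smooth_E2 Wx E12) opprK dotC.
have r12J v : dot ('D_v E1 x) (J (E2 x)) = dot ('D_v E2 x) (J (E1 x)).
  have := dot_rule v smooth_E1 sJE2 Wx (c := 0); rewrite d_J; last exact: dE2.
  by move=> ->; [rewrite -dotJl dotC|move=> y Wy; exact: tangent_lagrangian].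
have bJ nu : W x -> dot ('D_(bracket e1 e2 x) F x) (J ('D_nu F x)) = 0.
  by move=> _; exact: tangent_lagrangian.
have b1 := bracket_dot (bJ (e1 x) Wx); have b2 := bracket_dot (bJ (e2 x) Wx).
have exp X := unitary3_expand X u3; rewrite !alongE in b1 b2.
split; rewrite [LHS]exp ?(r1F, r2F, r1JF, r2JF, r11, r22, r21) ?T ?dot0J.
- rewrite -/(w1 x) -/(c111 x) -/(c112 x);
  by move: (F x) (J (F x)) (E1 x) (J (E1 x)) (E2 x) (J (E2 x)) => f jf a ja b jb;
    apply/matrixP => i j; rewrite !mxE; ring.
- rewrite -r12J -/(w1 x) -/(c122 x) -/(c112 x);
  by move: (F x) (J (F x)) (E1 x) (J (E1 x)) (E2 x) (J (E2 x)) => f jf a ja b jb;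
    apply/matrixP => i j; rewrite !mxE; ring.
- rewrite -b1 -b2 -r12J -/(w2 x) -/(c122 x) -/(c112 x).
  by move: (F x) (J (F x)) (E1 x) (J (E1 x)) (E2 x) (J (E2 x)) => f jf a ja b jb;
    apply/matrixP => i j; rewrite !mxE; ring.
- rewrite -r12J -b2 -/(w2 x) -/(c122 x) -/(c222 x).
  by move: (F x) (J (F x)) (E1 x) (J (E1 x)) (E2 x) (J (E2 x)) => f jf a ja b jb;
    apply/matrixP => i j; rewrite !mxE; ring.
Qed.

(** In [D1 E2 - D2 E1] the normal terms cancel by symmetry of the cubic form; injectivity of the
    differential of [F] brings the identity back to the source. *)
Lemma bracketE : bracket e1 e2 x = - (w1 x *: e1 x) - w2 x *: e2 x.
Proof.
have [_ D12 D21 _] := structure_eqs.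
apply/eqP; rewrite -subr_eq0; apply/eqP; apply: (FI Wx).
move: (bracket_along_mx oW sF s1 s2 Wx); rewrite D12 D21.
move: (bracket e1 e2 x) => b Hb; rewrite -scaleNr !derive_dirB // !derive_dirZ // -Hb !alongE.
move: (J (E1 x)) (E1 x) (J (E2 x)) (E2 x) => {Hb} a a' c d.
by apply/matrixP => i j; rewrite !mxE; ring.
Qed.

Lemma commutator_frame (f : V -> R) : smooth W f ->
  D1 (D2 f) x - D2 (D1 f) x = - w1 x * D1 f x - w2 x * D2 f x.
Proof.
move=> sf; have df := smooth_differentiable sf Wx.
rewrite (bracket_along oW sf s1 s2 Wx) bracketE derive_dirB // derive_dirZ //.
by rewrite -scaleNr derive_dirZ // !alongE.
Qed.

(** The common source of the integrability conditions: the commutator formula for [X], paired with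
    [N]. The pairs [(E1, J E1)], [(E1, J E2)], [(E2, J E2)] give the three Codazzi equations, and
    [(E1, E2)] gives the Gauss equation. *)
Lemma codazzi_dot (X N : V -> cvect R 3) : smooth W X -> smooth W N ->
  D1 (fun y => dot (D2 X y) (N y)) x - dot (D2 X x) (D1 N x) -
  (D2 (fun y => dot (D1 X y) (N y)) x - dot (D1 X x) (D2 N x)) =
  - w1 x * dot (D1 X x) (N x) - w2 x * dot (D2 X x) (N x).
Proof.
move=> sX sN; have dX := smooth_differentiable sX Wx; have dN := smooth_differentiable sN Wx.
have dD1 := smooth_differentiable (smooth_along_mx oW sX s1) Wx.
have dD2 := smooth_differentiable (smooth_along_mx oW sX s2) Wx.
rewrite (along_dot e1 dD2 dN) (along_dot e2 dD1 dN) !addrK -dotBl.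
rewrite (bracket_along_mx oW sX s1 s2 Wx) bracketE derive_dirB // derive_dirZ //.
by rewrite -scaleNr derive_dirZ // !alongE !dotlin mulNr.
Qed.

End AtPoint.

(** * Codazzi and Gauss equations *)

Section GaussCodazzi.
Variables (x : V) (Wx : W x).

Let sJE1 : smooth W (fun y => J (E1 y)). Proof. by apply: (smooth_J oW); exact: smooth_E1. Qed.
Let sJE2 : smooth W (fun y => J (E2 y)). Proof. by apply: (smooth_J oW); exact: smooth_E2. Qed.

Lemma dot_structure y : W y ->
  (dot (D1 E1 y) (E2 y) = w1 y) * (dot (D2 E1 y) (E2 y) = w2 y) *
  (dot (D1 E1 y) (J (E1 y)) = p y) * (dot (D1 E1 y) (J (E2 y)) = q y) *
  (dot (D2 E1 y) (J (E1 y)) = q y) * (dot (D2 E1 y) (J (E2 y)) = s y) *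
  (dot (D1 E2 y) (J (E2 y)) = s y) * (dot (D2 E2 y) (J (E2 y)) = t y).
Proof.
move=> Wy; have [_ _ D21 _] := structure_eqs Wy; have T := frame_table Wy.
have e21 : dot (D2 E1 y) (E2 y) = w2 y by [].
by rewrite -e21 D21 !dotlin !dotJJ !T !dot0J; do ![split]; rewrite -?D21 //; ring.
Qed.

Let ed (f g : V -> R) e : (forall y, W y -> f y = g y) -> along e f x = along e g x.
Proof. exact: eq_along. Qed.

Lemma codazzi1 : D1 q x - D2 p x = 2 * w1 x * s x - w1 x * p x - 3 * w2 x * q x.
Proof.
have [D11 D12 D21 D22] := structure_eqs Wx; have T := frame_table Wx.
have := codazzi_dot Wx smooth_E1 sJE1.
rewrite (@ed _ q) => [|y Wy]; last by rewrite (dot_structure Wy).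
rewrite (@ed (fun y => dot (D1 E1 y) (J (E1 y))) p) // !along_J; try exact: dE1.
rewrite !(dot_structure Wx) D11 D21.
rewrite !(dotlin, JD, JZ, JN, JK) !dotJJ !T !dot0J !dotJ0.
by move: (D1 q x) (D2 p x) (w1 x) (w2 x) (p x) (q x) (s x) => *; lra.
Qed.

Lemma codazzi2 : D1 s x - D2 q x = w1 x * t x + w2 x * p x - 2 * w2 x * s x - 2 * w1 x * q x.
Proof.
have [D11 D12 D21 D22] := structure_eqs Wx; have T := frame_table Wx.
have := codazzi_dot Wx smooth_E1 sJE2.
rewrite (@ed _ s) => [|y Wy]; last by rewrite (dot_structure Wy).
rewrite (@ed (fun y => dot (D1 E1 y) (J (E2 y))) q) // !along_J; try exact: dE2.
rewrite !(dot_structure Wx) D11 D12 D21 D22.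
rewrite !(dotlin, JD, JZ, JN, JK) !dotJJ !T !dot0J !dotJ0.
by move: (D1 s x) (D2 q x) (w1 x) (w2 x) (p x) (q x) (s x) (t x) => *; lra.
Qed.

Lemma codazzi3 : D1 t x - D2 s x = 2 * w2 x * q x - 3 * w1 x * s x - w2 x * t x.
Proof.
have [D11 D12 D21 D22] := structure_eqs Wx; have T := frame_table Wx.
have := codazzi_dot Wx smooth_E2 sJE2.
rewrite (@ed (fun y => dot (D2 E2 y) (J (E2 y))) t) //.
rewrite (@ed (fun y => dot (D1 E2 y) (J (E2 y))) s) // !along_J; try exact: dE2.
rewrite !(dot_structure Wx) D12 D22.
rewrite !(dotlin, JD, JZ, JN, JK) !dotJJ !T !dot0J !dotJ0.
by move: (D1 t x) (D2 s x) (w1 x) (w2 x) (p x) (q x) (s x) (t x) => *; lra.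
Qed.

Lemma gauss_equation : D2 w1 x - D1 w2 x - w1 x ^+ 2 - w2 x ^+ 2 =
  1 + p x * s x + q x * t x - q x ^+ 2 - s x ^+ 2.
Proof.
have [D11 D12 D21 D22] := structure_eqs Wx; have T := frame_table Wx.
have := codazzi_dot Wx smooth_E1 smooth_E2.
rewrite (@ed (fun y => dot (D2 E1 y) (E2 y)) w2) //.
rewrite (@ed (fun y => dot (D1 E1 y) (E2 y)) w1) //.
rewrite !(dot_structure Wx) D11 D12 D21 D22.
rewrite !(dotlin, JD, JZ, JN, JK) !dotJJ !T !dot0J !dotJ0.
by move: (D1 w2 x) (D2 w1 x) (w1 x) (w2 x) (p x) (q x) (s x) (t x) => *; lra.
Qed.

End GaussCodazzi.

(** * Normal projection and mean curvature vector in the frame *)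

Section MeanCurvature.

Definition frame (i : 'I_2) : V -> V := if i == 0 then e1 else e2.

Lemma frame_orthonormal x (Wx : W x) (i j : 'I_2) :
  dot ('D_(frame i x) F x) ('D_(frame j x) F x) = (i == j)%:R.
Proof.
case: i => -[|[|//]] Hi; case: j => -[|[|//]] Hj; rewrite /frame /=.
- exact: E11.
- exact: E12.
- rewrite dotC; exact: E12.
- exact: E22.
Qed.

Lemma sum_frame (T : nmodType) (f : 'I_2 -> T) : \sum_i f i = f 0 + f 1.
Proof. by rewrite !big_ord_recl big_ord0 addr0; congr (_ + f _); apply: val_inj. Qed.

Lemma frame0 : frame 0 = e1. Proof. by []. Qed.
Lemma frame1 : frame 1 = e2. Proof. by []. Qed.

(** The normal space inside the 5-sphere has dimension three: besides [J E1] and [J E2] it contains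
    [J F], which is minus the field [xi]. *)
Lemma normal_part_frame x w : W x -> normal_part F x w =
  dot w (J (F x)) *: J (F x) + dot w (J (E1 x)) *: J (E1 x) + dot w (J (E2 x)) *: J (E2 x).
Proof.
move=> Wx; have dF := smooth_differentiable sF Wx.
rewrite (normal_partE dF (frame_orthonormal Wx)) sum_frame frame0 frame1 !alongE.
rewrite [X in X - _ - _](unitary3_expand w (frame_unitary Wx)).
move: (dot w (F x)) (dot w (E1 x)) (dot w (E2 x)) (dot w (J _)) (dot w (J (E1 x))) (dot w (J (E2 x))).
move: (F x) (J (F x)) (E1 x) (J (E1 x)) (E2 x) (J (E2 x)).
by move=> *; apply/matrixP => i j; rewrite !mxE; ring.
Qed.

Lemma mean_curvature_frame x : W x -> mean_curvature_vector F x =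
  2^-1 *: ((p x + s x) *: J (E1 x) + (q x + t x) *: J (E2 x)).
Proof.
move=> Wx; have dF := smooth_differentiable sF Wx; have T := frame_table Wx.
have [D11 _ _ D22] := structure_eqs Wx.
(* Freezing the direction of the inner derivative changes the second derivative only by the tangent
   term ['D_('D_(e x) e x) F x], which the normal projection kills. *)
have np (e : V -> V) : smooth W e ->
    normal_part F x ('D_(e x) ('D_(e x) F) x) = normal_part F x (along e (along e F) x).
  move=> se; rewrite [along e (along e F) x](d_field_mx oW _ sF se Wx) addrC -[in RHS](scale1r
    ('D__ F x)).
  rewrite (normal_part_lin dF (frame_orthonormal Wx)) (normal_part_tangent dF (frame_orthonormal
    Wx)) ?scaler0 ?add0r //.
  exact: tangent_orthogonal.
rewrite (mean_curvature_vectorE dF (frame_orthonormal Wx) oW sF Wx) sum_frame frame0 frame1 !np //.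
rewrite !normal_part_frame // D11 D22 ?(dotlin, JD, JZ, JN, JK) ?(dotJJ, T, dot0J, dotJ0).
congr (_ *: _); move: (J (F x)) (J (E1 x)) (J (E2 x)) => *.
by apply/matrixP => i j; rewrite !mxE; ring.
Qed.

End MeanCurvature.

(** * The equation [Delta^D H = 0] in a frame with [H = r J E1] *)

Section Harmonic.
Local Notation H := (mean_curvature_vector F).
Variables (r : V -> R) (sr : smooth W r) (r_gt0 : forall x, W x -> 0 < r x).
Hypothesis HE : forall x, W x -> H x = r x *: J (E1 x).
Hypothesis harmonic : forall x, W x -> normal_laplacian F frame H x = 0.

Lemma trace_cubic x : W x -> p x + s x = 2 * r x /\ q x + t x = 0.
Proof.
move=> Wx; have := HE Wx; rewrite (mean_curvature_frame Wx) => E; have T := frame_table Wx.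
split.
  by have := congr1 (fun v => dot v (J (E1 x))) E; rewrite !(dotlin, dotJJ) !T; lra.
by have := congr1 (fun v => dot v (J (E2 x))) E; rewrite !(dotlin, dotJJ) !T; lra.
Qed.

Let dr x (Wx : W x) := smooth_differentiable sr Wx.
Let sJE1 : smooth W (fun y => J (E1 y)). Proof. by apply: (smooth_J oW); exact: smooth_E1. Qed.
Let sJE2 : smooth W (fun y => J (E2 y)). Proof. by apply: (smooth_J oW); exact: smooth_E2. Qed.
Let sJF : smooth W (fun y => J (F y)). Proof. exact: (smooth_J oW). Qed.

(** The normal derivatives of [H] along [e1] and [e2]. The term [- r J F], which comes from the
    summand [- F] of [D1 E1], makes the [J F] component of the Laplacian informative. *)
Definition dnH1 y : cvect R 3 := D1 r y *: J (E1 y) + (r y * w1 y) *: J (E2 y) - r y *: J (F y).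
Definition dnH2 y : cvect R 3 := D2 r y *: J (E1 y) + (r y * w2 y) *: J (E2 y).

Lemma along_H e x : smooth W e -> W x ->
  along e H x = along e r x *: J (E1 x) + r x *: J (along e E1 x).
Proof.
move=> se Wx; rewrite (eq_along e oW Wx HE) alongZ ?along_J //; first exact: dE1.
- exact: dr.
- exact: smooth_differentiable sJE1 Wx.
Qed.

Lemma normal_connection_H1 x : W x -> normal_connection F e1 H x = dnH1 x.
Proof.
move=> Wx; rewrite /normal_connection -derE alongE (along_H s1 Wx) normal_part_frame //.
have [D11 _ _ _] := structure_eqs Wx; have T := frame_table Wx.
rewrite D11 /dnH1 ?(dotlin, JD, JZ, JN, JK) ?(dotJJ, T, dot0J, dotJ0).
move: (J (F x)) (J (E1 x)) (J (E2 x)) => *.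
by apply/matrixP => i j; rewrite !mxE; ring.
Qed.

Lemma normal_connection_H2 x : W x -> normal_connection F e2 H x = dnH2 x.
Proof.
move=> Wx; rewrite /normal_connection -derE alongE (along_H s2 Wx) normal_part_frame //.
have [_ _ D21 _] := structure_eqs Wx; have T := frame_table Wx.
rewrite D21 /dnH2 ?(dotlin, JD, JZ, JN, JK) ?(dotJJ, T, dot0J, dotJ0).
move: (J (F x)) (J (E1 x)) (J (E2 x)) => *.
by apply/matrixP => i j; rewrite !mxE; ring.
Qed.

Lemma normal_connection_dir (X : V -> V) (a b : R) x : W x -> X x = a *: e1 x + b *: e2 x ->
  normal_connection F X H x = a *: dnH1 x + b *: dnH2 x.
Proof.
move=> Wx Xx; have dF := smooth_differentiable sF Wx.
have sH : smooth W H.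
  apply: (@eq_smooth _ _ _ oW _ (fun y => r y *: J (E1 y))) => [y Wy|]; first by rewrite HE.
  exact: smoothZ.
have dH := smooth_differentiable sH Wx.
rewrite -normal_connection_H1 // -normal_connection_H2 // /normal_connection -!derE Xx.
rewrite derive_dirD // !derive_dirZ // (normal_part_lin dF (frame_orthonormal Wx)).
by rewrite (normal_partZ dF (frame_orthonormal Wx)).
Qed.

Lemma levi_civita_frame x : W x ->
  levi_civita F e1 e1 x = 0 *: e1 x + w1 x *: e2 x /\
  levi_civita F e2 e2 x = - w2 x *: e1 x + 0 *: e2 x.
Proof.
move=> Wx; have dF := smooth_differentiable sF Wx.
have [D11 _ _ D22] := structure_eqs Wx; have T := frame_table Wx.
rewrite !(levi_civitaE dF (frame_orthonormal Wx) oW sF Wx) //.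
rewrite -[der _ _ _]/(D1 E1 x) -[der (along e2 F) _ _]/(D2 E2 x) D11 D22.
rewrite !(tangent_coordE dF (frame_orthonormal Wx)) !sum_frame frame0 frame1 !alongE.
rewrite ?(dotlin, JD, JZ, JN, JK) ?(dotJJ, T, dot0J, dotJ0); split; congr (_ *: _ + _ *: _); ring.
Qed.

Lemma normal_connection_twice (N : V -> cvect R 3) (dnH : V -> cvect R 3) e x nu :
  smooth W e -> smooth W dnH -> smooth W nu -> W x ->
  (forall y, W y -> normal_connection F e N y = dnH y) ->
  dot (E1 x) (nu x) = 0 -> dot (E2 x) (nu x) = 0 -> dot (F x) (nu x) = 0 ->
  dot (normal_connection F e (normal_connection F e N) x) (nu x) =
  along e (fun y => dot (dnH y) (nu y)) x - dot (dnH x) (along e nu x).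
Proof.
move=> se sn snu Wx dnHE E1nu E2nu Fnu; have dF := smooth_differentiable sF Wx.
rewrite {1}/normal_connection -derE (dot_normal_part dF (frame_orthonormal Wx)) //; last first.
  by move=> i; case: i => -[|[|//]] Hi; rewrite /frame /=.
rewrite (eq_derive_on _ oW Wx dnHE) alongE along_dot ?addrK //.
- exact: smooth_differentiable sn Wx.
- exact: smooth_differentiable snu Wx.
Qed.

Lemma smooth_dnH : smooth W dnH1 /\ smooth W dnH2.
Proof.
have sD1 := smooth_along oW sr s1; have sD2 := smooth_along oW sr s2.
split; last first.
  apply: (smoothD oW); apply: (smoothZ oW) => //.
  by apply: (smoothM oW) => //; exact: smooth_w2.
apply: (smoothB oW); last by apply: (smoothZ oW).
apply: (smoothD oW); apply: (smoothZ oW) => //.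
by apply: (smoothM oW) => //; exact: smooth_w1.
Qed.

(** The equation paired with a normal field [nu], with the outer derivative moved by the product
    rule so that only scalar functions are differentiated. The right-hand side comes from
    [nabla_e1 e1 = w1 e2] and [nabla_e2 e2 = - w2 e1]. *)
Lemma laplacian_dot x nu : smooth W nu -> W x ->
  (forall y, W y -> [/\ dot (E1 y) (nu y) = 0, dot (E2 y) (nu y) = 0 & dot (F y) (nu y) = 0]) ->
  along e1 (fun y => dot (dnH1 y) (nu y)) x - dot (dnH1 x) (along e1 nu x) +
  (along e2 (fun y => dot (dnH2 y) (nu y)) x - dot (dnH2 x) (along e2 nu x)) =
  w1 x * dot (dnH2 x) (nu x) - w2 x * dot (dnH1 x) (nu x).
Proof.
have arith (a b c d a' c' u v w w' : R) : - (a - b + (c - d)) = 0 -> a = a' -> c = c' ->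
    b = 0 * u + w * v -> d = - w' * u + 0 * v -> a' + c' = w * v - w' * u.
  by move=> *; lra.
move=> snu Wx nuP; have [n1 n2 n3] := nuP x Wx; have [sd1 sd2] := smooth_dnH.
have [lc1 lc2] := levi_civita_frame Wx.
have dot_expand (a b c d n : cvect R 3) : dot (- ((a - b) + (c - d))) n =
    - ((dot a n - dot b n) + (dot c n - dot d n)) by rewrite !dotlin.
have := etrans (congr1 (fun v => dot v (nu x)) (harmonic Wx)) (dot0l (nu x)).
have -> : normal_laplacian F frame H x =
    - ((normal_connection F e1 (normal_connection F e1 H) x
        - normal_connection F (levi_civita F e1 e1) H x) +
       (normal_connection F e2 (normal_connection F e2 H) x
        - normal_connection F (levi_civita F e2 e2) H x)).
  by congr (- _); apply: etrans (sum_frame _) _; rewrite frame0 frame1.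
rewrite dot_expand => E.
have dot_lin2 (a b : R) (c d n : cvect R 3) :
    dot (a *: c + b *: d) n = a * dot c n + b * dot d n by rewrite !dotlin.
have N1 := normal_connection_twice s1 sd1 snu Wx normal_connection_H1 n1 n2 n3.
have N2 := normal_connection_twice s2 sd2 snu Wx normal_connection_H2 n1 n2 n3.
have L1 := etrans (congr1 (fun v => dot v (nu x)) (normal_connection_dir Wx lc1)) (dot_lin2 _ _ _ _ _).
have L2 := etrans (congr1 (fun v => dot v (nu x)) (normal_connection_dir Wx lc2)) (dot_lin2 _ _ _ _ _).
exact: (arith _ _ _ _ _ _ _ _ _ _ E N1 N2 L1 L2).
Qed.

(** Taking [nu = J F] in [laplacian_dot] gives [- 2 D1 r - r w2 = r w2]. *)
Lemma harmonic_divergence x : W x -> D1 r x = - r x * w2 x.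
Proof.
move=> Wx; have T := frame_table Wx.
have eqs y : W y -> (dot (dnH1 y) (J (F y)) = - r y) * (dot (dnH2 y) (J (F y)) = 0).
  move=> Wy; have Ty := frame_table Wy; rewrite /dnH1 /dnH2.
  by rewrite ?(dotlin, JD, JZ, JN, JK) ?(dotJJ, Ty, dot0J, dotJ0); split; ring.
have := laplacian_dot sJF Wx.
have /[swap]/[apply] : forall y, W y ->
   [/\ dot (E1 y) (J (F y)) = 0, dot (E2 y) (J (F y)) = 0 & dot (F y) (J (F y)) = 0].
  by move=> y Wy; rewrite ?(frame_table Wy) dot0J.
rewrite (eq_along e1 oW Wx (fun y Wy => (eqs y Wy).1)).
rewrite (eq_along e2 oW Wx (fun y Wy => (eqs y Wy).2)).
rewrite along_cst alongN ?along_J; try exact: smooth_differentiable Wx; try exact: dr.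
rewrite !(eqs _ Wx) /dnH1 /dnH2 ?(dotlin, JD, JZ, JN, JK) ?(dotJJ, T, dot0J, dotJ0).
by move: (D1 r x) (D2 r x) (w1 x) (w2 x) (r x) => *; lra.
Qed.

Lemma trace_along e x : smooth W e -> W x ->
  along e p x + along e s x = 2 * along e r x /\ along e q x + along e t x = 0.
Proof.
move=> se Wx.
have dd f : smooth W f -> differentiable f x by move=> sf; exact: smooth_differentiable Wx.
rewrite -!alongD; try by apply: dd;
  first [exact: smooth_c111|exact: smooth_c112|exact: smooth_c122|exact: smooth_c222].
rewrite (eq_along e oW Wx (fun y Wy => (trace_cubic Wy).1)).
rewrite (eq_along e oW Wx (fun y Wy => (trace_cubic Wy).2)) along_cst.
split=> //; rewrite alongM ?along_cst ?mul0r ?add0r //; exact: dr.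
Qed.

(** The sum of [codazzi1] and [codazzi3] involves only the traces [p + s = 2 r] and [q + t = 0].
    Geometrically, the 1-form dual to [J H] is closed. *)
Lemma harmonic_curl x : W x -> D2 r x = r x * w1 x.
Proof.
move=> Wx; have := codazzi1 Wx; have := codazzi3 Wx.
have [tr1 tr2] := trace_cubic Wx.
have [t1 t2] := trace_along s1 Wx; have [t3 t4] := trace_along s2 Wx.
move: t1 t2 t3 t4; move: (D1 p x) (D1 q x) (D1 s x) (D1 t x) (D1 r x).
move: (D2 p x) (D2 q x) (D2 s x) (D2 t x) (D2 r x) => a b c d e a' b' c' d' e'.
have -> : t x = - q x by lra.
have -> : p x = 2 * r x - s x by lra.
by move=> *; lra.
Qed.

(** Taking [nu = J E1] in [laplacian_dot] and inserting the first derivatives of [r] gives [r] times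
    the claim; the constant [1] stems from the [J F] component of [dnH1]. *)
Lemma harmonic_curvature x : W x -> D2 w1 x - D1 w2 x - w1 x ^+ 2 - w2 x ^+ 2 = 1.
Proof.
move=> Wx; have T := frame_table Wx; have r0 := r_gt0 Wx.
have eqs y : W y -> (dot (dnH1 y) (J (E1 y)) = - r y * w2 y) * (dot (dnH2 y) (J (E1 y)) = r y * w1 y).
  move=> Wy; have Ty := frame_table Wy; rewrite /dnH1 /dnH2.
  by rewrite ?(dotlin, JD, JZ, JN, JK) ?(dotJJ, Ty, dot0J, dotJ0) harmonic_divergence //
    harmonic_curl //; split; ring.
have := laplacian_dot sJE1 Wx.
have /[swap]/[apply] : forall y, W y ->
   [/\ dot (E1 y) (J (E1 y)) = 0, dot (E2 y) (J (E1 y)) = 0 & dot (F y) (J (E1 y)) = 0].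
  by move=> y Wy; rewrite ?(frame_table Wy) dot0J.
rewrite (eq_along e1 oW Wx (fun y Wy => (eqs y Wy).1)).
rewrite (eq_along e2 oW Wx (fun y Wy => (eqs y Wy).2)).
have [D11 _ D21 _] := structure_eqs Wx.
have dw1 := smooth_differentiable smooth_w1 Wx; have dw2 := smooth_differentiable smooth_w2 Wx.
have dN := diffrN (dr Wx).
rewrite (alongM e1 dN dw2) (alongM e2 (dr Wx) dw1) (alongN e1 (dr Wx)).
rewrite !along_J; try exact: dE1.
rewrite !(eqs _ Wx) D11 D21 /dnH1 /dnH2 ?(dotlin, JD, JZ, JN, JK) ?(dotJJ, T, dot0J, dotJ0).
rewrite harmonic_divergence // harmonic_curl // => E.
apply: (mulfI (lt0r_neq0 r0)); move: E.
by move: (D1 w2 x) (D2 w1 x) (w1 x) (w2 x) (r x) => *; lra.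
Qed.

Lemma harmonic_gauss x : W x -> s x * (r x - s x) = q x ^+ 2.
Proof.
move=> Wx; have [tr1 tr2] := trace_cubic Wx.
have := gauss_equation Wx; rewrite harmonic_curvature //.
have -> : t x = - q x by lra.
have -> : p x = 2 * r x - s x by lra.
by move=> *; lra.
Qed.

Lemma harmonic_codazzi x : W x ->
  D1 s x - D2 q x = 2 * r x * w2 x - 3 * w2 x * s x - 3 * w1 x * q x /\
  D1 q x + D2 s x = 3 * w1 x * s x - 3 * w2 x * q x.
Proof.
move=> Wx; have [tr1 tr2] := trace_cubic Wx.
have := codazzi2 Wx; have := codazzi3 Wx.
have [t1 t2] := trace_along s1 Wx.
have -> : t x = - q x by lra.
have -> : p x = 2 * r x - s x by lra.
by split; lra.
Qed.

End Harmonic.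

End LegendreFrame.

(** * Rigidity and integration along a frame *)

Ltac diff_auto := repeat first [assumption | apply: diffrM | apply: diffrB | apply: diffrD
  | apply: diffrN | apply: differentiable_cst].
Ltac along_auto := repeat first [rewrite along_cst | rewrite alongM; [|by diff_auto|by diff_auto]
  | rewrite alongB; [|by diff_auto|by diff_auto] | rewrite alongD; [|by diff_auto|by diff_auto]
  | rewrite alongN; [|by diff_auto]].

(* The hypotheses express the derivatives of s and q up to second order; the two
   combinations below eliminate those derivatives through the commutators. *)
Lemma rigid_arith (R : realType) (r s q w a b c d s12 s21 q12 q21 : R) : 0 < r ->
  s * (r - s) = q * q ->
  r * a = - 4 * q * s * w -> r * b = w * s * (5 * r - 4 * s) ->
  r * c = - 2 * (r - 2 * s) * s * w -> r * d = w * q * (3 * r - 4 * s) ->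
  r * s12 = w * a * (5 * r - 8 * s) ->
  r * w * a + r * s21 = - 4 * (d * s * w + q * b * w + q * s * (1 + w ^+ 2)) ->
  r * q12 = w * (c * (3 * r - 4 * s) - 4 * q * a) ->
  r * w * c + r * q21 = - 2 * ((r * w - 2 * b) * s * w + (r - 2 * s) * b * w +
      (r - 2 * s) * s * (1 + w ^+ 2)) ->
  s12 - s21 = - w * a -> q12 - q21 = - w * c -> s = 0 /\ q = 0.
Proof.
move=> r0 gs aE bE cE dE s12E s21E q12E q21E cs cq.
have cancel u : r * u = 0 -> u = 0 by move=> /eqP; rewrite mulf_eq0 gt_eqF //= => /eqP.
(* Both eliminations end with this positive factor, so no case distinction on [w] arises. *)
have w2 u : u * (2 * w ^+ 2 + 1) = 0 -> u = 0.
  move=> /eqP; rewrite mulf_eq0 => /orP[/eqP//|]; rewrite gt_eqF //.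
  by rewrite ltr_wpDl // mulr_ge0 // sqr_ge0.
have qs : q * s = 0.
  apply: w2; apply: cancel; apply: (mulfI (_ : 4 != 0)) => //; rewrite mulr0.
  have -> : 4 * (r * (q * s * (2 * w ^+ 2 + 1))) =
    r * r * ((s12 - s21) - - w * a) - r * (r * s12 - w * a * (5 * r - 8 * s)) +
    r * ((r * w * a + r * s21) - - 4 * (d * s * w + q * b * w + q * s * (1 + w ^+ 2)))
    - w * (7 * r - 8 * s) * (r * a - - 4 * q * s * w)
    - 4 * s * w * (r * d - w * q * (3 * r - 4 * s))
    - 4 * q * w * (r * b - w * s * (5 * r - 4 * s)) by ring.
  by rewrite cs s12E s21E aE dE bE !subrr !mulr0 !subr0 addr0.
have rs : s * (r - 2 * s) = 0.
  apply: w2; apply: cancel; apply: (mulfI (_ : 2 != 0)) => //; rewrite mulr0.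
  have -> : 2 * (r * (s * (r - 2 * s) * (2 * w ^+ 2 + 1))) =
    r * r * ((q12 - q21) - - w * c) - r * (r * q12 - w * (c * (3 * r - 4 * s) - 4 * q * a)) +
    r * ((r * w * c + r * q21) - - 2 * ((r * w - 2 * b) * s * w + (r - 2 * s) * b * w +
      (r - 2 * s) * s * (1 + w ^+ 2)))
    - w * (5 * r - 4 * s) * (r * c - - 2 * (r - 2 * s) * s * w)
    + 4 * q * w * (r * a - - 4 * q * s * w)
    - 2 * w * (r - 4 * s) * (r * b - w * s * (5 * r - 4 * s))
    + 16 * s * w ^+ 2 * (s * (r - s) - q * q) by ring.
  by rewrite cq q12E q21E cE aE bE gs !subrr !mulr0 !subr0 !addr0.
(* This uses [r^2 = (r - 2 s)^2 + 4 s (r - s)] multiplied by [s]: the first term vanishes by [rs],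
   and the second equals [4 q (q s)] by the Gauss relation. *)
have s0 : s = 0.
  apply: (cancel _ (cancel _ _)).
  have -> : r * (r * s) = (r - 2 * s) * (s * (r - 2 * s)) + 4 * q * (q * s)
     + 4 * s * (s * (r - s) - q * q) by ring.
  by rewrite rs qs gs subrr !mulr0 !addr0.
split=> //; move: gs; rewrite s0 mul0r => /esym/eqP.
by rewrite mulf_eq0 orbb => /eqP.
Qed.

Section Rigidity.
Variables (R : realType).
Local Notation V := 'rV[R]_2.
Variables (W : set V) (oW : open W) (d1 d2 : V -> V) (sd1 : smooth W d1) (sd2 : smooth W d2).
Local Notation D1 := (along d1).
Local Notation D2 := (along d2).
Variables (r w s q : V -> R).
Hypotheses (sr : smooth W r) (sw : smooth W w) (ss : smooth W s) (sq : smooth W q).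
Hypotheses (r0 : forall x, W x -> 0 < r x)
  (commute : forall f x, smooth W f -> W x -> D1 (D2 f) x - D2 (D1 f) x = - w x * D1 f x)
  (D1r : forall x, W x -> D1 r x = 0) (D2r : forall x, W x -> D2 r x = r x * w x)
  (D2w : forall x, W x -> D2 w x = 1 + w x ^+ 2)
  (codB : forall x, W x -> D1 s x - D2 q x = - 3 * w x * q x)
  (codC : forall x, W x -> D1 q x + D2 s x = 3 * w x * s x)
  (gss : forall x, W x -> s x * (r x - s x) = q x * q x).

(** The commutator applied to [r]: as [D1 r = 0], it reduces to [D1 (r w) = r D1 w = 0]. *)
Lemma rigid_D1w x : W x -> D1 w x = 0.
Proof.
move=> Wx; have dr := smooth_differentiable sr Wx; have dw := smooth_differentiable sw Wx.
have := commute sr Wx; rewrite (eq_along _ oW Wx D2r) (eq_along d2 oW Wx D1r).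
rewrite along_cst alongM // D1r // mul0r mulr0 add0r subr0 => /eqP.
by rewrite mulf_eq0 gt_eqF ?r0 //= => /eqP.
Qed.

Lemma along_gauss e x : smooth W e -> W x ->
  along e s x * (r x - s x) + s x * (along e r x - along e s x) = 2 * q x * along e q x.
Proof.
move=> se Wx; have dr := smooth_differentiable sr Wx; have ds := smooth_differentiable ss Wx.
have dq := smooth_differentiable sq Wx.
have := eq_along e oW Wx gss; rewrite alongM //; last exact: diffrB.
by rewrite alongB // alongM // => ->; ring.
Qed.

Section First.
Variables (x : V) (Wx : W x).

(** The Codazzi equations eliminate [b] and [d], leaving a linear system in [a] and [c] of
    determinant [(r - 2 s)^2 + 4 q^2]. The Gauss relation makes this determinant [r^2] ([z3]), so
    the system is solved without division by a quantity that may vanish. *)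
Let linear_solve (rr ss' qq ww a b c d : R) : 0 < rr ->
  ss' * (rr - ss') = qq * qq ->
  a * (rr - ss') + ss' * (0 - a) = 2 * qq * c ->
  b * (rr - ss') + ss' * (rr * ww - b) = 2 * qq * d ->
  a - d = - 3 * ww * qq -> c + b = 3 * ww * ss' ->
  [/\ rr * a = - 4 * qq * ss' * ww, rr * b = ww * ss' * (5 * rr - 4 * ss'),
      rr * c = - 2 * (rr - 2 * ss') * ss' * ww & rr * d = ww * qq * (3 * rr - 4 * ss')].
Proof.
move=> rr0 gs e1 e2 e3 e4.
have dE : d = a + 3 * ww * qq by lra.
have bE : b = 3 * ww * ss' - c by lra.
subst d b.
have cancel u : rr * u = 0 -> u = 0.
  by move=> /eqP; rewrite mulf_eq0 gt_eqF //= => /eqP.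
have z1 : (rr - 2 * ss') * a - 2 * qq * c = 0 by lra.
have z2 : (rr - 2 * ss') * c + 2 * qq * a + 2 * rr * ss' * ww = 0.
  move: e2; rewrite -[2 * qq * (a + _)]/(2 * qq * (a + 3 * ww * qq)).
  have -> : 2 * qq * (a + 3 * ww * qq) = 2 * qq * a + 6 * ww * (qq * qq) by ring.
  by rewrite -gs => e2; lra.
have z3 : (rr - 2 * ss') ^+ 2 + 4 * (qq * qq) - rr ^+ 2 = 0 by rewrite -gs; ring.
have aE : rr * a = - 4 * qq * ss' * ww.
  apply/eqP; rewrite -subr_eq0; apply/eqP; apply: cancel.
  have -> : rr * (rr * a - - 4 * qq * ss' * ww) =
     - a * ((rr - 2 * ss') ^+ 2 + 4 * (qq * qq) - rr ^+ 2) +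
     (rr - 2 * ss') * ((rr - 2 * ss') * a - 2 * qq * c) +
     2 * qq * ((rr - 2 * ss') * c + 2 * qq * a + 2 * rr * ss' * ww) by ring.
  by rewrite z1 z2 z3 !mulr0 !addr0.
have cE : rr * c = - 2 * (rr - 2 * ss') * ss' * ww.
  apply/eqP; rewrite -subr_eq0; apply/eqP; apply: cancel.
  have -> : rr * (rr * c - - 2 * (rr - 2 * ss') * ss' * ww) =
     - c * ((rr - 2 * ss') ^+ 2 + 4 * (qq * qq) - rr ^+ 2) -
     2 * qq * ((rr - 2 * ss') * a - 2 * qq * c) +
     (rr - 2 * ss') * ((rr - 2 * ss') * c + 2 * qq * a + 2 * rr * ss' * ww) by ring.
  by rewrite z1 z2 z3 !mulr0 !addr0 subr0.
split=> //; first by rewrite mulrBr cE; ring.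
by rewrite mulrDr aE; ring.
Qed.

Lemma rigid_first : [/\ r x * D1 s x = - 4 * q x * s x * w x,
  r x * D2 s x = w x * s x * (5 * r x - 4 * s x),
  r x * D1 q x = - 2 * (r x - 2 * s x) * s x * w x &
  r x * D2 q x = w x * q x * (3 * r x - 4 * s x)].
Proof.
have g1 := along_gauss sd1 Wx; have g2 := along_gauss sd2 Wx.
rewrite D1r // in g1; rewrite D2r // in g2.
exact: (linear_solve (r0 Wx) (gss Wx) g1 g2 (codB Wx) (codC Wx)).
Qed.

End First.

(** Each first derivative from [rigid_first] is differentiated along the other field, and the
    commutator relations for [s] and [q] turn the result into the algebraic system of
    [rigid_arith]. *)
Lemma rigid x : W x -> s x = 0 /\ q x = 0.
Proof.
move=> Wx.
have dr := smooth_differentiable sr Wx; have dw := smooth_differentiable sw Wx.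
have ds := smooth_differentiable ss Wx; have dq := smooth_differentiable sq Wx.
have dif e f (se : smooth W e) (sf : smooth W f) :=
  smooth_differentiable (smooth_along oW sf se) Wx.
have dD1s := dif _ _ sd1 ss; have dD2s := dif _ _ sd2 ss.
have dD1q := dif _ _ sd1 sq; have dD2q := dif _ _ sd2 sq.
have F1 y (Wy : W y) : r y * D1 s y = - 4 * q y * s y * w y by have [] := rigid_first Wy.
have F2 y (Wy : W y) : r y * D2 s y = w y * s y * (5 * r y - 4 * s y) by have [] := rigid_first Wy.
have F3 y (Wy : W y) : r y * D1 q y = - 2 * (r y - 2 * s y) * s y * w y by have [] := rigid_first Wy.
have F4 y (Wy : W y) : r y * D2 q y = w y * q y * (3 * r y - 4 * s y) by have [] := rigid_first Wy.
have cst (k : R) : differentiable (fun _ : V => k) x by exact: differentiable_cst.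
have r1 := D1r Wx; have r2 := D2r Wx; have v1 := rigid_D1w Wx; have v2 := D2w Wx.
apply: (rigid_arith (r0 Wx) (gss Wx) (F1 x Wx) (F2 x Wx) (F3 x Wx) (F4 x Wx) _ _ _ _ (commute ss
  Wx) (commute sq Wx)).
- have := eq_along d1 oW Wx F2.
  by along_auto; rewrite r1 v1 => E; rewrite -[LHS]add0r -[X in X + _](mul0r (D2 s x)) E; ring.
- have := eq_along d2 oW Wx F1.
  by along_auto; rewrite r2 v2 => ->; ring.
- have := eq_along d1 oW Wx F4.
  by along_auto; rewrite r1 v1 => E; rewrite -[LHS]add0r -[X in X + _](mul0r (D2 q x)) E; ring.
- have := eq_along d2 oW Wx F3.
  by along_auto; rewrite r2 v2 => ->; ring.
Qed.

End Rigidity.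

(** * Constancy, angle functions and uniqueness along a frame *)

Section Integration.
Variables (R : realType).
Local Notation V := 'rV[R]_2.
Variables (W : set V) (oW : open W) (d1 d2 : V -> V) (sd1 : smooth W d1) (sd2 : smooth W d2).
Hypothesis span : forall x v, W x -> exists a b, v = a *: d1 x + b *: d2 x.
Local Notation D1 := (along d1).
Local Notation D2 := (along d2).

Lemma frame_derivative (T : normedModType R) (f : V -> T) x v : W x -> differentiable f x ->
  D1 f x = 0 -> D2 f x = 0 -> 'D_v f x = 0.
Proof.
move=> Wx df f1 f2; have [a [b ->]] := span v Wx.
by rewrite derive_dirD // !derive_dirZ // !alongE f1 f2 !scaler0 addr0.
Qed.

Lemma frame_constant (f : V -> R) x0 e : ball x0 e `<=` W ->
  (forall x, W x -> differentiable f x) ->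
  (forall x, ball x0 e x -> D1 f x = 0 /\ D2 f x = 0) ->
  forall x, ball x0 e x -> f x = f x0.
Proof.
move=> eW df f12; apply: zero_derive_const_scalar => x; first by move=> /eW; exact: df.
by move=> v xe; have [f1 f2] := f12 x xe; apply: frame_derivative => //; [exact: eW|exact/df/eW].
Qed.

Lemma frame_constant_mx m p (f : V -> 'M[R]_(m, p)) x0 e : ball x0 e `<=` W ->
  (forall x, W x -> differentiable f x) ->
  (forall x, ball x0 e x -> D1 f x = 0 /\ D2 f x = 0) ->
  forall x, ball x0 e x -> f x = f x0.
Proof.
move=> eW df f12; apply: zero_derive_const => x; first by move=> /eW; exact: df.
by move=> v xe; have [f1 f2] := f12 x xe; apply: frame_derivative => //; [exact: eW|exact/df/eW].
Qed.

(** The pair [(a, a')] rotates at rate [rho] along [d1], so its angle [- atan (a' / a)], defined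
    where [a > 0], has derivatives [rho] and [0]. This produces the second coordinate without
    integrating a closed form. *)
Lemma phase (a a' rho : V -> R) x0 : W x0 ->
  smooth W a -> smooth W a' ->
  (forall x, W x -> D1 a x = rho x * a' x /\ D1 a' x = - rho x * a x) ->
  (forall x, W x -> D2 a x = 0 /\ D2 a' x = 0) -> 0 < a x0 -> a' x0 = 0 ->
  exists e y, [/\ 0 < e, ball x0 e `<=` W, smooth (ball x0 e) y, y x0 = 0 &
    forall x, ball x0 e x -> D1 y x = rho x /\ D2 y x = 0].
Proof.
move=> Wx0 sa sa' a1 a2 ax0 a'x0.
have ca : {for x0, continuous a}.
  by apply: differentiable_continuous; exact: smooth_differentiable Wx0.
have : nbhs x0 (W `&` [set x | 0 < a x]).
  apply: filterI; first exact: open_nbhs_nbhs.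
  exact: (cvgr_gt (a x0) ca _ ax0).
move=> /nbhs_ballP[e /= e0 eP].
have eW : ball x0 e `<=` W by move=> x /eP[].
have ea x : ball x0 e x -> a x != 0 by move=> /eP[_ /= ?]; rewrite gt_eqF.
have sav : smooth (ball x0 e) (fun x => (a x)^-1).
  by apply: (smoothV (ball_open _ _) ea); exact: smooth_onS sa.
have oB : open (ball x0 e) by exact: ball_open.
pose h x := - (a' x * (a x)^-1).
have sh : smooth (ball x0 e) h.
  by apply: (smoothN oB); apply: (smoothM oB) => //; exact: smooth_onS sa'.
exists e, (fun x => atan (h x)); split => //.
- exact: (smooth_atan oB).
- by rewrite /h a'x0 mul0r oppr0 atan0.
move=> x xe; have Wx := eW x xe; have ax := ea x xe.
have da := smooth_differentiable sa Wx; have da' := smooth_differentiable sa' Wx.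
have dav := smooth_differentiable sav xe; have dh := smooth_differentiable sh xe.
have [a11 a12] := a1 x Wx; have [a21 a22] := a2 x Wx.
have dd e' : along e' (fun x => atan (h x)) x = along e' h x * (1 + h x ^+ 2)^-1.
  by apply: along_fun.
have pos : a x ^+ 2 + a' x ^+ 2 != 0.
  by rewrite gt_eqF // ltr_pwDl ?sqr_ge0 // exprn_even_gt0.
rewrite !dd /h !alongN ?alongM ?alongV //; try exact: diffrM.
rewrite a11 a12 a21 a22; split; last first.
  by rewrite !mul0r oppr0 mulr0 addr0 oppr0 mul0r.
field; rewrite ax /=.
have -> : a x ^+ 2 + (- a' x) ^+ 2 = a x ^+ 2 + a' x ^+ 2 by rewrite sqrrN.
by [].
Qed.

(* The equations preserve |dl|^2 + |up|^2. *)
Lemma energy m (kap : R) (rho : V -> R) (dl up : V -> cvect R m) x0 e :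
  ball x0 e `<=` W -> smooth (ball x0 e) dl -> smooth (ball x0 e) up ->
  (forall x, ball x0 e x -> D1 dl x = rho x *: up x /\
     D1 up x = rho x *: (kap *: J (up x) - dl x)) ->
  (forall x, ball x0 e x -> D2 dl x = 0 /\ D2 up x = 0) ->
  dl x0 = 0 -> up x0 = 0 -> forall x, ball x0 e x -> dl x = 0 /\ up x = 0.
Proof.
move=> eW sdl sup h1 h2 dl0 up0 x xe.
pose en x := dot (dl x) (dl x) + dot (up x) (up x).
have en0 : en x = en x0.
  apply: (zero_derive_const_scalar (r := e)) xe => z ze.
    have dd := smooth_differentiable sdl ze; have du := smooth_differentiable sup ze.
    by apply: diffrD; exact: diffr_dot.
  move=> ze'; have dd := smooth_differentiable sdl ze'; have du := smooth_differentiable sup ze'.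
  apply: frame_derivative; [exact: eW|by apply: diffrD; exact: diffr_dot| |].
    rewrite alongD ?along_dot //; try exact: diffr_dot.
    have [-> ->] := h1 _ ze'; rewrite !dotlin !dotJ0 !dot0J (dotC (dl z)); ring.
  rewrite alongD ?along_dot //; try exact: diffr_dot.
  by have [-> ->] := h2 _ ze'; rewrite !dot0l !dot0r !addr0.
move: en0; rewrite /en dl0 up0 dot0l addr0 => /eqP.
rewrite paddr_eq0 ?dot_ge0 // => /andP[/eqP/dot_eq0 -> /eqP/dot_eq0 ->].
by [].
Qed.

End Integration.

(** * The frame adapted to the mean curvature vector *)

Section AdaptedFrame.
Variables (R : realType).
Local Notation V := 'rV[R]_2.

Definition legendre_on (U : set V) (F : V -> cvect R 3) : Prop :=
  [/\ open U, smooth U F, (forall x, U x -> dot (F x) (F x) = 1),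
      (forall x v, U x -> dot (J ('D_v F x)) (F x) = 0) &
      (forall x v, U x -> 'D_v F x = 0 -> v = 0)].

Definition harmonic_on (U : set V) (F : V -> cvect R 3) : Prop :=
  forall (W : set V) e x, open W -> W `<=` U -> W x -> orthonormal_frame F W e ->
    normal_laplacian F e (mean_curvature_vector F) x = 0.

Lemma legendre_onS U U' F : open U' -> U' `<=` U -> legendre_on U F -> legendre_on U' F.
Proof.
move=> oU' sub [oU sF FF FL FI]; split => //.
- exact: smooth_onS sF.
- by move=> x /sub; exact: FF.
- by move=> x v /sub; exact: FL.
- by move=> x v /sub; exact: FI.
Qed.

Lemma dot_gt0 m (u : cvect R m) : (0 < dot u u) = (u != 0).
Proof.
rewrite lt_def dot_ge0 andbT; congr (~~ _).
by apply/eqP/eqP => [/dot_eq0|->] //; exact: dot0l.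
Qed.

Variables (U : set V) (F : V -> cvect R 3).
Hypothesis leg : legendre_on U F.

Let oU : open U. Proof. by case: leg. Qed.
Let sF : smooth U F. Proof. by case: leg. Qed.
Let FF : forall x, U x -> dot (F x) (F x) = 1. Proof. by case: leg. Qed.
Let FL : forall x v, U x -> dot (J ('D_v F x)) (F x) = 0. Proof. by case: leg. Qed.
Let FI : forall x v, U x -> 'D_v F x = 0 -> v = 0. Proof. by case: leg. Qed.
Let dF x (Ux : U x) := smooth_differentiable sF Ux.

Definition normalize (e : V -> V) (x : V) : V :=
  (Num.sqrt (dot (along e F x) (along e F x)))^-1 *: e x.

Section Normalize.
Variables (e : V -> V) (se : smooth U e) (e0 : forall x, U x -> e x != 0).

Lemma speed_gt0 x : U x -> 0 < dot (along e F x) (along e F x).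
Proof. by move=> Ux; rewrite dot_gt0; apply: contraNneq (e0 Ux) => /(FI Ux) ->. Qed.

Lemma smooth_normalize : smooth U (normalize e).
Proof.
have sE : smooth U (along e F) by exact: smooth_along_mx.
apply: (smoothZ oU) => //; apply: (smoothV oU).
  by move=> x Ux; rewrite gt_eqF // sqrtr_gt0 speed_gt0.
apply: (smooth_sqrt oU) => [x Ux|]; first exact: speed_gt0.
exact: smooth_dot.
Qed.

Lemma along_normalize x : U x -> along (normalize e) F x =
  (Num.sqrt (dot (along e F x) (along e F x)))^-1 *: along e F x.
Proof. by move=> Ux; rewrite {1}/along /normalize derive_dirZ //; exact: dF. Qed.

Lemma normalize_unit x : U x ->
  dot (along (normalize e) F x) (along (normalize e) F x) = 1.
Proof.
move=> Ux; have p0 := speed_gt0 Ux; rewrite along_normalize // dotZl dotZr.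
rewrite mulrA -invfM -expr2 sqr_sqrtr ?(ltW p0) // mulVf // gt_eqF //.
Qed.

End Normalize.

Lemma delta_neq0 (i : 'I_2) : (delta_mx 0 i : V) != 0.
Proof.
apply/eqP => /rowP/(_ i); rewrite !mxE !eqxx /= => /eqP; rewrite oner_eq0 //.
Qed.

(** The Gram-Schmidt frame of the coordinate fields. It is available on all of [U], zeros of [H]
    included, and serves to show that [H] is smooth there. *)
Definition gs1 : V -> V := normalize (fun=> delta_mx 0 0).
Definition gs2' (x : V) : V :=
  delta_mx 0 1 - dot (along (fun=> delta_mx 0 1) F x) (along gs1 F x) *: gs1 x.
Definition gs2 : V -> V := normalize gs2'.

Lemma smooth_gs1 : smooth U gs1.
Proof. by apply: smooth_normalize => [|x _]; [exact: smooth_cst|exact: delta_neq0]. Qed.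

Lemma gs1_unit x : U x -> dot (along gs1 F x) (along gs1 F x) = 1.
Proof. by apply: normalize_unit => y _; exact: delta_neq0. Qed.

(** [gs1] is a multiple of the first coordinate vector, so the second coordinate of [gs2'] remains
    [1]. *)
Lemma gs2'_neq0 x : gs2' x != 0.
Proof.
apply/eqP => /rowP/(_ 1); rewrite !mxE !eqxx /= !mulr0 subr0 => /eqP; rewrite oner_eq0 //.
Qed.

Lemma smooth_gs2' : smooth U gs2'.
Proof.
apply: (smoothB oU); first exact: smooth_cst.
apply: (smoothZ oU); last exact: smooth_gs1.
apply: (smooth_dot oU); apply: (smooth_along_mx oU sF); last exact: smooth_gs1.
exact: smooth_cst.
Qed.

Lemma smooth_gs2 : smooth U gs2.
Proof. by apply: smooth_normalize => [|x _]; [exact: smooth_gs2'|exact: gs2'_neq0]. Qed.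

Lemma gs2_unit x : U x -> dot (along gs2 F x) (along gs2 F x) = 1.
Proof. by apply: normalize_unit => y _; exact: gs2'_neq0. Qed.

Lemma gs_orthogonal x : U x -> dot (along gs1 F x) (along gs2 F x) = 0.
Proof.
move=> Ux; rewrite /gs2 along_normalize // dotZr.
have -> : along gs2' F x = along (fun=> delta_mx 0 1) F x -
    dot (along (fun=> delta_mx 0 1) F x) (along gs1 F x) *: along gs1 F x.
  have df := dF Ux; by rewrite -[LHS]/(der F x (gs2' x)) /gs2' derive_dirB // derive_dirZ.
rewrite [X in _ * X](_ : _ = 0) ?mulr0 //.
by rewrite dotBr dotZr gs1_unit // mulr1 dotC subrr.
Qed.

Let Hc := mean_curvature_vector F.
Definition mean_coord1 x : R := 2^-1 * (c111 F gs1 x + c122 F gs1 gs2 x).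
Definition mean_coord2 x : R := 2^-1 * (c112 F gs1 gs2 x + c222 F gs2 x).

Lemma mean_curvature_gs x : U x ->
  Hc x = mean_coord1 x *: J (along gs1 F x) + mean_coord2 x *: J (along gs2 F x).
Proof.
move=> Ux; rewrite /Hc (mean_curvature_frame oU sF FF FL smooth_gs1 smooth_gs2 gs1_unit gs2_unit
  gs_orthogonal Ux).
by rewrite scalerDr !scalerA.
Qed.

Lemma smooth_V1 : smooth U mean_coord1.
Proof.
apply: (smoothM oU); first exact: smooth_cst.
apply: (smoothD oU); first exact: smooth_c111 smooth_gs1.
exact: smooth_c122 smooth_gs1 smooth_gs2.
Qed.

Lemma smooth_V2 : smooth U mean_coord2.
Proof.
apply: (smoothM oU); first exact: smooth_cst.
apply: (smoothD oU); first exact: smooth_c112 smooth_gs1 smooth_gs2.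
exact: smooth_c222 smooth_gs2.
Qed.

Lemma smooth_mean_curvature : smooth U Hc.
Proof.
have s1 := smooth_gs1; have s2 := smooth_gs2.
apply: (@eq_smooth _ _ _ oU _ (fun x => mean_coord1 x *: J (along gs1 F x) + mean_coord2 x *: J
  (along gs2 F x))).
  by move=> x Ux; rewrite mean_curvature_gs.
apply: (smoothD oU); apply: (smoothZ oU) => //; try exact: smooth_V1; try exact: smooth_V2.
  by apply: (smooth_J oU); exact: smooth_along_mx.
by apply: (smooth_J oU); exact: smooth_along_mx.
Qed.

Lemma mean_curvature_norm x : U x -> dot (Hc x) (Hc x) = mean_coord1 x ^+ 2 + mean_coord2 x ^+ 2.
Proof.
move=> Ux; rewrite mean_curvature_gs // !dotlin !dotJJ gs1_unit // gs2_unit //.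
by rewrite (dotC (along gs2 F x)) gs_orthogonal //; ring.
Qed.

Definition nonminimal_set : set V := U `&` [set x | 0 < dot (Hc x) (Hc x)].

Lemma open_nonminimal_set : open nonminimal_set.
Proof.
rewrite openE => x [Ux Hx]; apply: filterI; first exact: open_nbhs_nbhs.
have : smooth U (fun x => dot (Hc x) (Hc x)).
  by apply: (smooth_dot oU); exact: smooth_mean_curvature.
move=> /smooth_differentiable/(_ Ux)/differentiable_continuous cH.
exact: (cvgr_gt _ cH _ Hx).
Qed.

Let W := nonminimal_set.
Let oW := open_nonminimal_set.
Definition mean_curvature x : R := Num.sqrt (dot (Hc x) (Hc x)).
Let r := mean_curvature.

Lemma mean_curvature_gt0 x : W x -> 0 < r x.
Proof. by move=> [_ Hx]; rewrite sqrtr_gt0. Qed.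

Lemma mean_curvature_sqr x : r x * r x = dot (Hc x) (Hc x).
Proof. by rewrite -expr2 sqr_sqrtr ?dot_ge0. Qed.

Let WU : W `<=` U. Proof. by move=> x []. Qed.

Lemma smooth_mean_curvature_norm : smooth W r.
Proof.
apply: (smooth_sqrt oW) => [x []//|].
by apply: (smooth_dot oW); apply: smooth_onS WU _; exact: smooth_mean_curvature.
Qed.

(** The Gram-Schmidt frame rotated by the angle of [H], so that [J E1] is the unit vector in the
    direction of [H]. *)
Definition adapted1 x : V := (mean_coord1 x * (r x)^-1) *: gs1 x + (mean_coord2 x * (r x)^-1) *: gs2 x.
Definition adapted2 x : V := (- mean_coord2 x * (r x)^-1) *: gs1 x + (mean_coord1 x * (r x)^-1) *:
  gs2 x.

Let srV : smooth W (fun x => (r x)^-1).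
Proof.
apply: (smoothV oW); last exact: smooth_mean_curvature_norm.
by move=> x /mean_curvature_gt0 rx; rewrite gt_eqF.
Qed.

Lemma smooth_adapted : smooth W adapted1 /\ smooth W adapted2.
Proof.
have s1 := smooth_onS WU smooth_gs1; have s2 := smooth_onS WU smooth_gs2.
have v1 := smooth_onS WU smooth_V1; have v2 := smooth_onS WU smooth_V2.
split; apply: (smoothD oW); apply: (smoothZ oW) => //; apply: (smoothM oW) => //.
exact: (smoothN oW).
Qed.

Lemma along_adapted x : W x ->
  along adapted1 F x = (mean_coord1 x * (r x)^-1) *: along gs1 F x + (mean_coord2 x * (r x)^-1) *:
    along gs2 F x /\
  along adapted2 F x = (- mean_coord2 x * (r x)^-1) *: along gs1 F x + (mean_coord1 x * (r x)^-1)
    *: along gs2 F x.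
Proof.
move=> [Ux _]; have df := dF Ux.
by split; rewrite -[LHS]/(der F x _) /adapted1 /adapted2 (derive_dirD _ _ df)
  (derive_dirZ (gs1 x) _ df) (derive_dirZ (gs2 x) _ df).
Qed.

Lemma adapted_orthonormal x : W x -> [/\ dot (along adapted1 F x) (along adapted1 F x) = 1,
  dot (along adapted2 F x) (along adapted2 F x) = 1 & dot (along adapted1 F x) (along adapted2 F x)
    = 0].
Proof.
move=> Wx; have Ux := WU Wx; have [-> ->] := along_adapted Wx.
have r0 := mean_curvature_gt0 Wx; have rr := mean_curvature_sqr x.
rewrite mean_curvature_norm // in rr.
have r2 : mean_coord1 x ^+ 2 + mean_coord2 x ^+ 2 != 0 by rewrite -rr gt_eqF // mulr_gt0.
rewrite !dotlin gs1_unit // gs2_unit // (dotC (along gs2 F x)) gs_orthogonal //.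
have i2 : (r x)^-1 * (r x)^-1 = (mean_coord1 x ^+ 2 + mean_coord2 x ^+ 2)^-1 by rewrite -rr invfM.
move: (mean_coord1 x) (mean_coord2 x) (r x)^-1 r2 i2 => a b c r2 i2.
have one : (a ^+ 2 + b ^+ 2) * (c * c) = 1 by rewrite i2 divff.
by split; [rewrite -[RHS]one; ring|rewrite -[RHS]one; ring|ring].
Qed.

Lemma mean_curvature_adapted x : W x -> Hc x = r x *: J (along adapted1 F x).
Proof.
move=> Wx; have [-> _] := along_adapted Wx; have r0 := mean_curvature_gt0 Wx.
rewrite (mean_curvature_gs (WU Wx)) JD !JZ scalerDr !scalerA.
by rewrite ![r x * _]mulrC !divfK ?gt_eqF.
Qed.

Lemma adapted_orthonormal_frame : orthonormal_frame F W (frame adapted1 adapted2).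
Proof.
have [s1 s2] := smooth_adapted; split.
  by move=> i; rewrite -smoothE /frame; case: ifP.
move=> x i j Wx; rewrite metricE.
apply: (@frame_orthonormal _ F W) => // y /adapted_orthonormal[] //.
Qed.

End AdaptedFrame.

Lemma ball_connected (R : realType) (V : normedModType R) (x : V) (r : R) : connected (ball x r).
Proof.
have [r0|r0] := leP r 0.
  suff -> : ball x r = set0 by exact: connected0.
  rewrite -subset0 => y; rewrite -ball_normE /= => /(le_lt_trans (normr_ge0 _)).
  by rewrite ltNge r0.
have xr : ball x r x by exact: ballxx.
have -> : ball x r = \bigcup_(y in ball x r) ((fun t : R => x + t *: (y - x)) @` `[0, 1]).
  apply/seteqP; split => [y yr|y [z zr [t /= t01 <-]]].
    by exists y => //; exists 1 => /=; rewrite ?in_itv /= ?ler01 ?lexx // scale1r addrC subrK.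
  by move: t01; rewrite in_itv /= => /ball_convex; apply.
apply: bigcup_connected.
  by exists x => y yr; exists 0 => /=; rewrite ?in_itv /= ?ler01 ?lexx // scale0r addr0.
move=> y yr; apply: connected_continuous_connected; first exact: segment_connected.
apply: continuous_subspaceT => t.
exact/differentiable_continuous/line_differentiable.
Qed.

(** * Consequences of harmonicity in the adapted frame *)

Section LocalHarmonic.
Variables (R : realType).
Local Notation V := 'rV[R]_2.
Variables (U : set V) (F : V -> cvect R 3).
Hypotheses (leg : legendre_on U F) (harm : harmonic_on U F).

Local Notation W := (nonminimal_set U F).
Local Notation e1 := (adapted1 F).
Local Notation e2 := (adapted2 F).
Local Notation D1 := (along e1).
Local Notation D2 := (along e2).
Local Notation r := (mean_curvature F).
Local Notation w1 := (w1 F e1 e2).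
Local Notation w2 := (w2 F e1 e2).
Local Notation s := (c122 F e1 e2).
Local Notation q := (c112 F e1 e2).

Let oW : open W := open_nonminimal_set leg.
Let WU : W `<=` U. Proof. by move=> x []. Qed.
Let legW : legendre_on W F := legendre_onS oW WU leg.
Let sF : smooth W F. Proof. by case: legW. Qed.
Let FF : forall x, W x -> dot (F x) (F x) = 1. Proof. by case: legW. Qed.
Let FL : forall x v, W x -> dot (J ('D_v F x)) (F x) = 0. Proof. by case: legW. Qed.
Let FI : forall x v, W x -> 'D_v F x = 0 -> v = 0. Proof. by case: legW. Qed.
Let s1 : smooth W e1 := (smooth_adapted leg).1.
Let s2 : smooth W e2 := (smooth_adapted leg).2.
Let E11 x (Wx : W x) : dot (D1 F x) (D1 F x) = 1.
Proof. by case: (adapted_orthonormal leg Wx). Qed.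
Let E22 x (Wx : W x) : dot (D2 F x) (D2 F x) = 1.
Proof. by case: (adapted_orthonormal leg Wx). Qed.
Let E12 x (Wx : W x) : dot (D1 F x) (D2 F x) = 0.
Proof. by case: (adapted_orthonormal leg Wx). Qed.
Let dF x (Wx : W x) : differentiable F x := smooth_differentiable sF Wx.
Let ee x (Wx : W x) := frame_orthonormal E11 E22 E12 Wx.
Let sr : smooth W r := smooth_mean_curvature_norm leg.
Let r_gt0 x (Wx : W x) : 0 < r x := mean_curvature_gt0 Wx.
Let HE x (Wx : W x) := mean_curvature_adapted leg Wx.
Let HL x : W x -> normal_laplacian F (frame e1 e2) (mean_curvature_vector F) x = 0.
Proof. by move=> Wx; apply: harm Wx (adapted_orthonormal_frame leg). Qed.

Lemma adapted_span x v : W x -> exists a b, v = a *: e1 x + b *: e2 x.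
Proof.
move=> Wx; exists (dot ('D_v F x) (D1 F x)), (dot ('D_v F x) (D2 F x)).
rewrite -[LHS](tangent_coord_tangent (dF Wx) (ee Wx)) (tangent_coordE (dF Wx) (ee Wx)).
by rewrite sum_frame frame0 frame1.
Qed.

Definition adapted_unitary x (Wx : W x) := frame_unitary oW sF FF FL E11 E22 E12 Wx.
Definition adapted_structure x (Wx : W x) := structure_eqs oW sF FF FL s1 s2 E11 E22 E12 Wx.

Lemma adapted_divergence x : W x -> D1 r x = - r x * w2 x.
Proof. exact: (harmonic_divergence oW sF FF FL s1 s2 E11 E22 E12 sr HE HL). Qed.
Lemma adapted_curl x : W x -> D2 r x = r x * w1 x.
Proof. exact: (harmonic_curl oW sF FF FL FI s1 s2 E11 E22 E12 sr HE). Qed.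
Lemma adapted_curvature x : W x -> D2 w1 x - D1 w2 x - w1 x ^+ 2 - w2 x ^+ 2 = 1.
Proof. exact: (harmonic_curvature oW sF FF FL FI s1 s2 E11 E22 E12 sr r_gt0 HE HL). Qed.
Lemma adapted_gauss x : W x -> s x * (r x - s x) = q x ^+ 2.
Proof. exact: (harmonic_gauss oW sF FF FL FI s1 s2 E11 E22 E12 sr r_gt0 HE HL). Qed.
Lemma adapted_codazzi x : W x ->
  D1 s x - D2 q x = 2 * r x * w2 x - 3 * w2 x * s x - 3 * w1 x * q x /\
  D1 q x + D2 s x = 3 * w1 x * s x - 3 * w2 x * q x.
Proof. exact: (harmonic_codazzi oW sF FF FL FI s1 s2 E11 E22 E12 sr HE). Qed.
Lemma adapted_trace x : W x -> c111 F e1 x + s x = 2 * r x /\ q x + c222 F e2 x = 0.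
Proof. exact: (trace_cubic oW sF FF FL s1 s2 E11 E22 E12 HE). Qed.
Lemma adapted_commutator (f : V -> R) x : smooth W f -> W x ->
  D1 (D2 f) x - D2 (D1 f) x = - w1 x * D1 f x - w2 x * D2 f x.
Proof. by move=> sf Wx; exact: (commutator_frame oW sF FF FL FI s1 s2 E11 E22 E12 Wx sf). Qed.
Lemma smooth_adapted_coefs : [/\ smooth W w1, smooth W w2, smooth W s & smooth W q].
Proof.
split; [exact: smooth_w1|exact: smooth_w2|exact: smooth_c122|exact: smooth_c112].
Qed.

Let sqr_norm x (Wx : W x) e : along e (fun y => enorm (mean_curvature_vector F y) ^+ 2) x
  = 2 * r x * along e r x.
Proof.
have dr := smooth_differentiable sr Wx.
rewrite (eq_along e (g := fun y => r y * r y) oW Wx) => [|y Wy]; last first.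
  by rewrite enorm2 mean_curvature_sqr.
by rewrite alongM //; ring.
Qed.

Let phiH_E x (Wx : W x) : phi (F x) (mean_curvature_vector F x) = - r x *: D1 F x.
Proof.
have T := unitary3_table (adapted_unitary Wx).
have JH : J (mean_curvature_vector F x) = - r x *: D1 F x.
  by rewrite HE // JZ JK scalerN scaleNr.
by rewrite /phi /Defs.eta JH dotZl T mulr0 scale0r subr0.
Qed.

Lemma constant_along_phiH x : W x -> mean_curvature_constant_along_phiH F x -> w2 x = 0.
Proof.
move=> Wx; rewrite /mean_curvature_constant_along_phiH phiH_E // -!derE => h.
have tc : tangent_coord F x (- r x *: D1 F x) = - r x *: e1 x.
  by rewrite /along -(derive_dirZ _ _ (dF Wx)) (tangent_coord_tangent (dF Wx) (ee Wx)).
have df : differentiable (fun y => enorm (mean_curvature_vector F y) ^+ 2) x.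
  apply: (eq_differentiable_on oW Wx (f := fun y => r y * r y)) => [y Wy|].
    by rewrite enorm2 mean_curvature_sqr.
  have dr := smooth_differentiable sr Wx; exact: diffrM.
move: h; rewrite tc derive_dirZ // alongE sqr_norm // adapted_divergence // => h.
have r0 := lt0r_neq0 (r_gt0 Wx).
(* Since [phi H = - r E1], the hypothesis reads [(- r) (2 r) (- r w2) = 0]: three factors [r] are
   cancelled. *)
apply/(mulfI r0)/(mulfI r0)/(mulfI r0).
by move: h; rewrite /GRing.scale /=; move: (r x) (w2 x) => *; lra.
Qed.

Lemma constant_along_phiH_perp x : W x -> mean_curvature_constant_along_phiH_perp F x -> w1 x = 0.
Proof.
move=> Wx; rewrite /mean_curvature_constant_along_phiH_perp phiH_E // => h.
have T := unitary3_table (adapted_unitary Wx).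
have r0 := lt0r_neq0 (r_gt0 Wx).
have : D2 (fun y => enorm (mean_curvature_vector F y) ^+ 2) x = 0.
  rewrite -alongE derE; apply: h; rewrite -?derE ?metricE ?alongE ?E22 //.
    by rewrite -dot_gt0; case: Wx.
  by rewrite dotZr T mulr0.
rewrite sqr_norm // adapted_curl // => {}h.
by apply/(mulfI r0)/(mulfI r0); lra.
Qed.

Lemma constant_mean_curvature_minimal (k : R) :
  (forall x, U x -> enorm (mean_curvature_vector F x) = k) -> W = set0.
Proof.
move=> hk; rewrite -subset0 => x0 Wx0.
have [sw1 sw2 _ _] := smooth_adapted_coefs.
have z e x : W x -> along e r x = 0.
  move=> Wx; rewrite (eq_along e (g := fun=> k) oW Wx) ?along_cst // => y Wy.
  by rewrite -(hk y (WU Wy)).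
have z1 x : W x -> w1 x = 0.
  by move=> Wx; have := adapted_curl Wx; rewrite z // => /esym/eqP;
    rewrite mulf_eq0 gt_eqF ?r_gt0 //= => /eqP.
have z2 x : W x -> w2 x = 0.
  by move=> Wx; have := adapted_divergence Wx; rewrite z // => /esym/eqP;
    rewrite mulNr oppr_eq0 mulf_eq0 gt_eqF ?r_gt0 //= => /eqP.
have := adapted_curvature Wx0.
rewrite (eq_along e2 oW Wx0 z1) (eq_along e1 oW Wx0 z2) !along_cst z1 // z2 //.
rewrite expr0n /= !subr0 => /esym/eqP; by rewrite oner_eq0.
Qed.

Section CaseAlong.
Hypothesis w20 : forall x, W x -> w2 x = 0.

Lemma phiH_rigidity x : W x -> [/\ D1 r x = 0, D2 r x = r x * w1 x, D1 w1 x = 0,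
  D2 w1 x = 1 + w1 x ^+ 2 & s x = 0 /\ q x = 0].
Proof.
have [sw1 sw2 ss sq] := smooth_adapted_coefs.
have D1r y : W y -> D1 r y = 0 by move=> Wy; rewrite adapted_divergence // w20 // mulr0.
have D2r y : W y -> D2 r y = r y * w1 y by exact: adapted_curl.
have D2w y : W y -> D2 w1 y = 1 + w1 y ^+ 2.
  move=> Wy; have := adapted_curvature Wy.
  by rewrite (eq_along e1 oW Wy w20) along_cst w20 //; lra.
have cmt (f : V -> R) y : smooth W f -> W y -> D1 (D2 f) y - D2 (D1 f) y = - w1 y * D1 f y.
  by move=> sf Wy; rewrite adapted_commutator // w20 // mul0r subr0.
have cB y : W y -> D1 s y - D2 q y = - 3 * w1 y * q y.
  by move=> Wy; rewrite (adapted_codazzi Wy).1 w20 //; lra.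
have cC y : W y -> D1 q y + D2 s y = 3 * w1 y * s y.
  by move=> Wy; rewrite (adapted_codazzi Wy).2 w20 //; lra.
have gs y : W y -> s y * (r y - s y) = q y * q y.
  by move=> Wy; rewrite adapted_gauss.
move=> Wx; split; [exact: D1r|exact: D2r| |exact: D2w|].
  exact: (rigid_D1w oW sr sw1 r_gt0 cmt D1r D2r).
exact: (rigid oW s1 s2 sr sw1 ss sq r_gt0 cmt D1r D2r D2w cB cC gs).
Qed.

End CaseAlong.

Section CasePerp.
Hypothesis w10 : forall x, W x -> w1 x = 0.

(** The system of the other case reappears with the frame fields exchanged, [w = - w2] and
    [s' = r - s]; the Gauss relation is invariant under this substitution. The conclusion [s' = 0]
    becomes [s = r]. *)
Lemma phiH_perp_rigidity x : W x -> [/\ D1 r x = - r x * w2 x, D2 r x = 0, D2 w2 x = 0,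
  D1 w2 x = - (1 + w2 x ^+ 2) & s x = r x /\ q x = 0].
Proof.
have [sw1 sw2 ss sq] := smooth_adapted_coefs.
pose w y := - w2 y.
have sw : smooth W w by exact: (smoothN oW).
pose s' y := r y - s y.
have ss' : smooth W s' by exact: (smoothB oW).
have dw2 y (Wy : W y) := smooth_differentiable sw2 Wy.
have dr y (Wy : W y) := smooth_differentiable sr Wy.
have ds y (Wy : W y) := smooth_differentiable ss Wy.
have D2r y : W y -> D2 r y = 0 by move=> Wy; rewrite adapted_curl // w10 // mulr0.
have D1r y : W y -> D1 r y = r y * w y by move=> Wy; rewrite adapted_divergence // /w mulNr mulrN.
have D1w2 y : W y -> D1 w2 y = - (1 + w2 y ^+ 2).
  move=> Wy; have := adapted_curvature Wy.
  by rewrite (eq_along e2 oW Wy w10) along_cst w10 //; lra.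
have D1w y : W y -> D1 w y = 1 + w y ^+ 2.
  by move=> Wy; rewrite /w (alongN e1 (dw2 y Wy)) D1w2 // opprK sqrrN.
have cmt (f : V -> R) y : smooth W f -> W y -> D2 (D1 f) y - D1 (D2 f) y = - w y * D2 f y.
  move=> sf Wy; have := adapted_commutator sf Wy; rewrite w10 // /w.
  by move: (D1 (D2 f) y) (D2 (D1 f) y) (D1 f y) (D2 f y) => *; lra.
have cB y : W y -> D2 s' y - D1 q y = - 3 * w y * q y.
  move=> Wy; have := (adapted_codazzi Wy).2.
  by rewrite /s' (alongB e2 (dr y Wy) (ds y Wy)) D2r // w10 // /w; lra.
have cC y : W y -> D2 q y + D1 s' y = 3 * w y * s' y.
  move=> Wy; have := (adapted_codazzi Wy).1.
  by rewrite /s' (alongB e1 (dr y Wy) (ds y Wy)) D1r // w10 // /w; lra.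
have gs y : W y -> s' y * (r y - s' y) = q y * q y.
  by move=> Wy; have := adapted_gauss Wy; rewrite /s'; lra.
move=> Wx; split; [by rewrite D1r // /w mulrN mulNr|exact: D2r| |exact: D1w2|].
  have := rigid_D1w oW sr sw r_gt0 cmt D2r D1r Wx.
  by rewrite /w (alongN e2 (dw2 x Wx)) => /eqP; rewrite oppr_eq0 => /eqP.
have [/eqP] := rigid oW s2 s1 sr sw ss' sq r_gt0 cmt D2r D1r D1w cB cC gs Wx.
by rewrite subr_eq0 => /eqP.
Qed.

End CasePerp.

(* The quotient is locally constant and at most r^2, so r stays bounded below. *)
Lemma nonminimal_propagates (w : V -> R) x0 e : ball x0 e `<=` U -> W x0 -> ball x0 e x0 ->
  smooth W w ->
  (forall x, W x -> D1 (fun y => r y ^+ 2 / (1 + w y ^+ 2)) x = 0 /\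
                    D2 (fun y => r y ^+ 2 / (1 + w y ^+ 2)) x = 0) ->
  ball x0 e `<=` W.
Proof.
move=> eU Wx0 x0e sw d0; pose k2 y := r y ^+ 2 / (1 + w y ^+ 2).
have w1_gt0 y : 0 < 1 + w y ^+ 2 by rewrite ltr_pwDl // sqr_ge0.
have dk y : W y -> differentiable k2 y.
  move=> Wy; have dr := smooth_differentiable sr Wy; have dw := smooth_differentiable sw Wy.
  apply: diffrM; first exact: diffrM.
  apply: diffrV; first by rewrite gt_eqF.
  by apply: diffrD; [exact: differentiable_cst|exact: diffrM].
have k_const y a : ball y a `<=` W -> forall z, ball y a z -> k2 z = k2 y.
  by move=> aW; apply: (frame_constant adapted_span aW dk) => z /aW; exact: d0.
have k_le y : k2 y <= r y ^+ 2.
  by rewrite ler_pdivrMr // ler_peMr ?sqr_ge0 // lerDl sqr_ge0.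
have k_gt0 : 0 < k2 x0 by rewrite divr_gt0 // exprn_gt0 // r_gt0.
pose S := ball x0 e `&` (W `&` [set y | k2 y = k2 x0]).
have W_ball y : W y -> exists2 a, 0 < a & ball y a `<=` W.
  move=> Wy; have : nbhs y W by exact: open_nbhs_nbhs.
  by move=> /nbhs_ballP[a /= a0 aW]; exists a.
suff -> : ball x0 e = S by move=> y [_ []].
apply/esym; apply: ball_connected.
- by exists x0.
- exists (W `&` [set y | k2 y = k2 x0]) => //.
  rewrite openE => y [Wy ky]; have [a a0 aW] := W_ball y Wy.
  by apply/nbhs_ballP; exists a => //= z za; split; [exact: aW|rewrite /= (k_const _ _ aW)].
- exists (closure S); first exact: closed_closure.
  apply/seteqP; split => y [ye]; first by move=> h; split => //; apply: subset_closure.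
  move=> clS; have Uy := eU y ye.
  have Wy : W y.
    split => //=; rewrite lt_def dot_ge0 andbT; apply/negP => /eqP u0.
    have : nbhs y [set z | dot (mean_curvature_vector F z) (mean_curvature_vector F z) < k2 x0].
      have sH := smooth_mean_curvature leg.
      have dH := smooth_differentiable sH Uy.
      have cH := differentiable_continuous (diffr_dot dH dH).
      by apply: (cvgr_lt _ cH); rewrite u0.
    move=> /clS[z [[_ [_ kz]] /= uz]]; move: (k_le z).
    by rewrite expr2 mean_curvature_sqr kz leNgt uz.
  split => //; split => //=; have [a a0 aW] := W_ball y Wy.
  have /clS[z [[_ [_ <-]] za]] := nbhsx_ballx y a a0.
  by rewrite (k_const _ _ aW).
Qed.

(** In each of the three alternatives, [r^2] and [1 + w^2] have the same logarithmic derivative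
    along [e]: [0], [2 w] or [- 2 w]. *)
Lemma ratio_constant (w : V -> R) e x : W x -> smooth W w ->
  along e r x = 0 /\ along e w x = 0 \/
  along e r x = r x * w x /\ along e w x = 1 + w x ^+ 2 \/
  along e r x = - r x * w x /\ along e w x = - (1 + w x ^+ 2) ->
  along e (fun y => r y ^+ 2 / (1 + w y ^+ 2)) x = 0.
Proof.
move=> Wx sw h; have dr := smooth_differentiable sr Wx; have dw := smooth_differentiable sw Wx.
have w_neq0 : 1 + w x * w x != 0 by rewrite -expr2 gt_eqF // ltr_pwDl // sqr_ge0.
have d2 := diffrD (differentiable_cst (1 : R) x) (diffrM dw dw).
rewrite alongM; [|exact: diffrM|exact: diffrV].
rewrite (alongM e dr dr) (alongV e w_neq0 d2).
rewrite (alongD e (differentiable_cst (1 : R) x) (diffrM dw dw)) along_cst (alongM e dw dw).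
rewrite -/(w x ^+ 2) /=; case: h => [[-> ->]|[[-> ->]|[-> ->]]]; field; rewrite // .
Qed.

End LocalHarmonic.

(** * Change of charts *)

Section Reparametrization.
Variables (R : realType).
Local Notation V := 'rV[R]_2.
Variables (U U' : set V) (F F' : V -> cvect R 3) (tau : V -> V).
Hypotheses (leg : legendre_on U F) (leg' : legendre_on U' F') (stau : smooth U' tau)
  (tauU : forall x, U' x -> U (tau x)) (F'E : forall x, U' x -> F' x = F (tau x)).

Let oU : open U. Proof. by case: leg. Qed.
Let sF : smooth U F. Proof. by case: leg. Qed.
Let oU' : open U'. Proof. by case: leg'. Qed.
Let sF' : smooth U' F'. Proof. by case: leg'. Qed.

Lemma derive_reparam x u : U' x -> 'D_u F' x = 'D_('D_u tau x) F (tau x).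
Proof.
move=> Ux; rewrite (eq_derive_on u oU' Ux F'E); apply: d_comp.
  exact: smooth_differentiable stau Ux.
by apply: smooth_differentiable sF _; exact: tauU.
Qed.

Lemma derive2_reparam x u : U' x -> 'D_u ('D_u F') x =
  'D_('D_u ('D_u tau) x) F (tau x) + 'D_('D_u tau x) ('D_('D_u tau x) F) (tau x).
Proof.
move=> Ux; have Uy := tauU Ux.
have dt := smooth_differentiable (smooth_derive u stau) Ux.
have dtau := smooth_differentiable stau Ux.
have dFi i : differentiable ('D_(delta_mx 0 i) F) (tau x).
  exact: smooth_differentiable (smooth_derive _ sF) Uy.
have E z : U' z -> 'D_u F' z = \sum_i ('D_u tau z) 0 i *: 'D_(delta_mx 0 i) F (tau z).
  move=> Uz; rewrite (derive_reparam u Uz).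
  by rewrite -(@field_expand _ _ _ _ (fun=> 'D_u tau z)) //; apply: smooth_differentiable sF _;
    exact: tauU.
rewrite (eq_derive_on u oU' Ux E) dsum; last first.
  move=> i _; apply: diffrZ; first exact: diffr_coord.
  exact: differentiable_comp dtau (dFi i).
under eq_bigr => i _.
  rewrite dZ; [|exact: diffr_coord|exact: differentiable_comp dtau (dFi i)].
  rewrite d_coord // (d_comp u dtau (dFi i)); over.
rewrite big_split /=; congr (_ + _).
  by rewrite -(@field_expand _ _ _ _ (fun=> 'D_u ('D_u tau) x)) //; exact: smooth_differentiable sF Uy.
have E2 z : U z -> 'D_('D_u tau x) F z = \sum_i ('D_u tau x) 0 i *: 'D_(delta_mx 0 i) F z.
  move=> Uz; rewrite -(@field_expand _ _ _ _ (fun=> 'D_u tau x)) //; exact: smooth_differentiable sF Uz.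
rewrite (eq_derive_on _ oU Uy E2) dsum; last first.
  by move=> i _; apply: diffrZ => //; exact: differentiable_cst.
apply: eq_bigr => i _.
rewrite (dZ _ (differentiable_cst (('D_u tau x) 0 i) (tau x)) (dFi i)).
by rewrite d_cst scale0r add0r.
Qed.

(** [tau] carries an orthonormal frame to an orthonormal frame, and the second derivative of [tau]
    contributes only a tangent vector, which the normal projection kills. Hence vanishing of [H] at
    a point does not depend on the chart. *)
Lemma mean_curvature_reparam x : U' x ->
  mean_curvature_vector F' x = mean_curvature_vector F (tau x).
Proof.
move=> Ux; have Uy := tauU Ux.
have dF := smooth_differentiable sF Uy; have dF' := smooth_differentiable sF' Ux.
pose e' (i : 'I_2) : V := frame (gs1 F') (gs2 F') i x.
pose e (i : 'I_2) : V := 'D_(e' i) tau x.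
have ee' i j : dot ('D_(e' i) F' x) ('D_(e' j) F' x) = (i == j)%:R.
  apply: (frame_orthonormal (W := U')) => // y Uy';
    [exact: (gs1_unit leg')|exact: (gs2_unit leg')|exact: (gs_orthogonal leg')].
have ee i j : dot ('D_(e i) F (tau x)) ('D_(e j) F (tau x)) = (i == j)%:R.
  by rewrite -!derive_reparam.
have npE w : normal_part F' x w = normal_part F (tau x) w.
  rewrite (normal_partE dF' ee') (normal_partE dF ee) F'E //; congr (_ - _ - _).
  by apply: eq_bigr => i _; rewrite derive_reparam.
rewrite (mean_curvature_vectorE dF' ee' oU' sF' Ux) (mean_curvature_vectorE dF ee oU sF Uy).
congr (_ *: _); apply: eq_bigr => i _; rewrite npE derive2_reparam //.
rewrite -[X in normal_part _ _ (X + _)]scale1r (normal_part_lin dF ee).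
rewrite (normal_part_tangent dF ee) ?scaler0 ?add0r //.
by case: leg => _ _ FF FL _; apply: (tangent_orthogonal oU sF).
Qed.

End Reparametrization.

Local Notation coord := Defs.coord.

Section Charts.
Variables (R : realType) (M : topologicalType) (n : nat).

Lemma chart_overlap_open (c c' : chart R M n) : open (cod c `&` param c @^-1` dom c').
Proof.
have oc := @cod_open _ _ _ c; have := @param_continuous _ _ _ c.
rewrite continuous_open_subspace // => cc; rewrite openE => x [cx dx].
apply: filterI; first exact: open_nbhs_nbhs.
have := cc x; rewrite inE => /(_ cx); apply; apply: open_nbhs_nbhs.
by split => //; exact: dom_open.
Qed.

Lemma chart_preimage_open (c : chart R M n) (A : set 'rV[R]_n) : open A ->
  open (dom c `&` coord c @^-1` A).
Proof.
move=> oA; have oc := @dom_open _ _ _ c; have := @Defs.coord_continuous _ _ _ c.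
rewrite continuous_open_subspace // => cc; rewrite openE => x [cx dx].
apply: filterI; first exact: open_nbhs_nbhs.
by have := cc x; rewrite inE => /(_ cx); apply; exact: open_nbhs_nbhs.
Qed.

End Charts.

Section LegendreCharts.
Variables (R : realType) (M : topologicalType) (S : smooth_structure R M 2)
  (f : M -> cvect R 3) (f_legendre : legendre_immersion S f).

Lemma chart_legendre (c : chart R M 2) : atlas S c -> legendre_on (cod c) (f \o param c).
Proof.
move=> Sc; have [fS fs fI fL] := f_legendre; split.
- exact: cod_open.
- by rewrite smoothE; exact: fs.
- by move=> x _; apply/sphereP; exact: fS.
- by move=> x v cx; rewrite derE; exact: fL.
- by move=> x v cx; rewrite derE; exact: fI.
Qed.

Lemma chart_mean_curvature (c c' : chart R M 2) p : atlas S c -> atlas S c' ->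
  dom c p -> dom c' p ->
  mean_curvature_vector (f \o param c) (coord c p) =
  mean_curvature_vector (f \o param c') (coord c' p).
Proof.
move=> Sc Sc' cp c'p; have [cc _] := atlas_compatible Sc Sc'.
pose U' := cod c `&` param c @^-1` dom c'.
have U'p : U' (coord c p) by split; [exact: coord_cod|rewrite /= coordK].
have leg' : legendre_on U' (f \o param c).
  apply: legendre_onS (chart_legendre Sc); first exact: chart_overlap_open.
  by move=> x [].
have := mean_curvature_reparam (tau := coord c' \o param c) (chart_legendre Sc') leg' _ _ _ U'p.
rewrite /= coordK //; apply; first by rewrite smoothE.
  by move=> x [_ /coord_cod].
by move=> x [_ dx] /=; rewrite coordK.
Qed.

Hypothesis M_connected : connected [set: M].
Hypothesis f_nonminimal : ~ minimal S f.

(* [H <> 0] is an open condition, so if it propagates inside chart balls the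
   connectedness of [M] makes it hold everywhere. *)
Lemma mean_curvature_nowhere_zero :
  (forall c x0 e, atlas S c -> ball x0 e `<=` cod c -> ball x0 e x0 ->
     nonminimal_set (cod c) (f \o param c) x0 ->
     ball x0 e `<=` nonminimal_set (cod c) (f \o param c)) ->
  forall c x, atlas S c -> cod c x -> nonminimal_set (cod c) (f \o param c) x.
Proof.
move=> prop.
pose P := [set p | exists c, [/\ atlas S c, dom c p &
  mean_curvature_vector (f \o param c) (coord c p) != 0]].
have Pc c p : atlas S c -> dom c p -> P p -> mean_curvature_vector (f \o param c) (coord c p) != 0.
  by move=> Sc dp [c' [Sc' dp' h]]; rewrite (chart_mean_curvature Sc Sc').
have PT : P = [set: M].
  apply: M_connected.
  - apply: contrapT => /set0P/negP/negPn/eqP P0; apply: f_nonminimal => c x Sc cx.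
    apply: contrapT => /eqP h.
    suff : P (param c x) by rewrite P0.
    by exists c; split => //; [exact: param_dom|rewrite paramK].
  - exists P; last by rewrite setTI.
    rewrite openE => p [c [Sc dp h]].
    have oW := open_nonminimal_set (chart_legendre Sc).
    have o2 := chart_preimage_open c oW; move: (o2); rewrite openE => /(_ p) o3.
    apply: filterS (o3 _); last first.
      by split => //; split; [exact: coord_cod|rewrite /= dot_gt0].
    by move=> z [dz [_ /=]]; rewrite dot_gt0 => hz; exists c.
  - exists P; last by rewrite setTI.
    move=> p clP; have [c Sc dp] := atlas_cover S p.
    have /nbhs_ballP[e /= e0 eU] : nbhs (coord c p) (cod c).
      by apply: open_nbhs_nbhs; split; [exact: cod_open|exact: coord_cod].
    (* Half the radius: for a point [z] of [P] found there, the ball of radius [e / 2] about [z]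
       still lies in the chart and contains [p]. *)
    have : nbhs p (dom c `&` coord c @^-1` ball (coord c p) (e / 2)).
      apply: open_nbhs_nbhs; split; first exact/chart_preimage_open/ball_open.
      by split => //; apply: ballxx; rewrite divr_gt0.
    move=> /clP[z [Pz [dz /= ze]]]; exists c; split => //; rewrite -dot_gt0.
    have sub : ball (coord c z) (e / 2) `<=` cod c.
      by move=> y ye; apply: eU; rewrite [e]splitr; exact: ball_triangle ze ye.
    have e2 : 0 < e / 2 by rewrite divr_gt0.
    have Wz : nonminimal_set (cod c) (f \o param c) (coord c z).
      by split; [exact: coord_cod|rewrite /= dot_gt0; exact: Pc].
    by have [] := prop c (coord c z) (e / 2) Sc sub (ballxx _ e2) Wz _ (ball_sym ze).
move=> c x Sc cx; split => //=; rewrite dot_gt0 -[x](paramK cx).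
by apply: Pc => //; [exact: param_dom|rewrite PT].
Qed.

End LegendreCharts.

Section ChangeOfCoordinates.
Variables (R : realType) (M : topologicalType) (n : nat).
Variables (S : smooth_structure R M n) (c0 : chart R M n) (Sc0 : atlas S c0).
Variables (B : set 'rV[R]_n) (oB : open B) (Bc0 : B `<=` cod c0).
Variables (tau g : 'rV[R]_n -> 'rV[R]_n) (stau : smooth B tau) (otB : open (tau @` B))
  (gK : forall x, B x -> g (tau x) = x) (sg : smooth (tau @` B) g).

(** The transition maps of the new chart are those of [c0] composed with [tau] or [g], so they are
    smooth and maximality of the atlas admits the chart. *)
Lemma new_chart : exists c : chart R M n,
  [/\ atlas S c, dom c = dom c0 `&` coord c0 @^-1` B, cod c = tau @` B &
      forall x, B x -> param c (tau x) = param c0 x].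
Proof.
pose D := dom c0 `&` coord c0 @^-1` B.
have oD : open D by exact: chart_preimage_open.
have cont_in (T : topologicalType) (A : set T) (T' : topologicalType) (h : T -> T') :
    open A -> (forall x, A x -> {for x, continuous h}) -> {within A, continuous h}.
  by move=> oA hA; rewrite continuous_open_subspace // => x; rewrite inE; exact: hA.
have in_cont (T : topologicalType) (A : set T) (T' : topologicalType) (h : T -> T') x :
    open A -> {within A, continuous h} -> A x -> {for x, continuous h}.
  by move=> oA; rewrite continuous_open_subspace // => hA Ax; apply: hA; rewrite inE.
have h1 p : D p -> (tau @` B) ((tau \o coord c0) p) by move=> [_ Bp]; exists (coord c0 p).
have h2 x : (tau @` B) x -> D ((param c0 \o g) x).
  move=> [z Bz <-] /=; rewrite gK //; split; first exact/param_dom/Bc0.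
  by rewrite /= paramK //; exact: Bc0.
have h3 p : D p -> (param c0 \o g) ((tau \o coord c0) p) = p.
  by move=> [Dp Bp] /=; rewrite gK // coordK.
have h4 x : (tau @` B) x -> (tau \o coord c0) ((param c0 \o g) x) = x.
  by move=> [z Bz <-] /=; rewrite gK // paramK //; exact: Bc0.
have h5 : {within D, continuous (tau \o coord c0)}.
  apply: cont_in => // p [Dp Bp]; apply: continuous_comp.
    exact: in_cont (@dom_open _ _ _ c0) (@Defs.coord_continuous _ _ _ c0) Dp.
  exact/differentiable_continuous/(smooth_differentiable stau).
have h6 : {within tau @` B, continuous (param c0 \o g)}.
  apply: cont_in => // x tx; apply: continuous_comp.
    exact/differentiable_continuous/(smooth_differentiable sg).
  apply: in_cont (@cod_open _ _ _ c0) (@Defs.param_continuous _ _ _ c0) _.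
  by case: tx => z Bz <-; rewrite gK //; exact: Bc0.
pose c := Chart oD otB h1 h2 h3 h4 h5 h6.
exists c; split => //=; last by move=> x Bx; rewrite gK.
apply: atlas_maximal => c' Sc'; have [k1 k2] := atlas_compatible Sc0 Sc'.
split; rewrite -smoothE.
  have gO x : (cod c `&` param c @^-1` dom c') x -> (cod c0 `&` param c0 @^-1` dom c') (g x).
    by move=> [[z Bz <-]] /=; rewrite gK // => dz; split => //; exact: Bc0.
  rewrite -[coord c' \o param c]/(fun x => (coord c' \o param c0) (g x)).
  apply: (smooth_comp (@chart_overlap_open _ _ _ c c') gO (g := coord c' \o param c0)).
    by apply: smooth_onS sg => x [].
  by rewrite smoothE.
have cB x : (cod c' `&` param c' @^-1` dom c) x -> B ((coord c0 \o param c') x).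
  by move=> [_ []].
apply: (smooth_comp (@chart_overlap_open _ _ _ c' c) cB (g := tau)) => //.
by move: k2; rewrite -!smoothE; apply: smooth_onS => x [cx [dx _]].
Qed.

End ChangeOfCoordinates.

(** Turns functions [tau] with dual fields [X i] into genuine coordinates near [p], that is, into a
    chart of the given atlas. *)
Lemma coordinates_chart (R : realType) (M : topologicalType) (n : nat)
    (S : smooth_structure R M n) (c0 : chart R M n) p (U : set 'rV[R]_n)
    (tau : 'rV[R]_n -> 'rV[R]_n) (X : 'I_n -> 'rV[R]_n -> 'rV[R]_n) :
  atlas S c0 -> dom c0 p -> open U -> U `<=` cod c0 -> U (coord c0 p) ->
  smooth U tau -> (forall i, smooth U (X i)) ->
  (forall i x, U x -> 'D_(X i x) tau x = delta_mx 0 i) ->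
  exists c : chart R M n, [/\ atlas S c, dom c p &
    forall u, cod c u -> exists x, [/\ U x, tau x = u & param c u = param c0 x]].
Proof.
move=> Sc0 dp oU Uc Up stau sX tX.
have [r [g [r0 rU otB gK sg]]] := inverse_function oU Up stau sX tX.
have Bc : ball (coord c0 p) r `<=` cod c0 by move=> x /rU/Uc.
have [c [Sc domE codE pE]] := new_chart Sc0 (ball_open _ _) Bc (smooth_onS rU stau) otB gK sg.
exists c; split => //; first by rewrite domE; split => //; exact: ballxx.
rewrite codE => u [x xr <-]; exists x; split => //; [exact: rU|exact: pE].
Qed.

(** * Unitary coordinates and explicit integration *)

Lemma smooth_id (R : realType) (V : normedModType R) (U : set V) : open U -> smooth U (@id V).
Proof.
move=> oU; apply: (smooth_potential oU (D := fun v _ => v)) => [x _|v x _|v].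
- exact: ex_diff.
- exact: d_id.
- exact: smooth_cst.
Qed.

Section UnitaryCoordinates.
Variables (R : realType) (a b c : cvect R 3) (abc : unitary3 a b c).

Definition unitary_triple (j : 'I_3) : cvect R 3 :=
  if j == 0 then a else if j == 1 then b else c.
Local Notation e := unitary_triple.

(** The complex linear isometry that sends [a, b, c] to the standard basis; it is the isometry of
    the sphere required by the local forms. *)
Definition unitary_coord (v : cvect R 3) : cvect R 3 :=
  \matrix_(k, j) dot v (if k == 0 then e j else J (e j)).

Lemma unitary_coord0 v j : unitary_coord v 0 j = dot v (e j).
Proof. by rewrite mxE. Qed.
Lemma unitary_coord1 v j : unitary_coord v 1 j = dot v (J (e j)).
Proof. by rewrite mxE. Qed.

Lemma sum3 (T : nmodType) (f : 'I_3 -> T) : \sum_j f j = f 0 + f 1 + f 2%:R.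
Proof.
rewrite !big_ord_recl big_ord0 addr0 addrA; congr (f _ + f _ + f _); exact: val_inj.
Qed.

Lemma unitary_table i j : (dot (e i) (e j) = (i == j)%:R) * (dot (e i) (J (e j)) = 0).
Proof.
have T := unitary3_table abc.
by case: i => -[|[|[|//]]] Hi; case: j => -[|[|[|//]]] Hj; rewrite /e /= ?T ?dot0J.
Qed.

Lemma dot_unitary_coord u v : dot (unitary_coord u) (unitary_coord v) = dot u v.
Proof.
rewrite dotE [X in dot X v](unitary3_expand u abc) !dotlin sum3.
rewrite !unitary_coord0 !unitary_coord1 /unitary_triple /=.
by rewrite (dotC v) !(dotC v).
Qed.

Lemma unitary_coord_inj : injective unitary_coord.
Proof.
move=> u v uv; apply: (unitary3_inj abc).
all: have h0 j := etrans (esym (unitary_coord0 u j)) (etrans (congr1 (fun m : cvect R 3 => m 0 j)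
  uv) (unitary_coord0 v j)).
all: have h1 j := etrans (esym (unitary_coord1 u j)) (etrans (congr1 (fun m : cvect R 3 => m 1 j)
  uv) (unitary_coord1 v j)).
- exact: (h0 0).
- exact: (h1 0).
- exact: (h0 1).
- exact: (h1 1).
- exact: (h0 2%:R).
- exact: (h1 2%:R).
Qed.

Lemma unitary_coord_surj u : exists v, unitary_coord v = u.
Proof.
exists (\sum_j (u 0 j *: e j + u 1 j *: J (e j))).
apply: cvectP => i; rewrite ?unitary_coord0 ?unitary_coord1 dot_suml (bigD1 i) //= big1 ?addr0.
- by rewrite !dotlin dotJl !unitary_table eqxx oppr0 mulr0 addr0 mulr1.
- by move=> j ji; rewrite !dotlin dotJl !unitary_table (negPf ji) oppr0 !mulr0 addr0.
- by rewrite !dotlin dotJJ !unitary_table eqxx mulr0 add0r mulr1.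
- by move=> j ji; rewrite !dotlin dotJJ !unitary_table (negPf ji) !mulr0 addr0.
Qed.

Lemma smooth_unitary_coord : smooth setT unitary_coord.
Proof.
apply: (smooth_mx openT) => k j.
have -> : (fun v => unitary_coord v k j) = fun v => dot v (if k == 0 then e j else J (e j)).
  by apply/funext => v; rewrite mxE.
set w := (if _ then _ else _).
apply: (smooth_dot (f := id) (g := fun=> w) openT); first exact: smooth_id openT.
exact: (smooth_cst openT w).
Qed.

Lemma derive_unitary_coord p X : 'D_X unitary_coord p = unitary_coord X.
Proof.
have dA := smooth_differentiable smooth_unitary_coord (I : setT p).
apply/matrixP => k j; rewrite -d_coord //.
have -> : (fun v => unitary_coord v k j) = fun v => dot v (if k == 0 then e j else J (e j)).
  by apply/funext => v; rewrite mxE.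
set w := (if _ then _ else _).
rewrite (d_dot (f := id) (g := fun=> w)); [|exact: ex_diff|exact: differentiable_cst].
by rewrite d_cst dot0r addr0 d_id mxE.
Qed.

Lemma unitary_coord_isometry : sphere_isometry unitary_coord.
Proof.
have sph v : sphere (unitary_coord v) <-> sphere v by rewrite !sphereP dot_unitary_coord.
split.
- exists setT; split => //; first exact: openT.
  by rewrite -smoothE; exact: smooth_unitary_coord.
- split.
  + by move=> v /sph.
  + by move=> u v _ _; exact: unitary_coord_inj.
  + move=> u su; have [v vu] := unitary_coord_surj u; exists v => //.
    by apply/sph; rewrite vu.
- by move=> p X Y _ _ _; rewrite -!derE !derive_unitary_coord dot_unitary_coord.
Qed.

End UnitaryCoordinates.

Ltac vdiff_auto := repeat first [assumption | apply: diffrZ | apply: diffr_J | apply: diffrM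
  | apply: diffrB | apply: diffrD | apply: diffrN | apply: differentiable_cst].
Ltac valong_auto := repeat first [rewrite along_cst
  | rewrite alongB; [|by vdiff_auto|by vdiff_auto]
  | rewrite alongD; [|by vdiff_auto|by vdiff_auto] | rewrite alongN; [|by vdiff_auto]
  | rewrite alongZ; [|by vdiff_auto|by vdiff_auto] | rewrite along_J; [|by vdiff_auto]
  | rewrite alongM; [|by vdiff_auto|by vdiff_auto]].

(** Multiplication of a vector by the complex number [a + i b]. *)
Definition rot (R : realType) m (a b : R) (v : cvect R m) : cvect R m := a *: v + b *: J v.

Lemma unitary3_rot (R : realType) (a b c : cvect R 3) (p q : R) : p ^+ 2 + q ^+ 2 = 1 ->
  unitary3 a b c -> unitary3 a (rot p q b) (rot p q c).
Proof.
move=> pq abc; have T := unitary3_table abc.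
have p2 : p ^+ 2 = 1 - q ^+ 2 by rewrite -pq addrK.
rewrite /unitary3 /rot ?(dotlin, JD, JZ, JN, JK, dotJJ, dot0J, dotJ0) !T.
by do ![split]; rewrite // ; ring: p2.
Qed.

Section SecantFunction.
Variables (R : realType) (U : set 'rV[R]_2) (oU : open U) (w : 'rV[R]_2 -> R) (sw : smooth U w).

(** In both models [w] is, up to sign, the tangent of the coordinate [x], and [slope] is its
    secant. *)
Definition slope y : R := Num.sqrt (1 + w y ^+ 2).

Lemma slope_arg_gt0 y : 0 < 1 + w y ^+ 2.
Proof. by rewrite ltr_pwDl // sqr_ge0. Qed.

Lemma slope_gt0 y : 0 < slope y.
Proof. by rewrite sqrtr_gt0 slope_arg_gt0. Qed.

Lemma slope_sqr y : slope y ^+ 2 = 1 + w y ^+ 2.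
Proof. by rewrite sqr_sqrtr // ltW // slope_arg_gt0. Qed.

Lemma smooth_slope : smooth U slope.
Proof.
apply: (smooth_sqrt oU) => [y _|]; first exact: slope_arg_gt0.
by apply: (smoothD oU); [exact: smooth_cst|exact: smoothM].
Qed.

Lemma along_slope e x k : U x -> along e w x = k * slope x ^+ 2 -> along e slope x = k * w x * slope x.
Proof.
move=> Ux ew; have dw := smooth_differentiable sw Ux.
have d2 := diffrD (differentiable_cst (1 : R) x) (diffrM dw dw).
rewrite (along_fun e (is_derive1_sqrt (slope_arg_gt0 x)) d2).
rewrite (alongD e (differentiable_cst (1 : R) x) (diffrM dw dw)) along_cst (alongM e dw dw) ew.
rewrite -/(slope x); have := lt0r_neq0 (slope_gt0 x); move: (slope x) => t t0.
by field.
Qed.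

End SecantFunction.

Section RotatingPair.
Variables (R : realType).
Local Notation V := 'rV[R]_2.
Variables (U : set V) (oU : open U) (d1 d2 : V -> V).
Hypothesis span : forall x v, U x -> exists a b, v = a *: d1 x + b *: d2 x.
Variables (m : nat) (f g : V -> cvect R m) (rho : V -> R).
Hypotheses (sf : smooth U f) (sg : smooth U g)
  (D1fg : forall x, U x -> along d1 f x = rho x *: g x /\ along d1 g x = - rho x *: f x)
  (D2fg : forall x, U x -> along d2 f x = 0 /\ along d2 g x = 0).

(** The inner products of [f] and [g] with the initial vector [f x0] form a rotating scalar pair,
    whose angle [y] is supplied by [phase]. The deviations of [f] and [g] from the explicit rotation
    satisfy the same system and vanish at [x0], so [energy] with [kap = 0] annihilates them. *)
Lemma rotating_pair x0 : U x0 -> dot (f x0) (f x0) = 1 -> dot (f x0) (g x0) = 0 ->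
  exists e y, [/\ 0 < e, ball x0 e `<=` U, smooth (ball x0 e) y,
    forall x, ball x0 e x -> along d1 y x = rho x /\ along d2 y x = 0 &
    forall x, ball x0 e x -> f x = cos (y x) *: f x0 + sin (y x) *: g x0].
Proof.
move=> Ux0 ff fg.
have [f0 f0E] : exists v, v = f x0 by exists (f x0).
have [g0 g0E] : exists v, v = g x0 by exists (g x0).
rewrite -f0E -g0E; rewrite -f0E in ff fg; rewrite -g0E in fg.
pose a x := dot (f x) f0; pose a' x := dot (g x) f0.
have scst (T : set V) (v : cvect R m) : open T -> smooth T (fun=> v) by move=> oT; exact: smooth_cst.
have sa : smooth U a by exact: (smooth_dot oU sf (scst _ _ oU)).
have sa' : smooth U a' by exact: (smooth_dot oU sg (scst _ _ oU)).
have da v (d : V -> V) x : smooth U v -> U x ->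
    along d (fun y => dot (v y) f0) x = dot (along d v x) f0.
  move=> sv Ux; rewrite along_dot; last exact: differentiable_cst.
    by rewrite along_cst dot0r addr0.
  exact: smooth_differentiable sv Ux.
have h1 x : U x -> along d1 a x = rho x * a' x /\ along d1 a' x = - rho x * a x.
  by move=> Ux; rewrite !da //; have [-> ->] := D1fg Ux; rewrite !dotZl.
have h2 x : U x -> along d2 a x = 0 /\ along d2 a' x = 0.
  by move=> Ux; rewrite !da //; have [-> ->] := D2fg Ux; rewrite !dot0l.
have ax0 : 0 < a x0 by rewrite /a -f0E ff.
have a'x0 : a' x0 = 0 by rewrite /a' -g0E dotC.
have [e [y [e0 eU sy y0 Dy]]] := phase oU Ux0 sa sa' h1 h2 ax0 a'x0.
exists e, y; split => // x xe.
have oB : open (ball x0 e) by exact: ball_open.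
have [ss sc] := smooth_sincos oB sy.
pose dl x := f x - (cos (y x) *: f0 + sin (y x) *: g0).
pose up x := g x - (- sin (y x) *: f0 + cos (y x) *: g0).
have sdl : smooth (ball x0 e) dl.
  apply: (smoothB oB); first exact: smooth_onS sf.
  by apply: (smoothD oB); apply: (smoothZ oB) => //; exact: scst.
have sup : smooth (ball x0 e) up.
  apply: (smoothB oB); first exact: smooth_onS sg.
  by apply: (smoothD oB); apply: (smoothZ oB) => //; [exact: (smoothN oB)|exact: scst|exact: scst].
have D z (ze : ball x0 e z) d : along d dl z = along d f z -
    along d y z *: (- sin (y z) *: f0 + cos (y z) *: g0) /\
    along d up z = along d g z + along d y z *: (cos (y z) *: f0 + sin (y z) *: g0).
  have dy := smooth_differentiable sy ze.
  have dm := smooth_differentiable sf (eU z ze); have dn := smooth_differentiable sg (eU z ze).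
  have ds := smooth_differentiable ss ze; have dc := smooth_differentiable sc ze.
  rewrite /dl /up; split; valong_auto;
    rewrite (along_fun _ (is_derive_sin _) dy) (along_fun _ (is_derive_cos _) dy);
    move: (along d f z) (along d g z) => *;
    by apply/matrixP => i j; rewrite !mxE; ring.
have [] := energy (kap := 0) (rho := rho) span eU sdl sup _ _ _ _ xe.
- move=> z ze; have [-> ->] := D z ze d1; have [-> _] := Dy z ze.
  have [-> ->] := D1fg (eU z ze); rewrite /dl /up scale0r sub0r.
  by move: (f z) (g z) => *; split; apply/matrixP => i j; rewrite !mxE; ring.
- move=> z ze; have [-> ->] := D z ze d2; have [_ ->] := Dy z ze.
  by have [-> ->] := D2fg (eU z ze); rewrite !scale0r subr0 addr0.
- by rewrite /dl -f0E y0 cos0 sin0 scale1r scale0r addr0 subrr.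
- by rewrite /up -g0E y0 cos0 sin0 oppr0 scale1r scale0r add0r subrr.
by move=> /eqP; rewrite subr_eq0 => /eqP.
Qed.

End RotatingPair.

(** * Integration of the structure equations in case (iii) *)

Section PerpModel.
Variables (R : realType).
Local Notation V := 'rV[R]_2.
Variables (U : set V) (oU : open U) (F : V -> cvect R 3) (e1 e2 : V -> V) (w : V -> R) (b : R).
Hypotheses (sF : smooth U F) (s1 : smooth U e1) (s2 : smooth U e2) (sw : smooth U w) (b0 : 0 < b).
Local Notation D1 := (along e1).
Local Notation D2 := (along e2).
Local Notation E1 := (along e1 F).
Local Notation E2 := (along e2 F).
Local Notation sq := (slope w).
Hypotheses (span : forall x v, U x -> exists p q, v = p *: e1 x + q *: e2 x)
  (u3 : forall x, U x -> unitary3 (F x) (E1 x) (E2 x))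
  (D11 : forall x, U x -> D1 E1 x = (b * sq x) *: J (E1 x) - F x)
  (D12 : forall x, U x -> D1 E2 x = (b * sq x) *: J (E2 x))
  (D21 : forall x, U x -> D2 E1 x = w x *: E2 x + (b * sq x) *: J (E2 x))
  (D22 : forall x, U x -> D2 E2 x = - w x *: E1 x + (b * sq x) *: J (E1 x) - F x)
  (D1w : forall x, U x -> D1 w x = - (1 + w x ^+ 2)) (D2w : forall x, U x -> D2 w x = 0).

Let ssq : smooth U sq := smooth_slope oU sw.
Let sq0 x : 0 < sq x := slope_gt0 w x.
Let D1sq x : U x -> D1 sq x = - w x * sq x.
Proof. by move=> Ux; rewrite (along_slope (k := -1) sw Ux) ?D1w // ?slope_sqr; ring. Qed.
Let D2sq x : U x -> D2 sq x = 0.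
Proof. by move=> Ux; rewrite (along_slope (k := 0) sw Ux) ?D2w //; ring. Qed.

Definition perp_radius : R := Num.sqrt (1 + b ^+ 2).
Local Notation ra := perp_radius.
Let ra0 : 0 < ra. Proof. by rewrite sqrtr_gt0 ltr_pwDl // sqr_ge0. Qed.
Let ra2 : ra ^+ 2 = 1 + b ^+ 2. Proof. by rewrite sqr_sqrtr // ltW // ltr_pwDl // sqr_ge0. Qed.

(** With [w = - tan x] one has [slope - w = sec x + tan x], so [perp_phase] is the exponent
    [b ln (sec x + tan x)] of the model. *)
Definition perp_x y : R := atan (- w y).
Definition perp_phase y : R := b * ln (sq y - w y).

Let sw_gt0 y : 0 < sq y - w y.
Proof.
rewrite subr_gt0; have [wy|wy] := leP (w y) 0; first exact: le_lt_trans wy (sq0 y).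
by rewrite -(ltr_pXn2r (ltn0Sn 1)) ?nnegrE ?ltW ?sq0 // slope_sqr ltrDr.
Qed.

Lemma smooth_perp_x : smooth U perp_x.
Proof. by apply: (smooth_atan oU); exact: (smoothN oU). Qed.

Lemma smooth_perp_phase : smooth U perp_phase.
Proof.
apply: (smoothM oU); first exact: smooth_cst.
by apply: (smooth_ln oU) => //; exact: (smoothB oU).
Qed.

Lemma perp_x_trig y : cos (perp_x y) = (sq y)^-1 /\ sin (perp_x y) = - w y * (sq y)^-1.
Proof.
have ca : cos (perp_x y) = (sq y)^-1 by rewrite cos_atan sqrrN.
split => //; have := atanK (- w y); rewrite /tan -/(perp_x y) ca => <-.
by rewrite invrK -mulrA mulfV ?mulr1 // gt_eqF.
Qed.

Lemma along_perp_x x : U x -> D1 perp_x x = 1 /\ D2 perp_x x = 0.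
Proof.
move=> Ux; have dw := diffrN (smooth_differentiable sw Ux).
rewrite !(along_fun _ (is_derive1_atan (- w x)) dw) !alongN ?D1w ?D2w //;
  try exact: smooth_differentiable Ux.
by rewrite oppr0 mul0r opprK sqrrN mulfV // gt_eqF // ltr_pwDl // sqr_ge0.
Qed.

Lemma along_perp_phase x : U x -> D1 perp_phase x = b * sq x /\ D2 perp_phase x = 0.
Proof.
move=> Ux; have dw := smooth_differentiable sw Ux; have ds := smooth_differentiable ssq Ux.
have dsw := diffrB ds dw.
have dln := diffr1 (a := fun y => sq y - w y) (is_derive1_ln (sw_gt0 x)) dsw.
have h e : along e perp_phase x = b * ((along e sq x - along e w x) * (sq x - w x)^-1).
  rewrite /perp_phase (alongM e (differentiable_cst b x) dln) along_cst mul0r add0r.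
  by rewrite (along_fun (a := fun y => sq y - w y) e (is_derive1_ln (sw_gt0 x)) dsw) (alongB e ds dw).
rewrite !h D1w // D1sq // D2w // D2sq //; split; last by ring.
have := lt0r_neq0 (sw_gt0 x); have := slope_sqr w x; move: (sq x) (w x) => s t st n0.
by rewrite -st; field.
Qed.

(** Found by inverting the model. There [F = ((i b + sin x) e + cos x u) / ra] and
    [E1 = (cos x e + (i b - sin x) u) / ra], with [u] the rest of the position up to length; this
    matrix is unitary, and its conjugate transpose gives [perp_e] and [perp_u]. *)
Definition perp_e y : cvect R 3 :=
  ra^-1 *: (- b *: J (F y) - (w y * (sq y)^-1) *: F y + (sq y)^-1 *: E1 y).
Definition perp_u y : cvect R 3 :=
  ra^-1 *: ((sq y)^-1 *: F y + (w y * (sq y)^-1) *: E1 y - b *: J (E1 y)).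
Local Notation cq y := (cos (perp_phase y)).
Local Notation sn y := (sin (perp_phase y)).
(** Along [e1] both [perp_u] and [E2] are multiplied by the same phase. Removing it leaves a pair
    that is constant along [e1] and rotates along [e2]. *)
Definition perp_m y : cvect R 3 := rot (cq y) (- sn y) (perp_u y).
Definition perp_n y : cvect R 3 := rot (cq y) (- sn y) (E2 y).

Let dF x (Ux : U x) := smooth_differentiable sF Ux.
Let sE1 : smooth U E1 := smooth_along_mx oU sF s1.
Let sE2 : smooth U E2 := smooth_along_mx oU sF s2.
Let sqV : smooth U (fun y => (sq y)^-1).
Proof. by apply: (smoothV oU) => // y _; rewrite gt_eqF. Qed.

Let along_sqV x : U x -> D1 (fun y => (sq y)^-1) x = w x * (sq x)^-1 /\ D2 (fun y => (sq y)^-1) x = 0.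
Proof.
move=> Ux; have n0 := lt0r_neq0 (sq0 x); have ds := smooth_differentiable ssq Ux.
rewrite !(alongV _ n0 ds) D1sq // D2sq //; split; last by rewrite mul0r oppr0.
by field.
Qed.

Lemma along_perp_e x : U x -> D1 perp_e x = 0 /\ D2 perp_e x = 0.
Proof.
move=> Ux; have dw := smooth_differentiable sw Ux; have ds := smooth_differentiable sqV Ux.
have df := dF Ux; have d1 := smooth_differentiable sE1 Ux.
have n0 := lt0r_neq0 (sq0 x); have [k1 k2] := along_sqV Ux.
have ss : w x * w x = sq x * sq x - 1 by have := slope_sqr w x; rewrite !expr2; lra.
rewrite /perp_e; split; valong_auto; rewrite ?k1 ?k2 ?D1w ?D2w ?D11 ?D21 //; move: ss n0.
  move: ra^-1 (F x) (J (F x)) (E1 x) (J (E1 x)) (w x) (sq x) => k f jf g jg t s ss n0.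
  by apply/matrixP => i j; rewrite !mxE; field.
move: ra^-1 (E2 x) (J (E2 x)) (w x) (sq x) => k f jf t s ss n0.
by apply/matrixP => i j; rewrite !mxE; field.
Qed.

Lemma along_perp_u x : U x -> D1 perp_u x = (b * sq x) *: J (perp_u x) /\
  D2 perp_u x = (ra * sq x) *: E2 x.
Proof.
move=> Ux; have dw := smooth_differentiable sw Ux; have ds := smooth_differentiable sqV Ux.
have df := dF Ux; have d1 := smooth_differentiable sE1 Ux.
have n0 := lt0r_neq0 (sq0 x); have [k1 k2] := along_sqV Ux.
have ss : w x * w x = sq x * sq x - 1 by have := slope_sqr w x; rewrite !expr2; lra.
have rr : ra * ra = 1 + b * b by rewrite -!expr2.
have r0 := lt0r_neq0 ra0.
rewrite /perp_u; split; valong_auto; rewrite ?k1 ?k2 ?D1w ?D2w ?D11 ?D21 ?(JD, JZ, JN, JB, JK) //;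
  move: ss n0.
  move: ra^-1 (F x) (J (F x)) (E1 x) (J (E1 x)) (w x) (sq x) => k f jf g jg t s ss n0.
  by apply/matrixP => i j; rewrite !mxE; field.
move: rr r0; move: ra (E2 x) (J (E2 x)) (w x) (sq x) => k f jf t s rr k0 ss n0.
apply/matrixP => i j; rewrite !mxE; apply/eqP; rewrite -subr_eq0; apply/eqP.
(* The difference of the two sides is a combination of the relations [w^2 = slope^2 - 1] and
   [ra^2 = 1 + b^2]. *)
apply: (@etrans _ _ ((k^-1 / s * (t * t - (s * s - 1)) - k^-1 * s * (k * k - (1 + b * b))) * f i j)).
  by field; rewrite n0 k0.
by rewrite ss rr; ring.
Qed.

Let sQ := smooth_sincos oU smooth_perp_phase.

Lemma smooth_perp_u : smooth U perp_u.
Proof.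
apply: (smoothZ oU); first exact: smooth_cst.
apply: (smoothB oU); last by apply: (smoothZ oU); [exact: smooth_cst|exact: smooth_J].
by apply: (smoothD oU); apply: (smoothZ oU) => //; apply: (smoothM oU).
Qed.

Lemma smooth_rot (p q : V -> R) (v : V -> cvect R 3) : smooth U p -> smooth U q -> smooth U v ->
  smooth U (fun y => rot (p y) (q y) (v y)).
Proof.
move=> sp sq' sv; apply: (smoothD oU); apply: (smoothZ oU) => //; exact: smooth_J.
Qed.

Lemma smooth_perp_m : smooth U perp_m.
Proof. by apply: smooth_rot; [exact: sQ.2|apply: (smoothN oU); exact: sQ.1|exact: smooth_perp_u]. Qed.
Lemma smooth_perp_n : smooth U perp_n.
Proof. by apply: smooth_rot; [exact: sQ.2|apply: (smoothN oU); exact: sQ.1|]. Qed.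

Let along_trig x : U x -> (D1 (fun y => cq y) x = - (b * sq x) * sn x) * (D2 (fun y => cq y) x = 0) *
  (D1 (fun y => sn y) x = (b * sq x) * cq x) * (D2 (fun y => sn y) x = 0).
Proof.
move=> Ux; have dp := smooth_differentiable smooth_perp_phase Ux; have [p1 p2] := along_perp_phase Ux.
rewrite !(along_fun _ (is_derive_sin _) dp) !(along_fun _ (is_derive_cos _) dp) p1 p2.
by do ![split]; ring.
Qed.

Lemma along_perp_mn x : U x ->
  [/\ D1 perp_m x = 0, D1 perp_n x = 0, D2 perp_m x = (ra * sq x) *: perp_n x &
      D2 perp_n x = - (ra * sq x) *: perp_m x].
Proof.
move=> Ux; have T := along_trig Ux.
have ds := smooth_differentiable sQ.1 Ux; have dc := smooth_differentiable sQ.2 Ux.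
have du := smooth_differentiable smooth_perp_u Ux; have d2 := smooth_differentiable sE2 Ux.
have [u1 u2] := along_perp_u Ux.
have n22 : D2 E2 x = - (ra * sq x) *: perp_u x.
  rewrite D22 //; have r0 := lt0r_neq0 ra0; have n0 := lt0r_neq0 (sq0 x); rewrite /perp_u.
  move: r0 n0; move: ra (E1 x) (J (E1 x)) (F x) (w x) (sq x) => k f jf g t s k0 n0.
  by apply/matrixP => i j; rewrite !mxE; field; rewrite n0 k0.
rewrite /perp_m /perp_n /rot; split; valong_auto;
  rewrite ?T ?u1 ?u2 ?n22 ?D12 ?(JD, JZ, JN, JK) //;
  move: (perp_u x) (J (perp_u x)) (E2 x) (J (E2 x)) => a b' c d;
  by apply/matrixP => i j; rewrite !mxE; ring.
Qed.

Lemma perp_unitary x : U x -> unitary3 (perp_e x) (perp_m x) (perp_n x).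
Proof.
move=> Ux; apply: unitary3_rot; first by rewrite sqrrN cos2Dsin2.
have T := unitary3_table (u3 Ux).
have n0 := lt0r_neq0 (sq0 x); have r0 := lt0r_neq0 ra0.
have ss : w x * w x = sq x * sq x - 1 by have := slope_sqr w x; rewrite !expr2; lra.
have rr : ra * ra = 1 + b * b by rewrite -!expr2.
rewrite /perp_e /perp_u /unitary3 ?(dotlin, JD, JZ, JN, JB, JK).
rewrite ?(dotJJ, dot0J, dotJ0, T).
move: ss rr n0 r0; move: ra (w x) (sq x) => k t s ss rr n0 k0.
have i1 : k^-1 * (k^-1 * (1 + b * b)) = 1 by rewrite -rr; field.
have i2 : s^-1 * s^-1 * (1 + t * t) = 1 by rewrite ss; field.
have i3 : s^-1 * s^-1 + t / s * (t / s) = 1 by rewrite -i2; ring.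
have i4 : k^-1 * (k^-1 * (s^-1 * s^-1 + t / s * (t / s) + b * b)) = 1 by rewrite i3.
do ![split]; rewrite ?opprK; try ring; rewrite -[RHS]i4; ring.
Qed.

Lemma perp_position x : U x -> F x =
  (- w x * (sq x)^-1 * ra^-1) *: perp_e x + (b * ra^-1) *: J (perp_e x)
  + (cq x * (sq x)^-1 * ra^-1) *: perp_m x + (sn x * (sq x)^-1 * ra^-1) *: J (perp_m x).
Proof.
move=> Ux; have n0 := lt0r_neq0 (sq0 x); have r0 := lt0r_neq0 ra0.
have i2 : (sq x)^-1 * (sq x)^-1 * (1 + w x ^+ 2) = 1 by rewrite -slope_sqr; field.
have i1 : ra^-1 * ra^-1 * (1 + b ^+ 2) = 1 by rewrite -ra2; field.
have um : (cq x * (sq x)^-1 * ra^-1) *: perp_m x + (sn x * (sq x)^-1 * ra^-1) *: J (perp_m x) =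
    ((sq x)^-1 * ra^-1) *: perp_u x.
  rewrite /perp_m /rot.
  have c2 := cos2Dsin2 (perp_phase x); move: c2.
  move: (sq x)^-1 ra^-1 (cq x) (sn x) (perp_u x) => s k c d f c2.
  rewrite JD !JZ JK; move: (J f) => jf.
  apply/matrixP => i j; rewrite !mxE -[RHS]mul1r -c2; ring.
rewrite -addrA um /perp_e /perp_u JZ JD JB !JZ JK.
move: i1 i2; move: (sq x)^-1 ra^-1 (w x) (F x) (J (F x)) (E1 x) (J (E1 x)) => s k t f jf g jg i1 i2.
apply/matrixP => i j; rewrite !mxE -[LHS]mul1r -i1.
have -> : 1 + b ^+ 2 = s * s * (1 + t ^+ 2) + b ^+ 2 by rewrite i2.
ring.
Qed.

Lemma perp_integrate x0 : U x0 -> exists e y, [/\ 0 < e, ball x0 e `<=` U, smooth (ball x0 e) y,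
  forall x, ball x0 e x -> D1 y x = 0 /\ D2 y x = ra * sq x &
  forall x, ball x0 e x -> perp_e x = perp_e x0 /\
    perp_m x = cos (y x) *: perp_m x0 + sin (y x) *: perp_n x0].
Proof.
move=> Ux0; have [[_ m1 _] [[_ _ mn] _]] := perp_unitary Ux0.
(* [rotating_pair] is used with the frame fields exchanged, because here the rotation takes place
   along [e2]. *)
have span' x v : U x -> exists p q, v = p *: e2 x + q *: e1 x.
  by move=> Ux; have [p [q ->]] := span v Ux; exists q, p; rewrite addrC.
have [||e [y [e0 eU sy Dy mE]]] :=
  rotating_pair (rho := fun x => ra * sq x) oU span' smooth_perp_m smooth_perp_n _ _ Ux0 m1 mn.
- by move=> x Ux; have [_ _ -> ->] := along_perp_mn Ux.
- by move=> x Ux; have [-> -> _ _] := along_perp_mn Ux.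
exists e, y; split => // [x /Dy[-> ->] //|x xe]; split; last exact: mE.
apply: (frame_constant_mx span eU) xe => [z Uz|z ze]; last by apply: along_perp_e; exact: eU.
apply: diffrZ; first exact: differentiable_cst.
have df := dF Uz; have d1 := smooth_differentiable sE1 Uz.
have dw := smooth_differentiable sw Uz; have dq := smooth_differentiable sqV Uz.
by vdiff_auto.
Qed.

End PerpModel.

(** * The model curves *)

Section ComplexPairs.
Variable R : realType.

Definition pair_mx (a0 a1 b0 b1 : R) : cvect R 2 := \matrix_(k, j)
  (if k == 0 then (if j == 0 then a0 else b0) else (if j == 0 then a1 else b1)).

Lemma pair_mxE a0 a1 b0 b1 : row_mx (cnum (a0 +i* a1)%C) (cnum (b0 +i* b1)%C) = pair_mx a0 a1 b0 b1.
Proof.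
apply/matrixP => k j; rewrite !mxE; case: splitP => j' jE; rewrite !mxE /=.
  have -> : (j == 0) = true by apply/eqP/val_inj; rewrite /= jE (ord1 j').
  by case: ifP.
have -> : (j == 0) = false by apply/negP => /eqP j0; move: jE; rewrite j0.
by case: ifP.
Qed.

Lemma dot_pair a0 a1 b0 b1 c0 c1 d0 d1 : dot (pair_mx a0 a1 b0 b1) (pair_mx c0 c1 d0 d1) =
  a0 * c0 + a1 * c1 + (b0 * d0 + b1 * d1).
Proof. by rewrite dotE !big_ord_recl big_ord0 !mxE addr0. Qed.

Lemma J_pair a0 a1 b0 b1 : J (pair_mx a0 a1 b0 b1) = pair_mx (- a1) a0 (- b1) b0.
Proof.
by apply/matrixP => k j; rewrite !mxE; case: (k == 0); case: (j == 0).
Qed.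

Lemma scale_pair c a0 a1 b0 b1 : c *: pair_mx a0 a1 b0 b1 = pair_mx (c * a0) (c * a1) (c * b0) (c * b1).
Proof. by apply/matrixP => k j; rewrite !mxE; case: (k == 0); case: (j == 0). Qed.

Lemma sub_pair a0 a1 b0 b1 c0 c1 d0 d1 : pair_mx a0 a1 b0 b1 - pair_mx c0 c1 d0 d1 =
  pair_mx (a0 - c0) (a1 - c1) (b0 - d0) (b1 - d1).
Proof. by apply/matrixP => k j; rewrite !mxE; case: (k == 0); case: (j == 0). Qed.

Section PairCalculus.
Variables (V : normedModType R) (U : set V) (oU : open U) (a0 a1 b0 b1 : V -> R).
Hypotheses (sa0 : smooth U a0) (sa1 : smooth U a1) (sb0 : smooth U b0) (sb1 : smooth U b1).
Local Notation z := (fun t => pair_mx (a0 t) (a1 t) (b0 t) (b1 t)).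

Lemma smooth_pair : smooth U z.
Proof.
apply: (smooth_mx oU) => k j.
have -> : (fun t => z t k j) =
    if k == 0 then (if j == 0 then a0 else b0) else (if j == 0 then a1 else b1).
  by apply/funext => t; rewrite mxE; case: (k == 0); case: (j == 0).
by case: (k == 0); case: (j == 0).
Qed.

Lemma derive_pair v t : U t ->
  'D_v z t = pair_mx ('D_v a0 t) ('D_v a1 t) ('D_v b0 t) ('D_v b1 t).
Proof.
move=> Ut; have dz := smooth_differentiable smooth_pair Ut.
apply/matrixP => k j; rewrite -d_coord // mxE.
have -> : (fun t => z t k j) =
    if k == 0 then (if j == 0 then a0 else b0) else (if j == 0 then a1 else b1).
  by apply/funext => s; rewrite mxE; case: (k == 0); case: (j == 0).
by case: (k == 0); case: (j == 0).
Qed.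

End PairCalculus.
End ComplexPairs.

Section SecantCurve.
Variables (R : realType) (b : R).
Local Notation ra := (Num.sqrt (1 + b ^+ 2)).
Local Notation phase := (fun t : R^o => b * ln (sec t + tan t)).
Definition half_turn : set R := [set t | - (pi / 2) < t < pi / 2].

Lemma open_half_turn : open (half_turn : set R^o).
Proof.
have -> : (half_turn : set R^o) = `]- (pi / 2), pi / 2[%classic.
  by apply/seteqP; split => t /=; rewrite in_itv.
exact: interval_open.
Qed.

Lemma cos_half_turn t : half_turn t -> 0 < cos t.
Proof. by move=> /cos_gt0_pihalf. Qed.

Lemma sec_tan_gt0 t : half_turn t -> 0 < sec t + tan t.
Proof.
move=> /cos_half_turn ct; rewrite /sec /tan -[X in X + _]mul1r -mulrDl divr_gt0 //.
have := cos2Dsin2 t; have : 0 < cos t ^+ 2 by rewrite exprn_gt0.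
move: (cos t ^+ 2) => c c0 h; have : sin t ^+ 2 < 1 by rewrite -h ltrDr.
(* If [1 + sin t] were not positive, then [sin t <= -1] and its square could not be below [1]. *)
by have [//|] := ltP 0 (1 + sin t); move: (sin t) => s ? ?; nra.
Qed.

Lemma ra_gt0 : 0 < ra. Proof. by rewrite sqrtr_gt0 ltr_pwDl // sqr_ge0. Qed.

Lemma real_complexV (x : R) : (x%:C)^-1%C = (x^-1)%:C%C :> R[i].
Proof.
by apply/eqP; rewrite eq_complex /= expr0n /= addr0 mul0r oppr0 eqxx andbT expr2 invfM mulrA;
  have [->|x0] := eqVneq x 0; rewrite ?invr0 ?mulr0 // mulfV ?mul1r.
Qed.

Lemma z1E t : z1 b t = (sin t / ra +i* (b / ra))%C.
Proof. by rewrite /z1 real_complexV; simpc. Qed.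

Lemma z2E t : z2 b t = (cos (phase t) * cos t / ra +i* (sin (phase t) * cos t / ra))%C.
Proof. by rewrite /z2 /cexp real_complexV; simpc => /=; rewrite ?expR0 ?mul1r. Qed.

Let smooth_trig : smooth half_turn (@sin R : R^o -> R) /\ smooth half_turn (@cos R : R^o -> R).
Proof.
exact: (smooth_sincos open_half_turn (smooth_id open_half_turn)).
Qed.

Let smooth_st : smooth half_turn (fun t : R^o => sec t + tan t).
Proof.
have [ss sc] := smooth_trig; have oI := open_half_turn.
have sv : smooth half_turn (fun t : R^o => (cos t)^-1).
  by apply: (smoothV oI) sc => t /cos_half_turn; rewrite lt0r => /andP[].
by apply: (smoothD oI) => //; apply: (smoothM oI).
Qed.

Lemma smooth_sec_phase : smooth half_turn phase.
Proof.
apply: (smoothM open_half_turn); first exact: (smooth_cst open_half_turn).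
by apply: (smooth_ln open_half_turn) smooth_st; exact: sec_tan_gt0.
Qed.

Lemma derive_trig t : ('D_1 (@sin R : R^o -> R) t = cos t) * ('D_1 (@cos R : R^o -> R) t = - sin t).
Proof.
have di : differentiable (@id R^o) t by exact: ex_diff.
by split; rewrite (d1 (a := @id R^o) _ _ di) d_id mul1r.
Qed.

Lemma derive_sec_phase t : half_turn t -> 'D_1 phase t = b / cos t.
Proof.
move=> It; have [ss sc] := smooth_trig; have oI := open_half_turn.
have ct := lt0r_neq0 (cos_half_turn It).
have dc := smooth_differentiable sc It; have ds := smooth_differentiable ss It.
have dv := diffrV ct dc; have dst := smooth_differentiable smooth_st It.
have st0 := sec_tan_gt0 It.
have dln := diffr1 (a := fun s : R^o => sec s + tan s) (is_derive1_ln st0) dst.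
rewrite (dM _ (differentiable_cst b t) dln) d_cst mul0r add0r.
rewrite (d1 (a := fun s : R^o => sec s + tan s) _ (is_derive1_ln st0) dst).
rewrite (dD _ dv (diffrM ds dv)) (dM _ ds dv) (dV _ ct dc) !derive_trig.
have n0 := lt0r_neq0 st0; move: n0; rewrite /sec /tan; have c2 := cos2Dsin2 t.
move: c2 ct; move: (cos t) (sin t) => c s c2 c0 n0.
have n1 : 1 + s != 0 by apply: contraNneq n0 => h; rewrite -[X in X + _]mul1r -mulrDl h mul0r.
have c2' : c * c = (1 - s) * (1 + s) by rewrite -expr2 -[LHS](addrK (s ^+ 2)) c2; ring.
have -> : - (- s * (c^-1 * c^-1)) + (c * c^-1 + s * - (- s * (c^-1 * c^-1))) = (1 + s) * (c^-1 * c^-1).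
  apply: (mulfI c0); apply: (mulfI c0); rewrite expr2 in c2; apply: (@etrans _ _ (s + (c * c + s * s))).
    by field.
  by rewrite -[s * s]/(s ^+ 2) c2; field.
rewrite /cst; by field; rewrite n1 c0.
Qed.

Lemma secant_curve : unit_speed_legendre_curve half_turn
  (fun t => row_mx (cnum (z1 b t)) (cnum (z2 b t))).
Proof.
pose z (t : R^o) : cvect R 2 := pair_mx (sin t / ra) (b / ra) (cos (phase t) * cos t / ra) (sin
  (phase t) * cos t / ra).
have -> : (fun t => row_mx (cnum (z1 b t)) (cnum (z2 b t))) = z.
  by apply/funext => t; rewrite z1E z2E pair_mxE.
have oI := open_half_turn; have [ss sc] := smooth_trig.
have [sps spc] := smooth_sincos oI smooth_sec_phase.
have scst (c : R) : smooth half_turn (fun _ : R^o => c) by exact: smooth_cst.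
have s1 : smooth half_turn (fun t : R^o => sin t / ra) by exact: smoothM.
have s2 : smooth half_turn (fun _ : R^o => b / ra) by [].
have s3 : smooth half_turn (fun t : R^o => cos (phase t) * cos t / ra).
  by apply: (smoothM oI) => //; exact: smoothM.
have s4 : smooth half_turn (fun t : R^o => sin (phase t) * cos t / ra).
  by apply: (smoothM oI) => //; exact: smoothM.
have sz : smooth half_turn z by exact: (smooth_pair oI s1 s2 s3 s4).
have r0 := lt0r_neq0 ra_gt0.
have r2 : ra ^+ 2 = 1 + b ^+ 2 by rewrite sqr_sqrtr // ltW // ltr_pwDl // sqr_ge0.
have dz t : half_turn t -> derive1 z t = pair_mx (cos t / ra) 0
    ((- sin (phase t) * b - cos (phase t) * sin t) / ra)
    ((cos (phase t) * b - sin (phase t) * sin t) / ra).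
  move=> It; rewrite derive1E -derE (derive_pair oI s1 s2 s3 s4 1 It).
  have ct := lt0r_neq0 (cos_half_turn It).
  have dc := smooth_differentiable sc It; have ds := smooth_differentiable ss It.
  have dp := smooth_differentiable smooth_sec_phase It.
  have dps := smooth_differentiable sps It; have dpc := smooth_differentiable spc It.
  have dr : differentiable (fun _ : R^o => ra^-1) t by exact: differentiable_cst.
  rewrite d_cst (dM _ ds dr) (dM _ (diffrM dpc dc) dr) (dM _ (diffrM dps dc) dr).
  rewrite (dM _ dpc dc) (dM _ dps dc) d_cst !derive_trig.
  rewrite (d1 (a := phase) _ (is_derive_sin (phase t)) dp) (d1 (a := phase) _ (is_derive_cos (phase
    t)) dp).
  rewrite derive_sec_phase //; move: ct; move: (cos _) (sin _) (cos t) (sin t) => p q c s c0.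
  by congr pair_mx; field; rewrite ?r0 ?c0.
split; first by rewrite -smoothE.
- move=> t It; apply/sphereP; rewrite dot_pair.
  have c1 := cos2Dsin2 t; have c2 := cos2Dsin2 (phase t).
  move: r2 r0 c1 c2; move: ra (cos _) (sin _) (cos t) (sin t) => k p q c s r2 r0 c1 c2.
  apply: (@etrans _ _ ((s ^+ 2 + b ^+ 2 + (p ^+ 2 + q ^+ 2) * c ^+ 2) / k ^+ 2)); first by field.
  by rewrite c2 mul1r r2 addrAC [s ^+ 2 + _]addrC c1 divff // -r2 expf_neq0.
- move=> t It; rewrite dz // /enorm dot_pair.
  have c1 := cos2Dsin2 t; have c2 := cos2Dsin2 (phase t).
  move: r2 r0 c1 c2; move: ra (cos _) (sin _) (cos t) (sin t) => k p q c s r2 r0 c1 c2.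
  rewrite -[RHS]sqrtr1; congr Num.sqrt.
  apply: (@etrans _ _ ((c ^+ 2 + (p ^+ 2 + q ^+ 2) * (b ^+ 2 + s ^+ 2)) / k ^+ 2)); first by field.
  by rewrite c2 mul1r addrCA c1 addrC -r2 divff // expf_neq0.
- move=> t It; rewrite dz // /Defs.eta J_pair dot_pair.
  have c2 := cos2Dsin2 (phase t).
  move: r0 c2; move: ra (cos _) (sin _) (cos t) (sin t) => k p q c s r0 c2.
  apply: (@etrans _ _ (b * c * (1 - (p ^+ 2 + q ^+ 2)) / k ^+ 2)); first by field.
  by rewrite c2 subrr mulr0 mul0r.
Qed.

End SecantCurve.

(** * The Legendre curve of constant curvature [2 k] *)

Section CircleCurve.
Variables (R : realType) (k : R) (k0 : 0 < k).

(* The frequencies of z'' = 2 k i z' - z, i.e. the roots of X^2 - 2 k X - 1. *)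
Definition rate1 : R := k + Num.sqrt (k ^+ 2 + 1).
Definition rate2 : R := k - Num.sqrt (k ^+ 2 + 1).
Local Notation l := rate1.
Local Notation m := rate2.

Lemma rates : [/\ l * m = -1, l + m = 2 * k, 0 < l & 0 < l - m].
Proof.
have h : 0 <= k ^+ 2 + 1 by rewrite addr_ge0 // sqr_ge0.
have s0 : 0 < Num.sqrt (k ^+ 2 + 1) by rewrite sqrtr_gt0 ltr_wpDl // sqr_ge0.
have s2 := sqr_sqrtr h; rewrite /rate1 /rate2; move: s0 s2; move: (Num.sqrt _) => s s0 s2.
by split; [rewrite mulrC -subr_sqr s2; ring|ring|exact: addr_gt0|lra].
Qed.

Local Notation d := (l - m).
(** Real and imaginary parts of the fundamental solutions of [z'' = 2 k i z' - z]: [al] starts at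
    [1] with velocity [0], [be] at [0] with velocity [1]. Moreover [be' = ga] and [al' = - be]. *)
Definition al0 (t : R) : R := (l * cos (m * t) - m * cos (l * t)) / d.
Definition al1 (t : R) : R := (l * sin (m * t) - m * sin (l * t)) / d.
Definition be0 (t : R) : R := (sin (l * t) - sin (m * t)) / d.
Definition be1 (t : R) : R := (cos (m * t) - cos (l * t)) / d.
Definition ga0 (t : R) : R := (l * cos (l * t) - m * cos (m * t)) / d.
Definition ga1 (t : R) : R := (l * sin (l * t) - m * sin (m * t)) / d.

Lemma circle_relation t : al0 t = ga0 t + 2 * k * be1 t /\ al1 t = ga1 t - 2 * k * be0 t.
Proof.
have [_ lm _ _] := rates; rewrite -lm /al0 /al1 /be0 /be1 /ga0 /ga1.
move: (l) (m) d^-1 (cos _) (cos _) (sin _) (sin _) => *; split; ring.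
Qed.

Lemma circle_at0 : [/\ al0 0 = 1, al1 0 = 0, be0 0 = 0 & be1 0 = 0] /\ ga0 0 = 1 /\ ga1 0 = 0.
Proof.
have [_ _ _ /lt0r_neq0 d0] := rates.
rewrite /al0 /al1 /be0 /be1 /ga0 /ga1 !mulr0 cos0 sin0 !mulr1 !mulr0 !subr0 !subrr !mul0r.
by rewrite mulfV.
Qed.

(** The three identities are the unit length, the unit speed and the Legendre condition of the curve
    [(al, be)]; they rest on the product [l m = -1] of the frequencies. *)
Lemma circle_table t :
  [/\ al0 t ^+ 2 + al1 t ^+ 2 + (be0 t ^+ 2 + be1 t ^+ 2) = 1,
      be0 t ^+ 2 + be1 t ^+ 2 + (ga0 t ^+ 2 + ga1 t ^+ 2) = 1 &
      be1 t * al0 t - be0 t * al1 t + (ga0 t * be1 t - ga1 t * be0 t) = 0].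
Proof.
have [lm _ _ /lt0r_neq0 d0] := rates.
have c1 := cos2Dsin2 (l * t); have c2 := cos2Dsin2 (m * t).
rewrite /al0 /al1 /be0 /be1 /ga0 /ga1.
move: lm d0 c1 c2; move: (cos (m * t)) (sin (m * t)) (cos (l * t)) (sin (l * t)).
move: (l) (m) => a b p q c s ab d0 c1 c2.
have dd : (a - b) ^+ 2 = a ^+ 2 + b ^+ 2 + 2 by rewrite sqrrB ab; ring.
split.
- apply: (@etrans _ _ ((a ^+ 2 * (p ^+ 2 + q ^+ 2) + b ^+ 2 * (c ^+ 2 + s ^+ 2) +
    (c ^+ 2 + s ^+ 2) + (p ^+ 2 + q ^+ 2) - 2 * (a * b + 1) * (c * p + s * q)) / (a - b) ^+ 2)).
    by field.
  by rewrite c1 c2 ab addNr mulr0 mul0r subr0 !mulr1 -addrA -dd divff // expf_neq0.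
- apply: (@etrans _ _ ((a ^+ 2 * (c ^+ 2 + s ^+ 2) + b ^+ 2 * (p ^+ 2 + q ^+ 2) +
    (c ^+ 2 + s ^+ 2) + (p ^+ 2 + q ^+ 2) - 2 * (a * b + 1) * (c * p + s * q)) / (a - b) ^+ 2)).
    by field.
  by rewrite c1 c2 ab addNr mulr0 mul0r subr0 !mulr1 -addrA -dd divff // expf_neq0.
- apply: (@etrans _ _ (((a - b) * (p ^+ 2 + q ^+ 2 - (c ^+ 2 + s ^+ 2))) / (a - b) ^+ 2)).
    by field.
  by rewrite c1 c2 subrr mulr0 mul0r.
Qed.

Section CircleCalculus.
Variables (V : normedModType R) (U : set V) (oU : open U) (y : V -> R) (sy : smooth U y).

Let sly : smooth U (fun x => l * y x).
Proof. by apply: (smoothM oU) => //; exact: smooth_cst. Qed.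
Let smy : smooth U (fun x => m * y x).
Proof. by apply: (smoothM oU) => //; exact: smooth_cst. Qed.
Let scst (c : R) : smooth U (fun=> c). Proof. exact: smooth_cst. Qed.

Lemma smooth_circle : [/\ smooth U (fun x => al0 (y x)), smooth U (fun x => al1 (y x)),
  smooth U (fun x => be0 (y x)) & smooth U (fun x => be1 (y x))] /\
  smooth U (fun x => ga0 (y x)) /\ smooth U (fun x => ga1 (y x)).
Proof.
have [a1 a2] := smooth_sincos oU sly; have [b1 b2] := smooth_sincos oU smy.
do ![split]; apply: (smoothM oU) => //; apply: (smoothB oU) => //; exact: (smoothM oU).
Qed.

Lemma derive_circle v x : U x ->
  [/\ 'D_v (fun x => al0 (y x)) x = - ('D_v y x * be0 (y x)),
      'D_v (fun x => al1 (y x)) x = - ('D_v y x * be1 (y x)),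
      'D_v (fun x => be0 (y x)) x = 'D_v y x * ga0 (y x) &
      'D_v (fun x => be1 (y x)) x = 'D_v y x * ga1 (y x)] /\
  'D_v (fun x => ga0 (y x)) x = - ('D_v y x * (2 * k * ga1 (y x) + be0 (y x))) /\
  'D_v (fun x => ga1 (y x)) x = 'D_v y x * (2 * k * ga0 (y x) - be1 (y x)).
Proof.
move=> Ux; have dy := smooth_differentiable sy Ux.
have dc (c : R) : differentiable (fun _ : V => c) x by exact: differentiable_cst.
have dl := diffrM (dc l) dy; have dm := diffrM (dc m) dy.
have dsl := diffr1 (a := fun x => l * y x) (is_derive_sin (l * y x)) dl;
  have dcl := diffr1 (a := fun x => l * y x) (is_derive_cos (l * y x)) dl.
have dsm := diffr1 (a := fun x => m * y x) (is_derive_sin (m * y x)) dm;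
  have dcm := diffr1 (a := fun x => m * y x) (is_derive_cos (m * y x)) dm.
have El : 'D_v (fun x => l * y x) x = l * 'D_v y x by rewrite (dM v (dc l) dy) d_cst mul0r add0r.
have Em : 'D_v (fun x => m * y x) x = m * 'D_v y x by rewrite (dM v (dc m) dy) d_cst mul0r add0r.
have Esl := d1 (a := fun x => l * y x) v (is_derive_sin (l * y x)) dl;
  have Ecl := d1 (a := fun x => l * y x) v (is_derive_cos (l * y x)) dl.
have Esm := d1 (a := fun x => m * y x) v (is_derive_sin (m * y x)) dm;
  have Ecm := d1 (a := fun x => m * y x) v (is_derive_cos (m * y x)) dm.
rewrite El in Esl Ecl; rewrite Em in Esm Ecm.
have [lm lpm _ /lt0r_neq0 d0] := rates.
have root (a b : R) : a * b = -1 -> a + b = 2 * k -> a * a = 2 * k * a + 1.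
  by move=> ab <-; rewrite -[X in _ + X]opprK -ab; ring.
have l2 : l * l = 2 * k * l + 1 by exact: root lm lpm.
have m2 : m * m = 2 * k * m + 1 by apply: (root m l); [rewrite mulrC|rewrite addrC].
rewrite /al0 /al1 /be0 /be1 /ga0 /ga1.
have lc := diffrM (dc l) dcm; have ls := diffrM (dc l) dsm.
have mc := diffrM (dc m) dcl; have ms := diffrM (dc m) dsl.
have lc' := diffrM (dc l) dcl; have ls' := diffrM (dc l) dsl.
have mc' := diffrM (dc m) dcm; have ms' := diffrM (dc m) dsm.
rewrite (dM v (diffrB lc mc) (dc _)) (dM v (diffrB ls ms) (dc _)) (dM v (diffrB dsl dsm) (dc _)).
rewrite (dM v (diffrB dcm dcl) (dc _)) (dM v (diffrB lc' mc') (dc _)) (dM v (diffrB ls' ms') (dc _)).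
rewrite (dB v lc mc) (dB v ls ms) (dB v dsl dsm) (dB v dcm dcl) (dB v lc' mc') (dB v ls' ms').
rewrite (dM v (dc l) dcm) (dM v (dc m) dcl) (dM v (dc l) dsm) (dM v (dc m) dsl).
rewrite (dM v (dc l) dcl) (dM v (dc m) dcm) (dM v (dc l) dsl) (dM v (dc m) dsm).
rewrite !d_cst Esl Ecl Esm Ecm.
move: lm l2 m2; move: d^-1 (cos (l * y x)) (sin (l * y x)) (cos (m * y x)) (sin (m * y x)) ('D_v y x).
move: (l) (m) => a b i p q c s e ab a2 b2.
have i1 (t : R) : a * (b * t) = - t by rewrite mulrA ab mulN1r.
have i2 (t : R) : b * (a * t) = - t by rewrite mulrA [b * a]mulrC ab mulN1r.
have i3 (t : R) : a * (a * t) = 2 * k * a * t + t by rewrite mulrA a2; ring.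
have i4 (t : R) : b * (b * t) = 2 * k * b * t + t by rewrite mulrA b2; ring.
do ![split]; rewrite -?mulrA ?(i1, i2, i3, i4); ring.
Qed.

End CircleCalculus.

Definition circle_curve (t : R) : cvect R 2 := pair_mx (al0 t) (al1 t) (be0 t) (be1 t).

Lemma circle_curve_legendre : unit_speed_legendre_curve setT circle_curve /\
  forall t, geodesic_curvature circle_curve t = 2 * k.
Proof.
have oT : open (setT : set R^o) by exact: openT.
have sid := smooth_id oT.
have [[sa0 sa1 sb0 sb1] [sg0 sg1]] := smooth_circle oT sid.
have D := derive_circle sid.
have dz : derive1 circle_curve = fun t => pair_mx (- be0 t) (- be1 t) (ga0 t) (ga1 t).
  apply/funext => t; rewrite derive1E -derE (derive_pair oT sa0 sa1 sb0 sb1 _ (I : setT t)).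
  by have [[-> -> -> ->] _] := D 1 t I; rewrite d_id !mul1r.
have dz2 t : derive1 (derive1 circle_curve) t =
    pair_mx (- ga0 t) (- ga1 t) (- (2 * k * ga1 t + be0 t)) (2 * k * ga0 t - be1 t).
  rewrite dz derive1E -derE (derive_pair oT (smoothN oT sb0) (smoothN oT sb1) sg0 sg1 _ (I : setT t)).
  rewrite !dN; [|exact: smooth_differentiable sb1 I|exact: smooth_differentiable sb0 I].
  by have [[_ _ -> ->] [-> ->]] := D 1 t I; rewrite d_id !mul1r.
have u1 t : dot (derive1 circle_curve t) (derive1 circle_curve t) = 1.
  by rewrite dz dot_pair !mulrNN -!expr2; have [_] := circle_table t.
have z1 t : dot (circle_curve t) (circle_curve t) = 1.
  by rewrite dot_pair -!expr2; have [] := circle_table t.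
have e0 t : dot (J (derive1 circle_curve t)) (circle_curve t) = 0.
  by rewrite dz J_pair dot_pair opprK !mulNr; have [_ _ <-] := circle_table t; ring.
split.
  split; first by rewrite -smoothE; exact: (smooth_pair oT sa0 sa1 sb0 sb1).
  - by move=> t _; apply/sphereP.
  - by move=> t _; rewrite /enorm u1 sqrtr1.
  - by move=> t _; exact: e0.
move=> t; rewrite /geodesic_curvature.
have E : derive1 (derive1 circle_curve) t =
    (2 * k) *: J (derive1 circle_curve t) - circle_curve t.
  rewrite dz2 dz J_pair scale_pair sub_pair; have [r1 r2] := circle_relation t.
  by rewrite r1 r2; congr pair_mx; ring.
rewrite E dotBl dotZl e0 mulr0 z1 sub0r scaleNr scale1r opprK subrK.
rewrite /enorm dotZl dotZr dotJJ u1 mulr1 -expr2 sqrtr_sqr ger0_norm //.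
by rewrite mulr_ge0 // ltW.
Qed.

End CircleCurve.

(** * Integration of the structure equations in case (ii) *)

Section LatitudeModel.
Variables (R : realType).
Local Notation V := 'rV[R]_2.
Variables (U : set V) (oU : open U) (F : V -> cvect R 3) (e1 e2 : V -> V) (w : V -> R) (k : R).
Hypotheses (sF : smooth U F) (s1 : smooth U e1) (s2 : smooth U e2) (sw : smooth U w) (k0 : 0 < k).
Local Notation D1 := (along e1).
Local Notation D2 := (along e2).
Local Notation E1 := (along e1 F).
Local Notation E2 := (along e2 F).
Local Notation sq := (slope w).
Hypotheses (span : forall x v, U x -> exists p q, v = p *: e1 x + q *: e2 x)
  (u3 : forall x, U x -> unitary3 (F x) (E1 x) (E2 x))
  (D11 : forall x, U x -> D1 E1 x = w x *: E2 x + (2 * (k * sq x)) *: J (E1 x) - F x)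
  (D12 : forall x, U x -> D1 E2 x = - w x *: E1 x)
  (D21 : forall x, U x -> D2 E1 x = 0)
  (D22 : forall x, U x -> D2 E2 x = - F x)
  (D1w : forall x, U x -> D1 w x = 0) (D2w : forall x, U x -> D2 w x = 1 + w x ^+ 2).

Let ssq : smooth U sq := smooth_slope oU sw.
Let sq0 x : 0 < sq x := slope_gt0 w x.
Let D1sq x : U x -> D1 sq x = 0.
Proof. by move=> Ux; rewrite (along_slope (k := 0) sw Ux) ?D1w ?slope_sqr //; ring. Qed.
Let D2sq x : U x -> D2 sq x = w x * sq x.
Proof. by move=> Ux; rewrite (along_slope (k := 1) sw Ux) ?D2w ?slope_sqr //; ring. Qed.

Definition latitude y : R := atan (w y).

Lemma smooth_latitude : smooth U latitude.
Proof. exact: (smooth_atan oU). Qed.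

Lemma latitude_trig y : cos (latitude y) = (sq y)^-1 /\ sin (latitude y) = w y * (sq y)^-1.
Proof.
have ca : cos (latitude y) = (sq y)^-1 by rewrite cos_atan.
split => //; have := atanK (w y); rewrite /tan -/(latitude y) ca => <-.
by rewrite invrK -mulrA mulfV ?mulr1 // gt_eqF.
Qed.

Lemma along_latitude x : U x -> D1 latitude x = 0 /\ D2 latitude x = 1.
Proof.
move=> Ux; have dw := smooth_differentiable sw Ux.
rewrite !(along_fun _ (is_derive1_atan (w x)) dw) ?D1w ?D2w // mul0r.
by rewrite mulfV // gt_eqF // ltr_pwDl // sqr_ge0.
Qed.

(** With [w = tan x], the model has [F = cos x z + sin x pole] and [E2 = - sin x z + cos x pole].
    Inverting this rotation gives the constant vector [pole] and the curve [z] as [equator]. *)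
Definition pole y : cvect R 3 := (w y * (sq y)^-1) *: F y + (sq y)^-1 *: E2 y.
Definition equator y : cvect R 3 := (sq y)^-1 *: F y - (w y * (sq y)^-1) *: E2 y.

Let dF x (Ux : U x) := smooth_differentiable sF Ux.
Let sE1 : smooth U E1 := smooth_along_mx oU sF s1.
Let sE2 : smooth U E2 := smooth_along_mx oU sF s2.
Let sqV : smooth U (fun y => (sq y)^-1).
Proof. by apply: (smoothV oU) => // y _; rewrite gt_eqF. Qed.

Let along_sqV x : U x -> D1 (fun y => (sq y)^-1) x = 0 /\ D2 (fun y => (sq y)^-1) x = - w x * (sq x)^-1.
Proof.
move=> Ux; have n0 := lt0r_neq0 (sq0 x); have ds := smooth_differentiable ssq Ux.
rewrite !(alongV _ n0 ds) D1sq // D2sq //; split; first by rewrite mul0r oppr0.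
by field.
Qed.

Lemma smooth_equator : smooth U equator.
Proof. by apply: (smoothB oU); apply: (smoothZ oU) => //; exact: (smoothM oU). Qed.

Lemma smooth_pole : smooth U pole.
Proof. by apply: (smoothD oU); apply: (smoothZ oU) => //; exact: (smoothM oU). Qed.

Lemma along_pole_equator x : U x -> [/\ D1 pole x = 0, D2 pole x = 0,
  D1 equator x = sq x *: E1 x, D2 equator x = 0 &
  D1 E1 x = sq x *: (2 * k *: J (E1 x) - equator x)].
Proof.
move=> Ux; have dw := smooth_differentiable sw Ux; have ds := smooth_differentiable sqV Ux.
have df := dF Ux; have d2 := smooth_differentiable sE2 Ux.
have n0 := lt0r_neq0 (sq0 x); have [k1 k2] := along_sqV Ux.
have ss : w x * w x = sq x * sq x - 1 by have := slope_sqr w x; rewrite !expr2; lra.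
rewrite /pole /equator; split; last first.
- rewrite D11 //; move: n0; move: (F x) (E1 x) (J (E1 x)) (E2 x) (w x) (sq x) => f g jg h t s n0.
  by apply/matrixP => i j; rewrite !mxE; field.
all: valong_auto; rewrite ?k1 ?k2 ?D1w ?D2w ?D12 ?D22 //; move: ss n0;
  move: (F x) (E1 x) (E2 x) (w x) (sq x) => f g h t s ss n0.
- by apply/matrixP => i j; rewrite !mxE; field.
- apply/matrixP => i j; rewrite !mxE; apply/eqP; rewrite -subr_eq0; apply/eqP.
  apply: (@etrans _ _ ((t * t - (s * s - 1)) / s * g i j)); first by field.
  by rewrite ss subrr !mul0r.
- by apply/matrixP => i j; rewrite !mxE; field.
- by apply/matrixP => i j; rewrite !mxE; field.
Qed.

Lemma latitude_position x : F x = (sq x)^-1 *: equator x + (w x * (sq x)^-1) *: pole x.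
Proof.
have n0 := lt0r_neq0 (sq0 x).
have i2 : (sq x)^-1 * (sq x)^-1 * (1 + w x ^+ 2) = 1 by rewrite -slope_sqr; field.
rewrite /equator /pole; move: i2; move: (sq x)^-1 (w x) (F x) (E2 x) => s t f g i2.
by apply/matrixP => i j; rewrite !mxE -[LHS]mul1r -i2; ring.
Qed.

Lemma latitude_unitary x : U x -> unitary3 (equator x) (E1 x) (pole x).
Proof.
move=> Ux; have T := unitary3_table (u3 Ux).
have n0 := lt0r_neq0 (sq0 x).
have i2 : (sq x)^-1 * (sq x)^-1 * (1 + w x ^+ 2) = 1 by rewrite -slope_sqr; field.
rewrite /equator /pole /unitary3 ?(dotlin, JD, JZ, JN, JB, JK).
rewrite ?(dotJJ, dot0J, dotJ0, T).
move: i2; move: (w x) (sq x)^-1 => t s i2.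
by do ![split]; try ring; rewrite -[RHS]i2; ring.
Qed.

Local Notation l := (rate1 k).
Local Notation m := (rate2 k).

(* In the parameter y, [E1 - m J equator] rotates at the constant rate l;
   its angle provides y. *)
Lemma latitude_integrate x0 : U x0 -> exists e y, [/\ 0 < e, ball x0 e `<=` U, smooth (ball x0 e) y,
  forall x, ball x0 e x -> D1 y x = sq x /\ D2 y x = 0 &
  forall x, ball x0 e x -> pole x = pole x0 /\
    equator x = rot (al0 k (y x)) (al1 k (y x)) (equator x0)
                + rot (be0 k (y x)) (be1 k (y x)) (E1 x0)].
Proof.
move=> Ux0; have [lm lpm l0 _] := rates k0.
have [[zz uu _] [[zu _ _] [zJu _ _]]] := latitude_unitary Ux0.
have [z0 z0E] : exists v, v = equator x0 by exists (equator x0).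
have [u0 u0E] : exists v, v = E1 x0 by exists (E1 x0).
have [z zE] : exists z : V -> cvect R 3, z = equator by exists equator.
have [u uE] : exists z : V -> cvect R 3, z = E1 by exists E1.
have sz : smooth U z by rewrite zE; exact: smooth_equator.
have su : smooth U u by rewrite uE.
rewrite -z0E -u0E in zz uu zu zJu; rewrite -z0E -u0E.
have z0E' : z x0 = z0 by rewrite z0E zE.
have u0E' : u x0 = u0 by rewrite u0E uE.
have D1z x : U x -> D1 z x = sq x *: u x /\ D1 u x = sq x *: (2 * k *: J (u x) - z x).
  by move=> Ux; rewrite zE uE; have [_ _ -> _ ->] := along_pole_equator Ux.
have D2z x : U x -> D2 z x = 0 /\ D2 u x = 0.
  by move=> Ux; rewrite zE uE D21 //; have [_ _ _ -> _] := along_pole_equator Ux.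
have scst (T : set V) (v : cvect R 3) : open T -> smooth T (fun=> v) by move=> oT; exact: smooth_cst.
pose g x := u x - m *: J (z x).
have sg : smooth U g.
  apply: (smoothB oU) => //; apply: (smoothZ oU); first exact: smooth_cst.
  exact: (smooth_J oU).
have sJg : smooth U (fun x => J (g x)) by exact: (smooth_J oU).
have Dg d x : U x -> along d g x = along d u x - m *: J (along d z x).
  move=> Ux; have dz := smooth_differentiable sz Ux; have du := smooth_differentiable su Ux.
  by rewrite /g; valong_auto; rewrite scale0r add0r.
have dg x (Ux : U x) := smooth_differentiable sg Ux.
have m2 : m * m = 2 * k * m + 1.
  by rewrite -lpm -[X in _ + X]opprK -lm; ring.
have D1g x : U x -> D1 g x = (l * sq x) *: J (g x).
  move=> Ux; rewrite Dg //; have [-> ->] := D1z x Ux; rewrite /g JB !JZ JK.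
  move: (u x) (J (u x)) (z x) (sq x) => a ja c s.
  apply/matrixP => i j; rewrite !mxE -lpm.
  rewrite -[X in _ = X](@addrK _ (- (1 + l * m) * s * c i j)) lm addrN oppr0 !mul0r subr0.
  apply: (@etrans _ _ (s * (l * ja i j + (l * m) * c i j))); last by ring.
  by rewrite lm; ring.
have D2g x : U x -> D2 g x = 0.
  by move=> Ux; rewrite Dg //; have [-> ->] := D2z x Ux; rewrite -(scale0r 0) JZ !scale0r scaler0 subr0.
pose a x := dot (g x) (u0 - m *: J z0); pose a' x := dot (J (g x)) (u0 - m *: J z0).
have sa : smooth U a by exact: (smooth_dot oU sg (scst _ _ oU)).
have sa' : smooth U a' by exact: (smooth_dot oU sJg (scst _ _ oU)).
have da v (d : V -> V) x : smooth U v -> U x ->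
    along d (fun y => dot (v y) (u0 - m *: J z0)) x = dot (along d v x) (u0 - m *: J z0).
  move=> sv Ux; rewrite along_dot; last exact: differentiable_cst.
    by rewrite along_cst dot0r addr0.
  exact: smooth_differentiable sv Ux.
have h1 x : U x -> D1 a x = (l * sq x) * a' x /\ D1 a' x = - (l * sq x) * a x.
  move=> Ux; rewrite !da // (along_J _ (dg x Ux)) D1g // JZ JK; split; first by rewrite dotZl.
  by rewrite dotZl dotNl mulrN mulNr.
have h2 x : U x -> D2 a x = 0 /\ D2 a' x = 0.
  by move=> Ux; rewrite !da // (along_J _ (dg x Ux)) D2g // -(scale0r 0) JZ !scale0r dot0l.
have gg : g x0 = u0 - m *: J z0 by rewrite /g z0E' u0E'.
have ax0 : 0 < a x0.
  rewrite /a gg dotBl !dotBr !dotZl !dotZr dotJJ zz uu (dotC u0) dotJl zJu.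
  by rewrite oppr0 !mulr0 subr0 sub0r opprK mulr1 ltr_pwDl // -expr2 sqr_ge0.
have a'x0 : a' x0 = 0 by rewrite /a' gg dotJ0.
have [e [y' [e0 eU sy' y'0 Dy']]] := phase oU Ux0 sa sa' h1 h2 ax0 a'x0.
have oB : open (ball x0 e) by exact: ball_open.
pose y x := l^-1 * y' x.
have sy : smooth (ball x0 e) y by apply: (smoothM oB) => //; exact: smooth_cst.
have y0 : y x0 = 0 by rewrite /y y'0 mulr0.
have ln0 := lt0r_neq0 l0.
have Dy x : ball x0 e x -> D1 y x = sq x /\ D2 y x = 0.
  move=> xe; have dy := smooth_differentiable sy' xe.
  rewrite /y !(alongM _ (differentiable_cst l^-1 x) dy) !along_cst !mul0r !add0r /cst.
  by have [-> ->] := Dy' x xe; rewrite mulr0 mulrA mulVf ?mul1r.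
exists e, y; split => // x xe; split.
  apply: (frame_constant_mx span eU) xe => [t Ut|t te].
    exact: smooth_differentiable smooth_pole Ut.
  by have [-> -> _ _ _] := along_pole_equator (eU t te).
have [[sa0 sa1 sb0 sb1] [sg0 sg1]] := smooth_circle k oB sy.
(* [dl] and [up] are the deviations of [equator] and [E1] from the explicit solution with the same
   values at [x0]; they satisfy the homogeneous system of [energy] with [kap = 2 k] and therefore
   vanish. *)
pose dl x := z x - (rot (al0 k (y x)) (al1 k (y x)) z0 + rot (be0 k (y x)) (be1 k (y x)) u0).
pose up x := u x - (rot (- be0 k (y x)) (- be1 k (y x)) z0 + rot (ga0 k (y x)) (ga1 k (y x)) u0).
have srot p q v : smooth (ball x0 e) p -> smooth (ball x0 e) q ->
    smooth (ball x0 e) (fun y => rot (p y) (q y) (v : cvect R 3)).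
  by move=> sp sq'; exact: (smooth_rot oB sp sq' (scst _ v oB)).
have drot p q v d t : smooth (ball x0 e) p -> smooth (ball x0 e) q -> ball x0 e t ->
    along d (fun y => rot (p y) (q y) (v : cvect R 3)) t = rot (along d p t) (along d q t) v.
  move=> sp sq' te; have dp := smooth_differentiable sp te; have dq := smooth_differentiable sq' te.
  by rewrite /rot; valong_auto; rewrite !scaler0 !addr0.
have sdl : smooth (ball x0 e) dl.
  apply: (smoothB oB); first exact: smooth_onS sz.
  by apply: (smoothD oB); exact: srot.
have sup : smooth (ball x0 e) up.
  apply: (smoothB oB); first exact: smooth_onS su.
  by apply: (smoothD oB); apply: srot => //; exact: (smoothN oB).
have Ddl d t : ball x0 e t -> along d dl t = along d z t - along d y t *:
    (rot (- be0 k (y t)) (- be1 k (y t)) z0 + rot (ga0 k (y t)) (ga1 k (y t)) u0).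
  move=> te; have dz := smooth_differentiable sz (eU t te).
  have df1 := smooth_differentiable (srot _ _ z0 sa0 sa1) te.
  have df2 := smooth_differentiable (srot _ _ u0 sb0 sb1) te.
  rewrite /dl (alongB _ dz (diffrD df1 df2)) (alongD _ df1 df2) !drot //.
  have [[h11 h12 h13 h14] _] := derive_circle k0 sy (d t) te; rewrite !alongE in h11 h12 h13 h14.
  rewrite h11 h12 h13 h14 /rot; move: (J z0) (J u0) => jz ju.
  by congr (_ - _); apply/matrixP => i j; rewrite !mxE; ring.
have Dup d t : ball x0 e t -> along d up t = along d u t - along d y t *:
    (rot (- ga0 k (y t)) (- ga1 k (y t)) z0 +
     rot (- (2 * k * ga1 k (y t) + be0 k (y t))) (2 * k * ga0 k (y t) - be1 k (y t)) u0).
  move=> te; have du := smooth_differentiable su (eU t te).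
  have df1 := smooth_differentiable (srot _ _ z0 (smoothN oB sb0) (smoothN oB sb1)) te.
  have df2 := smooth_differentiable (srot _ _ u0 sg0 sg1) te.
  have db0 := smooth_differentiable sb0 te; have db1 := smooth_differentiable sb1 te.
  rewrite /up (alongB _ du (diffrD df1 df2)) (alongD _ df1 df2) !drot //; try exact: (smoothN oB).
  rewrite (alongN _ db0) (alongN _ db1).
  have [[_ _ h13 h14] [h15 h16]] := derive_circle k0 sy (d t) te; rewrite !alongE in h13 h14 h15 h16.
  rewrite h13 h14 h15 h16 /rot; move: (J z0) (J u0) => jz ju.
  by congr (_ - _); apply/matrixP => i j; rewrite !mxE; ring.
have [[i1 i2 i3 i4] [i5 i6]] := circle_at0 k0.
have [] := energy (kap := 2 * k) (rho := sq) span eU sdl sup _ _ _ _ xe.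
- move=> t te; rewrite Ddl // Dup //; have [-> _] := Dy t te.
  have [-> ->] := D1z t (eU t te); have [r1 r2] := circle_relation k0 (y t); rewrite /dl /up r1 r2 /rot.
  rewrite JB !JD !JZ !JK.
  move: (z t) (u t) (J (u t)) (J z0) (J u0) => zt ut jut jz ju.
  by split; apply/matrixP => i j; rewrite !mxE; ring.
- move=> t te; rewrite Ddl // Dup //; have [_ ->] := Dy t te.
  by have [-> ->] := D2z t (eU t te); rewrite !scale0r subr0.
- by rewrite /dl y0 z0E' i1 i2 i3 i4 /rot !scale0r scale1r !addr0 subrr.
- by rewrite /up y0 u0E' i5 i6 i3 i4 /rot oppr0 !scale0r scale1r !addr0 add0r subrr.
by move=> /eqP; rewrite subr_eq0 zE => /eqP.
Qed.

End LatitudeModel.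

(** Packages two coordinate functions with their dual fields in the form that [inverse_function]
    takes. *)
Lemma planar_coordinates (R : realType) (U : set 'rV[R]_2) (oU : open U)
    (p q : 'rV[R]_2 -> R) (X Y : 'rV[R]_2 -> 'rV[R]_2) :
  smooth U p -> smooth U q -> smooth U X -> smooth U Y ->
  (forall x, U x -> along X p x = 1 /\ along X q x = 0) ->
  (forall x, U x -> along Y p x = 0 /\ along Y q x = 1) ->
  exists (tau : 'rV[R]_2 -> 'rV[R]_2) (Z : 'I_2 -> 'rV[R]_2 -> 'rV[R]_2), [/\ smooth U tau, forall
    i, smooth U (Z i),
    forall i x, U x -> 'D_(Z i x) tau x = delta_mx 0 i &
    forall x, tau x 0 0 = p x /\ tau x 0 1 = q x].
Proof.
move=> sp sq sX sY hX hY; pose g (i : 'I_2) := if i == 0 then p else q.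
have sg i : smooth U (g i) by rewrite /g; case: ifP.
pose tau x : 'rV[R]_2 := \row_i g i x.
have st : smooth U tau.
  apply: (smooth_mx oU) => i j.
  have -> : (fun x => tau x i j) = g j by apply/funext => x; rewrite mxE.
  exact: sg.
exists tau, (fun i => if i == 0 then X else Y); split => //; first by move=> i; case: ifP.
- move=> i x Ux; have dt := smooth_differentiable st Ux.
  have [hX1 hX2] := hX x Ux; have [hY1 hY2] := hY x Ux.
  apply/rowP => j; rewrite -d_coord //.
  have -> : (fun x => tau x 0 j) = g j by apply/funext => z; rewrite mxE.
  by rewrite mxE /= /g; case: i j => -[|[|[]]] // ? [] [|[|[]]] //= ?.
- by move=> x; rewrite !mxE.
Qed.

Section CoordinateVectors.
Variable R : realType.

Lemma ord3P (P : 'I_3 -> Prop) : P 0 -> P 1 -> P 2%:R -> forall j, P j.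
Proof.
move=> P0 P1 P2 [] [|[|[|//]]] Hj; [move: P0|move: P1|move: P2]; congr P; exact: val_inj.
Qed.

Lemma ord2P (P : 'I_2 -> Prop) : P 0 -> P 1 -> forall j, P j.
Proof.
by move=> P0 P1 [] [|[|//]] Hj; [move: P0|move: P1]; congr P; exact: val_inj.
Qed.

Lemma row_mx21P (u : cvect R 3) (v : cvect R 2) (c : R[i]) :
  (forall k, u k 0 = v k 0) -> (forall k, u k 1 = v k 1) ->
  u 0 2%:R = complex.Re c -> u 1 2%:R = complex.Im c -> u = row_mx v (cnum c).
Proof.
move=> h0 h1 h2 h3; apply/matrixP => k; apply: ord3P.
- rewrite h0 (_ : (0 : 'I_3) = lshift 1 (0 : 'I_2)); last exact: val_inj.
  exact: (esym (row_mxEl v (cnum c) k 0)).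
- rewrite h1 (_ : (1 : 'I_3) = lshift 1 (1 : 'I_2)); last exact: val_inj.
  exact: (esym (row_mxEl v (cnum c) k 1)).
- rewrite [in RHS](_ : (2%:R : 'I_3) = rshift 2 (0 : 'I_1)); last exact: val_inj.
  apply: etrans (esym (row_mxEr v (cnum c) k 0)).
  by rewrite mxE; move: k; apply: ord2P.
Qed.

Lemma row_mx111P (u : cvect R 3) (a b c : R[i]) :
  u 0 0 = complex.Re a -> u 1 0 = complex.Im a -> u 0 1 = complex.Re b -> u 1 1 = complex.Im b ->
  u 0 2%:R = complex.Re c -> u 1 2%:R = complex.Im c ->
  u = row_mx (cnum a) (row_mx (cnum b) (cnum c)).
Proof.
move=> h1 h2 h3 h4 h5 h6; apply/matrixP => k; apply: ord3P.
- rewrite [in RHS](_ : (0 : 'I_3) = lshift 2 (0 : 'I_1)); last exact: val_inj.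
  apply: etrans (esym (row_mxEl (cnum a) (row_mx (cnum b) (cnum c)) k 0)).
  by rewrite mxE; move: k; apply: ord2P.
- rewrite [in RHS](_ : (1 : 'I_3) = rshift 1 (lshift 1 (0 : 'I_1))); last exact: val_inj.
  apply: etrans (esym (row_mxEr (cnum a) (row_mx (cnum b) (cnum c)) k _)).
  by rewrite row_mxEl mxE; move: k; apply: ord2P.
- rewrite [in RHS](_ : (2%:R : 'I_3) = rshift 1 (rshift 1 (0 : 'I_1))); last exact: val_inj.
  apply: etrans (esym (row_mxEr (cnum a) (row_mx (cnum b) (cnum c)) k _)).
  by rewrite row_mxEr mxE; move: k; apply: ord2P.
Qed.

End CoordinateVectors.

Lemma unitary_coord_sum (R : realType) (a b c : cvect R 3) (abc : unitary3 a b c)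
    (p0 p1 q0 q1 r0 r1 : R) :
  let v := rot p0 p1 a + rot q0 q1 b + rot r0 r1 c in
  [/\ unitary_coord a b c v 0 0 = p0, unitary_coord a b c v 1 0 = p1,
      unitary_coord a b c v 0 1 = q0, unitary_coord a b c v 1 1 = q1 &
      unitary_coord a b c v 0 2%:R = r0 /\ unitary_coord a b c v 1 2%:R = r1].
Proof.
have T := unitary3_table abc; move=> v.
do ![split]; rewrite ?unitary_coord0 ?unitary_coord1 /unitary_triple /= /v /rot !dotlin;
  rewrite ?(dotJJ, dot0J, dotJ0, T); ring.
Qed.

(** * Local normal forms near a point with [H] nonzero *)

Section LocalForms.
Variables (R : realType).
Local Notation V := 'rV[R]_2.
Variables (U : set V) (F : V -> cvect R 3).
Hypotheses (leg : legendre_on U F) (harm : harmonic_on U F).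
Local Notation W := (nonminimal_set U F).
Local Notation e1 := (adapted1 F).
Local Notation e2 := (adapted2 F).
Local Notation r := (mean_curvature F).

(** The constant of the local form originates here: [b] is the square root of the first integral
    [r^2 / (1 + w^2)] on a ball. *)
Lemma ratio_ball (w : V -> R) x0 : W x0 -> smooth W w ->
  (forall x, W x ->
    along e1 (fun y => r y ^+ 2 / (1 + w y ^+ 2)) x = 0 /\
    along e2 (fun y => r y ^+ 2 / (1 + w y ^+ 2)) x = 0) ->
  exists b e, [/\ 0 < b, 0 < e, ball x0 e `<=` W & forall x, ball x0 e x -> r x = b * slope w x].
Proof.
move=> Wx0 sw d0; have oW := open_nonminimal_set leg.
have sr : smooth W r := smooth_mean_curvature_norm leg.
have : nbhs x0 W by exact: open_nbhs_nbhs.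
move=> /nbhs_ballP[e /= e0 eW].
pose k2 y := r y ^+ 2 / (1 + w y ^+ 2).
have w0 y : 0 < 1 + w y ^+ 2 := slope_arg_gt0 w y.
have dk y : W y -> differentiable k2 y.
  move=> Wy; have dr := smooth_differentiable sr Wy; have dw := smooth_differentiable sw Wy.
  apply: diffrM; first exact: diffrM.
  apply: diffrV; first by rewrite gt_eqF.
  by apply: diffrD; [exact: differentiable_cst|exact: diffrM].
have kc x : ball x0 e x -> k2 x = k2 x0.
  apply: (frame_constant (fun x v => @adapted_span _ _ _ leg x v) eW dk) => z /eW; exact: d0.
have k0 : 0 < k2 x0 by rewrite divr_gt0 // exprn_gt0 // (mean_curvature_gt0 Wx0).
exists (Num.sqrt (k2 x0)), e; split => //; first by rewrite sqrtr_gt0.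
move=> x xe; rewrite -(kc x xe) /slope -sqrtrM; last by rewrite divr_ge0 ?sqr_ge0 // ltW.
rewrite divfK ?gt_eqF // sqrtr_sqr gtr0_norm //; exact: mean_curvature_gt0 (eW x xe).
Qed.

Lemma phiH_perp_local_form x0 : W x0 -> (forall x, W x -> w1 F e1 e2 x = 0) ->
  exists (b : R) (B : set V) (tau : V -> V) (Z : 'I_2 -> V -> V) (A : cvect R 3 -> cvect R 3), [/\
    b != 0, [/\ open B, B x0 & B `<=` U],
    [/\ smooth B tau, forall i, smooth B (Z i) &
      forall i x, B x -> 'D_(Z i x) tau x = delta_mx 0 i],
    sphere_isometry A &
    forall x, B x -> half_turn (tau x 0 0) /\ A (F x) = row_mx (cnum (z1 b (tau x 0 0)))
      (row_mx (cnum (z2 b (tau x 0 0) * (cos (tau x 0 1))%:C%C))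
              (cnum (z2 b (tau x 0 0) * (sin (tau x 0 1))%:C%C)))].
Proof.
move=> Wx0 w10; have oW := open_nonminimal_set leg; have [s1 s2] := smooth_adapted leg.
have [_ sF _ _ _] := legendre_onS oW (fun x Wx => Wx.1) leg.
have u3 x (Wx : W x) := adapted_unitary leg Wx; have str x (Wx : W x) := adapted_structure leg Wx.
have C := phiH_perp_rigidity leg harm w10; have [_ sw _ _] := smooth_adapted_coefs leg.
pose w := w2 F e1 e2.
have [b [e [b0 e0 eW rE]]] : exists b e,
    [/\ 0 < b, 0 < e, ball x0 e `<=` W & forall x, ball x0 e x -> r x = b * slope w x].
  apply: ratio_ball => // x Wx; have [h1 h2 h3 h4 _] := C x Wx.
  by split; apply: (ratio_constant leg Wx sw); [right; right|left].
have oB : open (ball x0 e) by exact: ball_open.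
have Bx0 : ball x0 e x0 by exact: ballxx.
have sFB := smooth_onS eW sF; have s1B := smooth_onS eW s1; have s2B := smooth_onS eW s2.
have swB : smooth (ball x0 e) w := smooth_onS eW sw.
have span x v : ball x0 e x -> exists p q, v = p *: e1 x + q *: e2 x.
  by move=> /eW; exact: (adapted_span leg).
have u3B x (Bx : ball x0 e x) := u3 x (eW x Bx).
(* Rigidity gives [s = r] and [q = 0], so the trace relations leave [p = 2 r - s = r] and
   [t = 0]. *)
have cf x (Bx : ball x0 e x) : [/\ c111 F e1 x = b * slope w x, c112 F e1 e2 x = 0,
    c122 F e1 e2 x = b * slope w x & c222 F e2 x = 0].
  have [_ _ _ _ [hs hq]] := C x (eW x Bx); have [t1 t2] := adapted_trace leg (eW x Bx).
  rewrite -(rE x Bx) hs hq; rewrite hs in t1; rewrite hq add0r in t2; split => //; lra.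
have D11 x : ball x0 e x -> along e1 (along e1 F) x = (b * slope w x) *: J (along e1 F x) - F x.
  move=> Bx; have [-> _ _ _] := str x (eW x Bx); have [c1 c2 c3 c4] := cf x Bx; rewrite ?c1 ?c2 ?c3 ?c4.
  by rewrite w10 ?scale0r ?add0r ?addr0 //; exact: eW.
have D12 x : ball x0 e x -> along e1 (along e2 F) x = (b * slope w x) *: J (along e2 F x).
  move=> Bx; have [_ -> _ _] := str x (eW x Bx); have [c1 c2 c3 c4] := cf x Bx; rewrite ?c1 ?c2 ?c3 ?c4.
  by rewrite w10 ?oppr0 ?scale0r ?add0r ?addr0 //; exact: eW.
have D21 x : ball x0 e x ->
    along e2 (along e1 F) x = w x *: along e2 F x + (b * slope w x) *: J (along e2 F x).
  move=> Bx; have [_ _ -> _] := str x (eW x Bx); have [c1 c2 c3 c4] := cf x Bx; rewrite ?c1 ?c2 ?c3 ?c4.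
  by rewrite scale0r addr0.
have D22 x : ball x0 e x -> along e2 (along e2 F) x =
    - w x *: along e1 F x + (b * slope w x) *: J (along e1 F x) - F x.
  move=> Bx; have [_ _ _ ->] := str x (eW x Bx); have [c1 c2 c3 c4] := cf x Bx; rewrite ?c1 ?c2 ?c3 ?c4.
  by rewrite scale0r addr0.
have D1w x : ball x0 e x -> along e1 w x = - (1 + w x ^+ 2).
  by move=> Bx; have [_ _ _ h _] := C x (eW x Bx).
have D2w x : ball x0 e x -> along e2 w x = 0.
  by move=> Bx; have [_ _ h _ _] := C x (eW x Bx).
have [a [y [a0 aB sy Dy pE]]] :=
  perp_integrate oB sFB s1B s2B swB span u3B D11 D12 D21 D22 D1w D2w Bx0.
have oA : open (ball x0 a) by exact: ball_open.
have sX := smooth_onS aB (smooth_perp_x oB swB).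
have sq0 x : perp_radius b * slope w x != 0.
  by rewrite gt_eqF // mulr_gt0 ?slope_gt0 // sqrtr_gt0 ltr_pwDl // sqr_ge0.
(* The rescaling makes [Y] the coordinate field of [y], whose derivative along [e2] is
   [ra * slope]. *)
pose Y x : V := (perp_radius b * slope w x)^-1 *: e2 x.
have sY : smooth (ball x0 a) Y.
  apply: (smoothZ oA); last exact: smooth_onS aB s2B.
  apply: (smoothV oA) => //; apply: (smoothM oA); first exact: smooth_cst.
  exact: smooth_onS aB (smooth_slope oB swB).
have [tau [Z [st sZ tZ tE]]] : exists (tau : V -> V) (Z : 'I_2 -> V -> V),
    [/\ smooth (ball x0 a) tau, forall i, smooth (ball x0 a) (Z i),
    forall i x, ball x0 a x -> 'D_(Z i x) tau x = delta_mx 0 i &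
    forall x, tau x 0 0 = perp_x w x /\ tau x 0 1 = y x].
  apply: (planar_coordinates oA sX sy (smooth_onS aB s1B) sY) => x xa.
    have [-> _] := along_perp_x swB D1w D2w (aB x xa).
    by have [-> _] := Dy x xa.
  have dX := smooth_differentiable sX xa; have dy := smooth_differentiable sy xa.
  have EY (f : V -> R) : differentiable f x ->
      along Y f x = (perp_radius b * slope w x)^-1 * along e2 f x.
    by move=> df; rewrite -[LHS]/(der f x (Y x)) /Y derive_dirZ.
  rewrite !EY //; have [_ ->] := along_perp_x swB D1w D2w (aB x xa).
  by have [_ ->] := Dy x xa; rewrite mulr0 mulVf.
have u30 := perp_unitary w b u3B Bx0.
exists b, (ball x0 a), tau, Z, (unitary_coord (perp_e F e1 w b x0) (perp_m F e1 w b x0) (perp_n F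
  e2 w b x0)).
split => //; first by rewrite gt_eqF.
- by split => // [|x /aB/eW[]//]; exact: ballxx.
- exact: unitary_coord_isometry.
move=> x xa; have [-> ->] := tE x; have [cx sx] := perp_x_trig w x.
have hx : half_turn (perp_x w x).
  by have := atan_def (- w x); rewrite /half_turn /perp_x => -[].
split => //.
(* [sec] and [tan] of [perp_x] are [slope] and [- w], which matches the exponent of [z2]. *)
have ph : b * ln (sec (perp_x w x) + tan (perp_x w x)) = perp_phase w b x.
  rewrite /sec /tan cx sx /perp_phase invrK -mulrA mulVf ?mulr1 //.
  by rewrite gt_eqF // slope_gt0.
have [eE mE] := pE x xa.
rewrite [F x](perp_position (U := ball x0 e) F e1 w b (aB x xa)) eE mE !z1E !z2E ph cx sx.
rewrite -/(perp_radius b).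
have /= [c1 c2 c3 c4 [c5 c6]] := unitary_coord_sum u30
  (- w x / slope w x / perp_radius b) (b / perp_radius b)
  (cos (perp_phase w b x) / slope w x / perp_radius b * cos (y x))
  (sin (perp_phase w b x) / slope w x / perp_radius b * cos (y x))
  (cos (perp_phase w b x) / slope w x / perp_radius b * sin (y x))
  (sin (perp_phase w b x) / slope w x / perp_radius b * sin (y x)).
set u := (X in unitary_coord _ _ _ X).
set u' := (X in unitary_coord _ _ _ X 0 0 = _) in c1.
have uu' : u = u'.
  rewrite /u /u' /rot; move: (perp_e F e1 w b x0) (perp_m F e1 w b x0) (perp_n F e2 w b x0) => e' m n.
  rewrite JD !JZ; move: (J e') (J m) (J n) => je jm jn.
  by apply/matrixP => i j; rewrite !mxE; ring.
by rewrite uu'; apply: row_mx111P; rewrite ?(c1, c2, c3, c4, c5, c6); simpc => /=.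
Qed.

Lemma phiH_local_form x0 : W x0 -> (forall x, W x -> w2 F e1 e2 x = 0) ->
  exists (k : R) (B : set V) (tau : V -> V) (Z : 'I_2 -> V -> V) (A : cvect R 3 -> cvect R 3),
  [/\ 0 < k, [/\ open B, B x0 & B `<=` U],
    [/\ smooth B tau, forall i, smooth B (Z i) &
      forall i x, B x -> 'D_(Z i x) tau x = delta_mx 0 i],
    sphere_isometry A &
    forall x, B x -> A (F x) = row_mx (cos (tau x 0 0) *: circle_curve k (tau x 0 1))
      (cnum (sin (tau x 0 0))%:C%C)].
Proof.
move=> Wx0 w20; have oW := open_nonminimal_set leg; have [s1 s2] := smooth_adapted leg.
have [_ sF _ _ _] := legendre_onS oW (fun x Wx => Wx.1) leg.
have u3 x (Wx : W x) := adapted_unitary leg Wx; have str x (Wx : W x) := adapted_structure leg Wx.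
have C := phiH_rigidity leg harm w20; have [sw _ _ _] := smooth_adapted_coefs leg.
pose w := w1 F e1 e2.
have [b [e [b0 e0 eW rE]]] : exists b e,
    [/\ 0 < b, 0 < e, ball x0 e `<=` W & forall x, ball x0 e x -> r x = b * slope w x].
  apply: ratio_ball => // x Wx; have [h1 h2 h3 h4 _] := C x Wx.
  by split; apply: (ratio_constant leg Wx sw); [left|right; left].
have oB : open (ball x0 e) by exact: ball_open.
have Bx0 : ball x0 e x0 by exact: ballxx.
have sFB := smooth_onS eW sF; have s1B := smooth_onS eW s1; have s2B := smooth_onS eW s2.
have swB : smooth (ball x0 e) w := smooth_onS eW sw.
have span x v : ball x0 e x -> exists p q, v = p *: e1 x + q *: e2 x.
  by move=> /eW; exact: (adapted_span leg).
have u3B x (Bx : ball x0 e x) := u3 x (eW x Bx).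
(* Here [s = q = 0], so [p = 2 r] carries the whole trace; this factor [2] reappears in the
   curvature [2 k] of the model curve. *)
have cf x (Bx : ball x0 e x) : [/\ c111 F e1 x = 2 * (b * slope w x), c112 F e1 e2 x = 0,
    c122 F e1 e2 x = 0 & c222 F e2 x = 0].
  have [_ _ _ _ [hs hq]] := C x (eW x Bx); have [t1 t2] := adapted_trace leg (eW x Bx).
  by rewrite -(rE x Bx) hs hq; rewrite hs addr0 in t1; rewrite hq add0r in t2; split.
have D11 x : ball x0 e x -> along e1 (along e1 F) x =
    w x *: along e2 F x + (2 * (b * slope w x)) *: J (along e1 F x) - F x.
  move=> Bx; have [-> _ _ _] := str x (eW x Bx); have [c1 c2 c3 c4] := cf x Bx; rewrite ?c1 ?c2 ?c3 ?c4.
  by rewrite scale0r addr0.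
have D12 x : ball x0 e x -> along e1 (along e2 F) x = - w x *: along e1 F x.
  move=> Bx; have [_ -> _ _] := str x (eW x Bx); have [c1 c2 c3 c4] := cf x Bx; rewrite ?c1 ?c2 ?c3 ?c4.
  by rewrite !scale0r !addr0.
have D21 x : ball x0 e x -> along e2 (along e1 F) x = 0.
  move=> Bx; have [_ _ -> _] := str x (eW x Bx); have [c1 c2 c3 c4] := cf x Bx; rewrite ?c1 ?c2 ?c3 ?c4.
  by rewrite w20 ?scale0r ?addr0 //; exact: eW.
have D22 x : ball x0 e x -> along e2 (along e2 F) x = - F x.
  move=> Bx; have [_ _ _ ->] := str x (eW x Bx); have [c1 c2 c3 c4] := cf x Bx; rewrite ?c1 ?c2 ?c3 ?c4.
  by rewrite w20 ?oppr0 ?scale0r ?add0r //; exact: eW.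
have D1w x : ball x0 e x -> along e1 w x = 0.
  by move=> Bx; have [_ _ h _ _] := C x (eW x Bx).
have D2w x : ball x0 e x -> along e2 w x = 1 + w x ^+ 2.
  by move=> Bx; have [_ _ _ h _] := C x (eW x Bx).
have [a [y [a0 aB sy Dy pE]]] :=
  latitude_integrate oB sFB s1B s2B swB b0 span u3B D11 D12 D21 D22 D1w D2w Bx0.
have oA : open (ball x0 a) by exact: ball_open.
have sX := smooth_onS aB (smooth_latitude oB swB).
have sq0 x : slope w x != 0 by rewrite gt_eqF // slope_gt0.
pose Y x : V := (slope w x)^-1 *: e1 x.
have sY : smooth (ball x0 a) Y.
  apply: (smoothZ oA); last exact: smooth_onS aB s1B.
  by apply: (smoothV oA) => //; exact: smooth_onS aB (smooth_slope oB swB).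
have [tau [Z [st sZ tZ tE]]] : exists (tau : V -> V) (Z : 'I_2 -> V -> V),
    [/\ smooth (ball x0 a) tau, forall i, smooth (ball x0 a) (Z i),
    forall i x, ball x0 a x -> 'D_(Z i x) tau x = delta_mx 0 i &
    forall x, tau x 0 0 = latitude w x /\ tau x 0 1 = y x].
  apply: (planar_coordinates oA sX sy (smooth_onS aB s2B) sY) => x xa.
    have [_ ->] := along_latitude swB D1w D2w (aB x xa).
    by have [_ ->] := Dy x xa.
  have dX := smooth_differentiable sX xa; have dy := smooth_differentiable sy xa.
  have EY (f : V -> R) : differentiable f x -> along Y f x = (slope w x)^-1 * along e1 f x.
    by move=> df; rewrite -[LHS]/(der f x (Y x)) /Y derive_dirZ.
  rewrite !EY //; have [-> _] := along_latitude swB D1w D2w (aB x xa).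
  by have [-> _] := Dy x xa; rewrite mulr0 mulVf.
have u30 := latitude_unitary w u3B Bx0.
exists b, (ball x0 a), tau, Z,
  (unitary_coord (equator F e2 w x0) (along e1 F x0) (pole F e2 w x0)).
split => //.
- by split => // [|x /aB/eW[]//]; exact: ballxx.
- exact: unitary_coord_isometry.
move=> x xa; have [-> ->] := tE x; have [cx sx] := latitude_trig w x.
have [zE mE] := pE x xa.
rewrite [F x](latitude_position F e2 w x) zE mE cx sx /circle_curve scale_pair.
have /= [c1 c2 c3 c4 [c5 c6]] := unitary_coord_sum u30
  ((slope w x)^-1 * al0 b (y x)) ((slope w x)^-1 * al1 b (y x))
  ((slope w x)^-1 * be0 b (y x)) ((slope w x)^-1 * be1 b (y x)) (w x / slope w x) 0.
set u := (X in unitary_coord _ _ _ X).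
set u' := (X in unitary_coord _ _ _ X 0 0 = _) in c1.
have uu' : u = u'.
  rewrite /u /u' /rot scale0r addr0.
  move: (equator F e2 w x0) (along e1 F x0) (pole F e2 w x0) => e' m n.
  move: (J e') (J m) => je jm.
  by apply/matrixP => i j; rewrite !mxE; ring.
by rewrite uu'; apply: row_mx21P; [apply: ord2P|apply: ord2P|..];
  rewrite ?(c1, c2, c3, c4, c5, c6) ?mxE.
Qed.

End LocalForms.

Lemma is_interval_half_turn (R : realType) : is_interval (@half_turn R).
Proof.
move=> x y /andP[x1 _] /andP[_ y2] z /andP[xz zy].
by apply/andP; split; [exact: lt_le_trans xz|exact: le_lt_trans y2].
Qed.

Theorem theorem1 (R : realType) (M : topologicalType)
    (M_hausdorff : hausdorff_space M)
    (M_second_countable : @second_countable M)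
    (M_connected : connected [set: M])
    (S : smooth_structure R M 2) (f : M -> cvect R 3)
    (f_legendre : legendre_immersion S f)
    (f_nonminimal : ~ minimal S f)
    (f_harmonic : harmonic_mean_curvature_vector S f) :
  [/\ ~ constant_mean_curvature S f,
      in_charts S f (fun F _ x => mean_curvature_constant_along_phiH F x) ->
      forall p : M, exists (c : chart R M 2) (A : cvect R 3 -> cvect R 3)
          (I : set R) (z : R -> cvect R 2),
        [/\ atlas S c /\ dom c p,
            sphere_isometry A,
            open_interval I /\ unit_speed_legendre_curve I z,
            exists2 k : R, k != 0 &
              forall t, I t -> geodesic_curvature z t = k &
            forall u : 'rV[R]_2, cod c u ->
              let x := u 0 0 in let y := u 0 1 in
              I y /\ A (f (param c u)) =
                row_mx (cos x *: z y) (cnum (sin x)%:C%C)] &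
      in_charts S f (fun F _ x => mean_curvature_constant_along_phiH_perp F x) ->
      forall p : M, exists (c : chart R M 2) (A : cvect R 3 -> cvect R 3)
          (I : set R) (b : R),
        [/\ atlas S c /\ dom c p,
            sphere_isometry A /\ b != 0,
            open_interval I /\ (forall t, I t -> 0 < cos t),
            unit_speed_legendre_curve I
              (fun t => row_mx (cnum (z1 b t)) (cnum (z2 b t))) &
            forall u : 'rV[R]_2, cod c u ->
              let x := u 0 0 in let y := u 0 1 in
              I x /\ A (f (param c u)) =
                row_mx (cnum (z1 b x))
                  (row_mx (cnum (z2 b x * (cos y)%:C%C))
                          (cnum (z2 b x * (sin y)%:C%C)))]].
Proof.
have leg c : atlas S c -> legendre_on (cod c) (f \o param c) := chart_legendre f_legendre (c := c).
have harm c : atlas S c -> harmonic_on (cod c) (f \o param c).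
  move=> Sc W e x oW sub Wx eF.
  exact: (f_harmonic c x Sc (sub x Wx) W e oW sub Wx eF).
split.
- move=> [k hk]; apply: f_nonminimal => c x Sc cx.
  have W0 := constant_mean_curvature_minimal (leg c Sc) (harm c Sc) (fun x => hk c x Sc).
  apply/eqP; apply: contraT; rewrite -dot_gt0 => Hx.
  by have : nonminimal_set (cod c) (f \o param c) x by []; rewrite W0.
- move=> h p.
  have w20 c (Sc : atlas S c) x : nonminimal_set (cod c) (f \o param c) x ->
      w2 (f \o param c) (adapted1 (f \o param c)) (adapted2 (f \o param c)) x = 0.
    move=> Wx; apply: (constant_along_phiH (leg c Sc) (harm c Sc) Wx).
    by apply: h => //; case: Wx.
  have [c0 Sc0 dp] := atlas_cover S p.
  have Wp : nonminimal_set (cod c0) (f \o param c0) (Defs.coord c0 p).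
    (* The local form is available only where [H] is nonzero; propagation makes this hold at the
       arbitrary point [p]. *)
    apply: (mean_curvature_nowhere_zero f_legendre M_connected f_nonminimal _ Sc0 (coord_cod dp)).
    move=> c x0 e Sc sub x0e Wx0; have [sw _ _ _] := smooth_adapted_coefs (leg c Sc).
    apply: (nonminimal_propagates (leg c Sc) sub Wx0 x0e sw) => x Wx.
    have [h1 h2 h3 h4 _] := phiH_rigidity (leg c Sc) (harm c Sc) (w20 c Sc) Wx.
    by split; apply: (ratio_constant (leg c Sc) Wx sw); [left|right; left].
  have [k [B [tau [Z [A [k0 [oB Bp BU] [st sZ tZ] isoA FA]]]]]] :=
    phiH_local_form (leg c0 Sc0) (harm c0 Sc0) Wp (w20 c0 Sc0).
  have [c [Sc dcp cE]] := coordinates_chart Sc0 dp oB BU Bp st sZ tZ.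
  have [leg_z curv_z] := circle_curve_legendre k0.
  (* The model curve is defined on the whole line, and its curvature [2 k] is nonzero because
     [k > 0]. *)
  exists c, A, setT, (circle_curve k); split => //.
  + by split => //; split; [exact: openT|].
  + by exists (2 * k) => //; rewrite gt_eqF // mulr_gt0.
  + by move=> u /cE[x [Bx <- ->]]; split => //; exact: FA.
- move=> h p.
  have w10 c (Sc : atlas S c) x : nonminimal_set (cod c) (f \o param c) x ->
      w1 (f \o param c) (adapted1 (f \o param c)) (adapted2 (f \o param c)) x = 0.
    move=> Wx; apply: (constant_along_phiH_perp (leg c Sc) Wx).
    by apply: h => //; case: Wx.
  have [c0 Sc0 dp] := atlas_cover S p.
  have Wp : nonminimal_set (cod c0) (f \o param c0) (Defs.coord c0 p).
    apply: (mean_curvature_nowhere_zero f_legendre M_connected f_nonminimal _ Sc0 (coord_cod dp)).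
    move=> c x0 e Sc sub x0e Wx0; have [_ sw _ _] := smooth_adapted_coefs (leg c Sc).
    apply: (nonminimal_propagates (leg c Sc) sub Wx0 x0e sw) => x Wx.
    have [h1 h2 h3 h4 _] := phiH_perp_rigidity (leg c Sc) (harm c Sc) (w10 c Sc) Wx.
    by split; apply: (ratio_constant (leg c Sc) Wx sw); [right; right|left].
  have [b [B [tau [Z [A [b0 [oB Bp BU] [st sZ tZ] isoA FA]]]]]] :=
    phiH_perp_local_form (leg c0 Sc0) (harm c0 Sc0) Wp (w10 c0 Sc0).
  have [c [Sc dcp cE]] := coordinates_chart Sc0 dp oB BU Bp st sZ tZ.
  exists c, A, (@half_turn R), b; split => //.
  + split; last exact: cos_half_turn.
    by split; [exact: open_half_turn|exact: is_interval_half_turn].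
  + exact: secant_curve.
  + by move=> u /cE[x [Bx <- ->]]; have [] := FA x Bx.
Qed.
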